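(* Let $J$ be a positive-definite (symmetric) $n\times n$ matrix which is ferromagnetic, i.e. $J_{i,j}\ge 0$ for all $i\ne j$, and let $v\in\mathbb R^n$. Then $$\rho_{\mathrm{LS}}\bigl(P^{\mathrm{GD}}(\nu_{J,v})\bigr)\ge\frac1n\exp\left(-2\|J\|_{\mathrm{OP}}\int_0^1\chi(\lambda)\,d\lambda\right),$$ where $\chi(\lambda)=\|\mathrm{Cov}(\nu_{\lambda J,0})\|_{\mathrm{OP}}$ for $\lambda\in(0,1)$.
   Context: For a symmetric $n\times n$ matrix $J$ and $v\in\mathbb R^n$, $\nu_{J,v}$ is the Ising measure on $\{-1,1\}^n$ given by $\nu_{J,v}(\{x\})\propto\exp(\langle x,Jx\rangle+\langle x,v\rangle)$. $\mathrm{Cov}(\nu)$ denotes the covariance matrix of $\nu$ and $\|\cdot\|_{\mathrm{OP}}$ the operator norm. Glauber dynamics: for a probability measure $\nu$ on $\{-1,1\}^n$, $P^{\mathrm{GD}}(\nu)$ is the Markov kernel on the support of $\nu$ with $P^{\mathrm{GD}}_{x\to y}(\nu)=\frac1n\frac{\nu(y)}{\nu(x)+\nu(y)}$ if $x,y$ differ in exactly one coordinate, $P^{\mathrm{GD}}_{x\to x}(\nu)=\frac1n\sum_{i=1}^n\frac{\nu(x)}{\nu(x)+\nu(x\oplus e_i)}$ where $x\oplus e_i$ is $x$ with coordinate $i$ flipped, and $0$ otherwise. Modified log-Sobolev (MLSI) coefficient of a reversible kernel $P$ with stationary measure $\nu$: $\rho_{\mathrm{LS}}(P)=1-\sup_{f:\Omega\to[0,\infty)}\frac{\mathrm{Ent}_\nu[Pf]}{\mathrm{Ent}_\nu[f]}$,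 supremum over $f$ with $\mathrm{Ent}_\nu[f]>0$, where $\mathrm{Ent}_\nu[f]=\int f\log f\,d\nu-\int f\,d\nu\,\log\int f\,d\nu$. *)

(* Defs.v *)
(* MathComp + MathComp-Analysis, over an abstract R : realType. *)
From mathcomp Require Import all_boot all_order all_algebra.
From mathcomp Require Import all_classical all_reals all_analysis.

Set Implicit Arguments.
Unset Strict Implicit.
Unset Printing Implicit Defensive.

Import Order.TTheory GRing.Theory Num.Theory.
Import numFieldNormedType.Exports.

Local Open Scope classical_set_scope.
Local Open Scope ring_scope.

Section LinearAlgebra.
Context {R : realType} {n : nat}.

Definition inner (x y : 'cV[R]_n) : R := \sum_i x i 0 * y i 0.

(* The norm `|x| that MathComp-Analysis puts on matrices is the sup norm. *)
Definition l2norm (x : 'cV[R]_n) : R := Num.sqrt (inner x x).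

Definition opnorm (A : 'M[R]_n) : R :=
  sup [set l2norm (A *m x) | x in [set x : 'cV[R]_n | l2norm x <= 1]].

Definition posdefmx (A : 'M[R]_n) : Prop :=
  A \is symmetricmx /\ forall x : 'cV[R]_n, x != 0 -> 0 < inner x (A *m x).

Definition ferromagnetic (J : 'M[R]_n) : Prop :=
  forall i j, i != j -> 0 <= J i j.

End LinearAlgebra.

(* Probability measures on a finite type are given by their mass functions. *)
Section FiniteProbability.
Context {R : realType} {Omega : finType}.
Implicit Types (nu f : Omega -> R) (P : Omega -> Omega -> R).

Definition expect nu f : R := \sum_x nu x * f x.

(* 0 log 0 = 0, since ln 0 = 0. *)
Definition Ent nu f : R :=
  expect nu (fun x => f x * ln (f x)) - expect nu f * ln (expect nu f).

Definition kernel_app P f : Omega -> R := fun x => \sum_y P x y * f y.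

(* The modified log-Sobolev coefficient of P with stationary measure nu.  The
   supremum is taken in \bar R, so it has its usual meaning without any
   boundedness assumption (it is -oo if no f has positive entropy).  For P a
   kernel on the support of nu, it does not matter that f ranges over functions
   on all of Omega: values of f off the support change neither entropy. *)
Definition rho_LS nu P : \bar R :=
  (1 - ereal_sup [set (Ent nu (kernel_app P f) / Ent nu f)%R%:E
                 | f in [set f : Omega -> R |
                          (forall x, 0 <= f x) /\ 0 < Ent nu f]%R])%E.

End FiniteProbability.

(* The hypercube {-1,1}^n is encoded by Boolean functions: false stands for +1
   and true for -1. *)
Notation cube n := {ffun 'I_n -> bool}.

Definition spin {R : realType} {n : nat} (x : cube n) : 'cV[R]_n :=
  \col_i (-1) ^+ x i.

Definition flip {n : nat} (x : cube n) (i : 'I_n) : cube n :=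
  [ffun j => if j == i then ~~ x j else x j].

Section Cube.
Context {R : realType} {n : nat}.
Implicit Types (nu : cube n -> R) (x y : cube n).

Definition cov nu : 'M[R]_n :=
  \matrix_(i, j) (expect nu (fun x => spin x i 0 * spin x j 0)
                  - expect nu (fun x => spin x i 0)
                    * expect nu (fun x => spin x j 0)).

(* Only rows x in the support of nu are meaningful; such a row vanishes at every
   y outside the support. *)
Definition glauber nu x y : R :=
  if #|[set i | x i != y i]%SET| == 1%N then n%:R^-1 * (nu y / (nu x + nu y))
  else if x == y then n%:R^-1 * \sum_i (nu x / (nu x + nu (flip x i)))
  else 0.

Definition ising_weight (J : 'M[R]_n) (v : 'cV[R]_n) x : R :=
  expR (inner (spin x) (J *m spin x) + inner (spin x) v).

Definition ising (J : 'M[R]_n) (v : 'cV[R]_n) x : R :=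
  ising_weight J v x / \sum_y ising_weight J v y.

Definition chi (J : 'M[R]_n) (lambda : R) : R :=
  opnorm (cov (ising (lambda *: J) 0)).

End Cube.

(* Main.v *)
Require Import Defs.
From mathcomp Require Import all_boot all_order all_algebra.
From mathcomp Require Import all_classical all_reals all_analysis.
From mathcomp Require Import measurable_realfun ring lra.
Import Order.TTheory GRing.Theory Num.Theory.
Import numFieldNormedType.Exports.
Local Open Scope classical_set_scope.
Local Open Scope ring_scope.

(** Write nu(l, v) for the Ising measure with interaction l J and field v, and chi(l)
    for the norm of its covariance matrix at v = 0.  The proof follows the
    localization method: one shows that the entropy of every f >= 0 is controlled by
    the sum of its conditional entropies at single sites (approximate tensorization,
    tensorizes), with a constant c(l) that is uniform in v, and follows c(l) from
    l = 0 to l = 1.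

    At l = 0 the measure is a product measure and c = 1 (went_le_local_ent).  For the
    step from l to l + h^2, write J as a sum of squares of linear forms
    (psd_sum_squares).  Averaging nu(l, v + s) over suitable small signed multiples s
    of these forms produces nu(l + h^2, v) up to an error of order h^4
    (field_mixture_bounds).  Single-site entropies are concave in the measure, so the
    constant c survives the averaging except for the defect of concavity of the full
    entropy.  That defect is a mean square of the displacement of the tilts when the
    measure is reweighted by f (mixture_gap), to leading order h^2 times the
    quadratic form of J at the displacement of the magnetization
    (field_mixture_gap).  By a transport inequality (transport) the displacement is
    controlled by the entropy of f times the largest variance of linear functionals,
    over all fields.  Hence one step costs a factor
    exp(- 2 h^2 |J| chi(l) + O(h^3)), once it is known that the variance is largest
    in zero field.  Since chi is nondecreasing, the losses of N steps with
    h^2 = 1 / N are a lower Riemann sum of the integral of chi, up to an error that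
    vanishes as N grows (tensorizes_chi).  Finally, one step of Glauber dynamics
    averages f over a random site, and convexity of x ln x turns tensorization into
    the decay of entropy (Ent_glauber).

    Two facts about ferromagnets are used.  That chi is nondecreasing is a Griffiths
    inequality (correlation_quad_mono), proved by duplication.  That covariances are
    nonnegative in every field and largest in zero field (cov_ising_le) is the
    inequality of Ding, Song and Sun; in the form part_quotient_max it compares four
    partition functions in an arbitrary field with their values in zero field.  It is
    proved by induction on the vertices, and the induction step (four_copies) is a
    statement about one spin and three real parameters: a certain ratio of explicit
    functions is at most 1, because at a maximum above 1 the first- and second-order
    conditions would make it constant along a line that reaches the boundary, where
    the bound is known. *)

(** * Second-order conditions at a maximum *)

Section SmallParameter.
Context {R : realType}.
Implicit Types (t l q c d : R).

Lemma le0_of_le_small t0 l c : 0 < t0 ->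
  (forall t, 0 < t -> t <= t0 -> l <= c * t) -> l <= 0.
Proof.
move=> t0_gt0 H; rewrite leNgt; apply/negP => l_gt0.
have c1 : 0 < `|c| + 1 by rewrite ltr_wpDl.
have d_gt0 : 0 < l / (2 * (`|c| + 1)) by rewrite divr_gt0 // mulr_gt0.
pose t := Num.min t0 (l / (2 * (`|c| + 1))).
have t_gt0 : 0 < t by rewrite lt_min t0_gt0.
have t_le0 : t <= t0 by rewrite ge_min lexx.
have t_led : t <= l / (2 * (`|c| + 1)) by rewrite ge_min lexx orbT.
have := H _ t_gt0 t_le0; apply/negP; rewrite -ltNge.
have : c * t <= (`|c| + 1) * t.
  by rewrite ler_pM2r //; have := ler_norm c; lra.
move=> h; apply: (le_lt_trans h).
apply: (@le_lt_trans _ _ ((`|c| + 1) * (l / (2 * (`|c| + 1))))).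
  by rewrite ler_pM2l.
have -> : (`|c| + 1) * (l / (2 * (`|c| + 1))) = l / 2 by field; rewrite gt_eqF.
by lra.
Qed.

Lemma quartic_slope_le0 t0 l q c d : 0 < t0 ->
  (forall t, 0 <= t -> t <= t0 -> l * t + q * t ^+ 2 + c * t ^+ 3 + d * t ^+ 4 <= 0) ->
  l <= 0.
Proof.
move=> t0_gt0 H.
apply: (@le0_of_le_small (Num.min t0 1) _ (`|q| + `|c| + `|d|)).
  by rewrite lt_min t0_gt0 ltr01.
move=> t t_gt0; rewrite le_min => /andP[tt0 t1].
have := H t (ltW t_gt0) tt0.
rewrite (_ : l * t + _ + _ + _ = t * (l + (q * t + c * t ^+ 2 + d * t ^+ 3)));
  last by ring.
rewrite pmulr_rle0 // => Hl.
have hq : - (q * t) <= `|q| * t by rewrite -mulNr ler_pM2r // -normrN ler_norm.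
have hc : - (c * t ^+ 2) <= `|c| * t.
  apply: (@le_trans _ _ (`|c| * t ^+ 2)).
    by rewrite -mulNr ler_pM2r ?exprn_gt0 // -normrN ler_norm.
  by rewrite ler_wpM2l // expr2 ler_piMl // ltW.
have hd : - (d * t ^+ 3) <= `|d| * t.
  apply: (@le_trans _ _ (`|d| * t ^+ 3)).
    by rewrite -mulNr ler_pM2r ?exprn_gt0 // -normrN ler_norm.
  rewrite ler_wpM2l // exprS ler_piMr ?(ltW t_gt0) //.
  by rewrite -(expr1n _ 2) lerXn2r ?nnegrE ?(ltW t_gt0) //.
by rewrite !mulrDl; lra.
Qed.

(** Fermat's rule and the second-order condition at the maximum t = 0 of a quartic. *)
Lemma quartic_max0 t0 l q c d : 0 < t0 ->
  (forall t, `|t| <= t0 -> l * t + q * t ^+ 2 + c * t ^+ 3 + d * t ^+ 4 <= 0) ->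
  l = 0 /\ q <= 0.
Proof.
move=> t0_gt0 H.
have l_le0 : l <= 0.
  apply: (@quartic_slope_le0 t0 l q c d) => // t t_ge0 tt0.
  by apply: H; rewrite ger0_norm.
have l_ge0 : - l <= 0.
  apply: (@quartic_slope_le0 t0 (- l) q (- c) d) => // t t_ge0 tt0.
  have := H (- t); rewrite normrN ger0_norm // => /(_ tt0).
  by rewrite (_ : _ + _ = - l * t + q * t ^+ 2 + - c * t ^+ 3 + d * t ^+ 4) //; ring.
have l0 : l = 0 by lra.
split=> //; apply: (@quartic_slope_le0 t0 q c d 0) => // t t_ge0 tt0.
have [-> |tn0] := eqVneq t 0; first by rewrite !expr0n /= !mulr0 !addr0.
have t_gt0 : 0 < t by rewrite lt_def tn0.
rewrite -(@pmulr_rle0 _ t) //.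
have := H t; rewrite ger0_norm // => /(_ tt0).
by rewrite l0 (_ : _ + _ = t * (q * t + c * t ^+ 2 + d * t ^+ 3 + 0 * t ^+ 4)) //; ring.
Qed.

(** Parametrizing a shift by the hyperbolic tangent of its size makes all the
    functions below rational in the parameter. *)
Lemma tanh_shift t : `|t| <= 2^-1 ->
  exists d k : R, [/\ 0 < k, expR d = (1 + t) / k, expR (- d) = (1 - t) / k,
                      `|d| <= 2 * `|t| & (0 <= t -> 0 <= d)].
Proof.
have pos (u : R) : 0 <= u -> u <= 2^-1 ->
    0 <= 2^-1 * (ln (1 + u) - ln (1 - u)) <= 2 * u.
  move=> u0 u1.
  have h1 : ln (1 + u) <= u by apply: le_ln1Dx; lra.
  have h2 : - ln (1 - u) <= 2 * u.
    rewrite -lnV ?posrE; last lra.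
    have -> : (1 - u)^-1 = 1 + u / (1 - u) by field; lra.
    apply: (@le_trans _ _ (u / (1 - u))).
      apply: le_ln1Dx; have : 0 <= u / (1 - u) by rewrite divr_ge0 //; lra.
      lra.
    rewrite ler_pdivrMr; last lra.
    nra.
  have h3 : 0 <= ln (1 + u) by apply: ln_ge0; lra.
  have h4 : ln (1 - u) <= 0 by apply: ln_le0; lra.
  by apply/andP; split; lra.
move=> ht.
have /andP[t1 t2] : - 2^-1 <= t <= 2^-1 by rewrite -ler_norml.
pose d := 2^-1 * (ln (1 + t) - ln (1 - t)).
have e2d : expR d ^+ 2 * (1 - t) = 1 + t.
  rewrite expr2 -expRD (_ : d + d = ln (1 + t) - ln (1 - t)); last by rewrite /d; field.
  by rewrite expRD expRN !lnK ?posrE; [field| |]; lra.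
have ed := expR_gt0 d.
exists d, ((1 + t) / expR d); split.
- by rewrite divr_gt0 //; lra.
- by field; rewrite ?gt_eqF //=; lra.
- rewrite expRN -e2d; field; rewrite gt_eqF //=; lra.
- case: (lerP 0 t) => t0.
    have /andP[? ?] := pos t t0 t2; rewrite (ger0_norm t0).
    by rewrite ger0_norm // /d.
  have /andP[h1 h2] : 0 <= 2^-1 * (ln (1 - t) - ln (1 + t)) <= 2 * (- t).
    by have := pos (- t); rewrite opprK; apply; lra.
  rewrite (ler0_norm (ltW t0)) ler0_norm /d; lra.
- by move=> t0; have /andP[] := pos t t0 t2.
Qed.

Lemma shift_tanh (d : R) :
  exists t k : R, [/\ 0 < k, expR d = (1 + t) / k & expR (- d) = (1 - t) / k].
Proof.
have h : 0 < expR d + expR (- d) by rewrite addr_gt0 ?expR_gt0.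
exists ((expR d - expR (- d)) / (expR d + expR (- d))), (2 / (expR d + expR (- d))).
by split; [rewrite divr_gt0|field|field]; rewrite ?gt_eqF.
Qed.

End SmallParameter.

(** * The partition function of one spin *)

Section OneSite.
Context {R : realType}.
Implicit Types (x y t : R).

(** The partition function of a single spin under field y, where a and b are the
    weights of the rest of the system given that the spin is up or down. *)
Definition site y (a b : R) : R := expR y * a + expR (- y) * b.

(** The mean of that spin, which is also the logarithmic derivative of site in the
    field. *)
Definition site_mag y (a b : R) : R :=
  (expR y * a - expR (- y) * b) / site y a b.

Lemma site_gt0 y a b : 0 < a -> 0 < b -> 0 < site y a b.
Proof. by move=> a0 b0; rewrite addr_gt0 ?mulr_gt0 ?expR_gt0. Qed.

Lemma site_shift y a b d k t : 0 < a -> 0 < b -> 0 < k ->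
  expR d = (1 + t) / k -> expR (- d) = (1 - t) / k ->
  site (y + d) a b = k^-1 * site y a b * (1 + site_mag y a b * t) /\
  site (y - d) a b = k^-1 * site y a b * (1 - site_mag y a b * t).
Proof.
move=> a0 b0 k0 hd hNd.
have s0 : site y a b != 0 by rewrite gt_eqF ?site_gt0.
have e : site y a b * site_mag y a b = expR y * a - expR (- y) * b.
  by rewrite mulrC divfK.
split.
  rewrite -mulrA mulrDr mulr1 mulrA e /site opprD !expRD hd hNd; field.
  by rewrite gt_eqF.
rewrite -mulrA mulrBr mulr1 mulrA e /site opprB !expRD.
by rewrite hd hNd; field; rewrite gt_eqF.
Qed.

Lemma continuous_site (T : topologicalType) (f : T -> R) a b :
  continuous f -> continuous (fun z => site (f z) a b).
Proof.
move=> cf z; apply: cvgD; apply: cvgM; try exact: cvg_cst.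
  by apply: continuous_comp; [exact: cf|exact: continuous_expR].
apply: (@continuous_comp _ _ _ (fun z => - f z) expR); last exact: continuous_expR.
by apply: cvgN; exact: cf.
Qed.

Lemma shift_itv x lo hi r d : - r <= d -> d <= r -> r <= x - lo -> r <= hi - x ->
  lo <= x + d <= hi.
Proof. by move=> *; apply/andP; split; lra. Qed.

Lemma amgm x y t : 0 <= x -> 0 <= y -> t ^+ 2 <= x * y -> 2 * t <= x + y.
Proof.
move=> x0 y0 h; case: (lerP t 0) => t0; first lra.
rewrite -(@ler_pXn2r _ 2) ?nnegrE //; [|lra|lra].
by have := sqr_ge0 (x - y); nra.
Qed.

End OneSite.

(** * The inequality for four copies of one spin *)

Local Ltac nneg :=
  solve [repeat first [ assumption | exact: expR_ge0 | by apply: ltW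
                      | apply: exprn_ge0 | apply: divr_ge0 | apply: mulr_ge0 ]].

(** This section is the induction step of part_quotient_max: it restores one spin.
    The constants a1, b1, ..., a4, b4 are partition functions without that spin, in
    the four combinations h + J + K, h + J - K, h - J + K and h - J - K of external
    fields, the letters a and b recording the sign of the spin; P, N and p, n play
    the same part for J + K and J - K, and q0 is the squared quotient of the
    partition functions in the fields J + K and J - K.  The variables w, j, k are
    the values of h, J, K at the spin. *)
Section FourCopies.
Context {R : realType}.
Variables (a1 b1 a2 b2 a3 b3 a4 b4 P N p n q0 : R).
Hypotheses (a1_gt0 : 0 < a1) (b1_gt0 : 0 < b1) (a2_gt0 : 0 < a2)
  (b2_gt0 : 0 < b2) (a3_gt0 : 0 < a3) (b3_gt0 : 0 < b3) (a4_gt0 : 0 < a4)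
  (b4_gt0 : 0 < b4) (P_gt0 : 0 < P) (N_gt0 : 0 < N) (p_gt0 : 0 < p)
  (n_gt0 : 0 < n) (q0_gt0 : 0 < q0).

Let num w j k := site (w + (j + k)) a1 b1 * site (w - (j + k)) a4 b4
                 * site (j - k) p n ^+ 2.
Let den w j k := site (w + (j - k)) a2 b2 * site (w - (j - k)) a3 b3
                 * site (j + k) P N ^+ 2.

Let num_gt0 w j k : 0 < num w j k.
Proof. by rewrite !mulr_gt0 ?exprn_gt0 ?site_gt0. Qed.
Let den_gt0 w j k : 0 < den w j k.
Proof. by rewrite !mulr_gt0 ?exprn_gt0 ?site_gt0. Qed.

(* H0 is the case of fewer sites carrying J, H1 to H3' are the inequality itself
   without the spin, H4 is part_vertex_mono and H5 is part_spread. *)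
Hypothesis H0 : forall w k, 0 <= k -> num w 0 k <= den w 0 k.
Hypothesis H1 : a1 * b4 * p ^+ 2 <= a2 * b3 * P ^+ 2.
Hypothesis H2 : a1 * b4 * n ^+ 2 <= b2 * a3 * P ^+ 2.
Hypothesis H3 : a1 * a4 <= q0 * (a2 * a3).
Hypothesis H3' : b1 * b4 <= q0 * (b2 * b3).
Hypothesis H4 : forall j k, 0 <= j -> 0 <= k ->
  q0 * site (j - k) p n ^+ 2 <= site (j + k) P N ^+ 2.
Hypothesis H5 : N * p <= P * n.

(* Here m1, ..., m4, pp, qq are the magnetizations at a maximum of the ratio and the
   three hypotheses are maximality along w, j and k.  The first-order conditions
   leave the parameters mu, A, A0, B below; the second-order condition in j then
   reads B (A0 - A) <= 0 while the one-sided first-order condition in k reads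
   A <= A0, so that A = A0 unless B = 0, and then mu = 0.  In both cases the two sides of the
   maximality condition along j turn out to be the same function of t. *)
Let crit (m1 m2 m3 m4 pp qq e : R) :
  0 < e -> qq <= pp ->
  (forall t, `|t| <= e -> (1 + m1 * t) * (1 + m4 * t) <= (1 + m2 * t) * (1 + m3 * t)) ->
  (forall t, `|t| <= e -> (1 + m1 * t) * (1 - m4 * t) * (1 + qq * t) ^+ 2
                       <= (1 + m2 * t) * (1 - m3 * t) * (1 + pp * t) ^+ 2) ->
  (forall t, 0 <= t -> t <= e ->
      (1 + m1 * t) * (1 - m4 * t) * (1 - qq * t) ^+ 2
      <= (1 - m2 * t) * (1 + m3 * t) * (1 + pp * t) ^+ 2) ->
  (m1 = m2 /\ m3 = m4 /\ pp = qq) \/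
  (m1 = pp /\ m4 = - pp /\ m2 = qq /\ m3 = - qq).
Proof.
move=> e0 qp Hw Hj Hk.
have [lw _] := @quartic_max0 R e (m1 + m4 - m2 - m3) (m1 * m4 - m2 * m3) 0 0 e0
  (fun t ht => ltac:(have := Hw t ht; nra)).
have [lj qj] := @quartic_max0 R e (m1 - m4 + 2 * qq - m2 + m3 - 2 * pp)
  (- (m1 * m4) + 2 * qq * (m1 - m4) + qq ^+ 2
   + m2 * m3 - 2 * pp * (m2 - m3) - pp ^+ 2)
  (- (2 * qq * m1 * m4) + qq ^+ 2 * (m1 - m4)
   + 2 * pp * m2 * m3 - pp ^+ 2 * (m2 - m3))
  (- (qq ^+ 2 * m1 * m4) + pp ^+ 2 * m2 * m3) e0
  (fun t ht => ltac:(have := Hj t ht; rewrite -subr_le0; congr (is_true (_ <= 0)); ring)).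
have lk := @quartic_slope_le0 R e (m1 - m4 - 2 * qq + m2 - m3 - 2 * pp)
  (- (m1 * m4) - 2 * qq * (m1 - m4) + qq ^+ 2
   + m2 * m3 + 2 * pp * (m2 - m3) - pp ^+ 2)
  ((2 * qq * m1 * m4) + qq ^+ 2 * (m1 - m4)
   + 2 * pp * m2 * m3 + pp ^+ 2 * (m2 - m3))
  (- (qq ^+ 2 * m1 * m4) + pp ^+ 2 * m2 * m3) e0
  (fun t t0 ht => ltac:(have := Hk t t0 ht; rewrite -subr_le0; congr (is_true (_ <= 0)); ring)).
pose mu := (m1 + m4) / 2; pose A := (m1 - m4) / 4 + (m2 - m3) / 4.
pose B := (pp - qq) / 2; pose A0 := (pp + qq) / 2.
have B0 : 0 <= B by rewrite /B; lra.
have e1 : m1 = mu + A + B by rewrite /mu /A /B; lra.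
have e4 : m4 = mu - A - B by rewrite /mu /A /B; lra.
have e2 : m2 = mu + A - B by rewrite /mu /A /B; lra.
have e3 : m3 = mu - A + B by rewrite /mu /A /B; lra.
have ep : pp = A0 + B by rewrite /A0 /B; lra.
have eq : qq = A0 - B by rewrite /A0 /B; lra.
have AA0 : A <= A0 by rewrite /A /A0; lra.
clearbody mu A B A0.
have [Bz|Bn] := eqVneq B 0.
  by left; rewrite e1 e2 e3 e4 ep eq Bz; repeat split; ring.
have Bp : 0 < B by rewrite lt_def Bn.
have AE : A = A0.
  apply/eqP; rewrite eq_le AA0 /=.
  have : 4 * B * (A0 - A) <= 0.
    by move: qj; subst; congr (is_true (_ <= 0)); ring.
  by rewrite pmulr_rle0 ?subr_le0 //; lra.
have mu0 : mu = 0.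
  apply/eqP; rewrite -sqrf_eq0; apply/eqP/le_anti; rewrite sqr_ge0 andbT.
  pose t := Num.min e (2^-1 / (`|pp| + `|qq| + 1)).
  have s0 : 0 < `|pp| + `|qq| + 1 by rewrite ltr_wpDl // addr_ge0.
  have t0 : 0 < t by rewrite lt_min e0 divr_gt0.
  have te : t <= e by rewrite ge_min lexx.
  have ts : t * (`|pp| + `|qq| + 1) <= 2^-1.
    by rewrite -ler_pdivlMr // /t ge_min lexx orbT.
  have tb x : `|x| <= `|pp| + `|qq| -> 2^-1 <= 1 + x * t.
    move=> hx; have : `|x * t| <= 2^-1.
      rewrite normrM (gtr0_norm t0) mulrC; apply: le_trans ts.
      by rewrite ler_pM2l //; lra.
    by rewrite ler_norml => /andP[]; lra.
  have hp := tb pp ltac:(rewrite lerDl //).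
  have hq := tb qq ltac:(rewrite lerDr //).
  have := Hj t; rewrite gtr0_norm // => /(_ te); rewrite -subr_ge0.
  rewrite (_ : _ - _ = - (mu ^+ 2 * (t ^+ 2 * ((1 + pp * t) ^+ 2 - (1 + qq * t) ^+ 2)))); last first.
    by subst; ring.
  have : 0 < (1 + pp * t) ^+ 2 - (1 + qq * t) ^+ 2.
    have : 0 < (pp - qq) * t by rewrite mulr_gt0 //; lra.
    nra.
  move=> h; rewrite oppr_ge0 pmulr_lle0 // mulr_gt0 // exprn_gt0 //.
by right; subst; repeat split; ring.
Qed.

(* The numerator exceeds the denominator by at most c times the squared partition
   function in the field j - k; the bounds in lower show that this becomes negligible
   against the denominator when the absolute value of w or j + k is large. *)
Let c := q0 * (2 * (p * n * (a1 * b4) / P ^+ 2)) + b1 * a4.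

Let prod_ge w : p * n * (a1 * b4) / P ^+ 2 * 2 <=
  expR w ^+ 2 * (a2 * a3) + expR (- w) ^+ 2 * (b2 * b3).
Proof.
rewrite mulrC; apply: amgm; try nneg.
rewrite [leRHS](_ : _ = (a2 * b3) * (b2 * a3)); last first.
  have : expR w * expR (- w) = 1 by rewrite expRN divff ?gt_eqF ?expR_gt0.
  move=> h; transitivity ((expR w * expR (- w)) ^+ 2 * ((a2 * b3) * (b2 * a3))).
    by ring.
  by rewrite h expr1n mul1r.
have P2 : 0 < P ^+ 2 by rewrite exprn_gt0.
rewrite [leLHS](_ : _ = (a1 * b4 * p ^+ 2 / P ^+ 2) * (a1 * b4 * n ^+ 2 / P ^+ 2)).
  by apply: ler_pM; try nneg; rewrite ler_pdivrMr.
by field; rewrite gt_eqF.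
Qed.

Let expand2 w y (A B C D : R) : site (w + y) A B * site (w - y) C D =
  expR w ^+ 2 * (A * C) + expR (- w) ^+ 2 * (B * D)
  + expR y ^+ 2 * (A * D) + expR (- y) ^+ 2 * (B * C).
Proof.
have hw : expR w * expR (- w) = 1 by rewrite expRN divff ?gt_eqF ?expR_gt0.
have hy : expR y * expR (- y) = 1 by rewrite expRN divff ?gt_eqF ?expR_gt0.
rewrite /site opprB opprD !expRD.
transitivity (expR w ^+ 2 * (A * C) * (expR y * expR (- y))
  + expR (- w) ^+ 2 * (B * D) * (expR y * expR (- y))
  + expR y ^+ 2 * (A * D) * (expR w * expR (- w))
  + expR (- y) ^+ 2 * (B * C) * (expR w * expR (- w))); first by ring.
by rewrite hw hy; ring.
Qed.

Let site2 y (A B : R) : site y A B ^+ 2 =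
  expR y ^+ 2 * A ^+ 2 + expR (- y) ^+ 2 * B ^+ 2 + 2 * (A * B).
Proof.
have hy : expR y * expR (- y) = 1 by rewrite expRN divff ?gt_eqF ?expR_gt0.
transitivity (expR y ^+ 2 * A ^+ 2 + expR (- y) ^+ 2 * B ^+ 2
   + 2 * (A * B) * (expR y * expR (- y))); first by rewrite /site; ring.
by rewrite hy; ring.
Qed.

Let bound w j k : 0 <= j -> 0 <= k ->
  num w j k <= den w j k + c * site (j - k) p n ^+ 2.
Proof.
move=> j0 k0; rewrite /num /den !expand2.
have h4 := H4 _ _ j0 k0; have hp := prod_ge w.
set D0 := site (j - k) p n ^+ 2 in h4 *; set N0 := site (j + k) P N ^+ 2 in h4 *.
have D00 : 0 < D0 by rewrite exprn_gt0 // site_gt0.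
set W := expR w ^+ 2 * (a2 * a3) + _ in hp *.
set e := p * n * (a1 * b4) / P ^+ 2 in hp *.
have P2 : 0 < P ^+ 2 by rewrite exprn_gt0.
have e0 : 0 <= e by nneg.
have N0P : expR (j + k) ^+ 2 * P ^+ 2 <= N0.
  rewrite /N0 site2 -addrA lerDl addr_ge0 // ?mulr_ge0 ?exprn_ge0 ?expR_ge0 // ltW //.
have NWle : expR w ^+ 2 * (a1 * a4) + expR (- w) ^+ 2 * (b1 * b4) <= q0 * W.
  rewrite mulrDr; apply: lerD; rewrite [leRHS]mulrCA ler_wpM2l ?exprn_ge0 ?expR_ge0 //.
have Yle : expR (- (j + k)) ^+ 2 * (b1 * a4) <= b1 * a4.
  apply: ler_piMl; first nneg; apply: exprn_ile1; first nneg.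
  by rewrite -expR0 ler_expR; lra.
set Dp := expR (j - k) ^+ 2 * (a2 * b3); set Dm := expR (- (j - k)) ^+ 2 * (b2 * a3).
have Dle : a1 * b4 / P ^+ 2 * D0 - 2 * e <= Dp + Dm.
  rewrite /D0 site2 (_ : _ - _ = expR (j - k) ^+ 2 * (a1 * b4 * p ^+ 2 / P ^+ 2)
      + expR (- (j - k)) ^+ 2 * (a1 * b4 * n ^+ 2 / P ^+ 2)); last first.
    by rewrite /e; field; rewrite gt_eqF.
  by apply: lerD; rewrite ler_wpM2l ?exprn_ge0 ?expR_ge0 // ler_pdivrMr.
set X := a1 * b4 in Dle *.
have X0 : 0 <= X by nneg.
have N00 : 0 <= N0 by rewrite exprn_ge0 // ltW // site_gt0.
have XN : expR (j + k) ^+ 2 * X * D0 <= X / P ^+ 2 * D0 * N0.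
  rewrite (_ : _ * D0 = X / P ^+ 2 * D0 * (expR (j + k) ^+ 2 * P ^+ 2)); last first.
    by field; rewrite gt_eqF.
  by rewrite ler_wpM2l // mulr_ge0 ?divr_ge0 // ltW.
rewrite /c -/X -/e.
have t1 : 2 * e * (N0 - q0 * D0) <= W * (N0 - q0 * D0).
  by rewrite ler_wpM2r ?subr_ge0 // mulrC.
have t2 : (X / P ^+ 2 * D0 - 2 * e) * N0 <= (Dp + Dm) * N0 by rewrite ler_wpM2r.
have t3 : (expR w ^+ 2 * (a1 * a4) + expR (- w) ^+ 2 * (b1 * b4)) * D0 <= q0 * W * D0.
  by rewrite ler_wpM2r // ltW.
have t4 : expR (- (j + k)) ^+ 2 * (b1 * a4) * D0 <= b1 * a4 * D0.
  by rewrite ler_wpM2r // ltW.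
lra.
Qed.

Let lower w j k : 0 <= j -> 0 <= k ->
  [/\ expR w ^+ 2 * (q0 * (a2 * a3)) * site (j - k) p n ^+ 2 <= den w j k,
      expR (- w) ^+ 2 * (q0 * (b2 * b3)) * site (j - k) p n ^+ 2 <= den w j k &
      expR (j + k) ^+ 2 * (a1 * b4) * site (j - k) p n ^+ 2 <= den w j k].
Proof.
move=> j0 k0; rewrite /den (expand2 w (j - k)).
have h4 := H4 _ _ j0 k0; have hp := prod_ge w.
set D0 := site (j - k) p n ^+ 2 in h4 *; set N0 := site (j + k) P N ^+ 2 in h4 *.
have D00 : 0 < D0 by rewrite exprn_gt0 // site_gt0.
set Wp := expR w ^+ 2 * (a2 * a3) in hp *; set Wm := expR (- w) ^+ 2 * (b2 * b3) in hp *.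
set Dp := expR (j - k) ^+ 2 * (a2 * b3); set Dm := expR (- (j - k)) ^+ 2 * (b2 * a3).
have pos (x y : R) : 0 < y -> 0 <= expR x ^+ 2 * y.
  by move=> y0; rewrite mulr_ge0 ?exprn_ge0 ?expR_ge0 // ltW.
have Wp0 : 0 <= Wp by rewrite pos ?mulr_gt0.
have Wm0 : 0 <= Wm by rewrite pos ?mulr_gt0.
have Dp0 : 0 <= Dp by rewrite pos ?mulr_gt0.
have Dm0 : 0 <= Dm by rewrite pos ?mulr_gt0.
have N00 : 0 <= N0 by rewrite exprn_ge0 // ltW // site_gt0.
have P2 : 0 < P ^+ 2 by rewrite exprn_gt0.
split.
- rewrite (_ : _ * D0 = Wp * (q0 * D0)); last by rewrite /Wp; ring.
  apply: ler_pM => //; try nneg; lra.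
- rewrite (_ : _ * D0 = Wm * (q0 * D0)); last by rewrite /Wm; ring.
  apply: ler_pM => //; try nneg; lra.
- have N0P : expR (j + k) ^+ 2 * P ^+ 2 <= N0.
    by rewrite /N0 site2 -addrA lerDl addr_ge0 // ?mulr_ge0 ?exprn_ge0 ?expR_ge0 // ltW.
  have Dle : a1 * b4 / P ^+ 2 * D0 <= Wp + Wm + Dp + Dm.
    have Dle' : a1 * b4 / P ^+ 2 * D0 - p * n * (a1 * b4) / P ^+ 2 * 2 <= Dp + Dm.
      rewrite /D0 site2 (_ : _ - _ = expR (j - k) ^+ 2 * (a1 * b4 * p ^+ 2 / P ^+ 2)
        + expR (- (j - k)) ^+ 2 * (a1 * b4 * n ^+ 2 / P ^+ 2)); last first.
        by field; rewrite gt_eqF.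
      by apply: lerD; rewrite ler_wpM2l ?exprn_ge0 ?expR_ge0 // ler_pdivrMr.
    lra.
  rewrite (_ : _ * D0 = a1 * b4 / P ^+ 2 * D0 * (expR (j + k) ^+ 2 * P ^+ 2)); last first.
    by field; rewrite gt_eqF.
  by apply: ler_pM => //; nneg.
Qed.

Let ratio (z : R * R * R) := num z.1.1 z.1.2 z.2 / den z.1.1 z.1.2 z.2.

Let continuous_ratio : continuous ratio.
Proof.
have c1 : continuous (fun z : R * R * R => z.1.1).
  by move=> z; apply: (@continuous_comp _ _ _ fst fst); exact: cvg_fst.
have c2 : continuous (fun z : R * R * R => z.1.2).
  by move=> z; apply: (@continuous_comp _ _ _ fst snd); [exact: cvg_fst|exact: cvg_snd].
have c3 : continuous (fun z : R * R * R => z.2) by move=> z; exact: cvg_snd.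
have cD (f g : R * R * R -> R) : continuous f -> continuous g ->
    continuous (fun z => f z + g z).
  by move=> cf cg z; apply: cvgD; [exact: cf|exact: cg].
have cN (f : R * R * R -> R) : continuous f -> continuous (fun z => - f z).
  by move=> cf z; apply: cvgN; exact: cf.
have cM (f g : R * R * R -> R) : continuous f -> continuous g ->
    continuous (fun z => f z * g z).
  by move=> cf cg z; apply: cvgM; [exact: cf|exact: cg].
have cS (f : R * R * R -> R) a b : continuous f -> continuous (fun z => site (f z) a b).
  exact: continuous_site.
have cJK : continuous (fun z : R * R * R => z.1.2 + z.2) by exact: cD.
have cJNK : continuous (fun z : R * R * R => z.1.2 - z.2) by apply: cD => //; exact: cN.
have cX (f : R * R * R -> R) : continuous f -> continuous (fun z => f z ^+ 2).
  by move=> cf; exact: (cM f f).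
have cnum : continuous (fun z : R * R * R => num z.1.1 z.1.2 z.2).
  apply: (cM _ (fun z => site (z.1.2 - z.2) p n ^+ 2)); last by apply: cX; exact: cS.
  apply: (cM (fun z => site (z.1.1 + (z.1.2 + z.2)) a1 b1)
             (fun z => site (z.1.1 - (z.1.2 + z.2)) a4 b4)).
    by apply: cS; exact: cD.
  by apply: cS; apply: (cD _ (fun z => - (z.1.2 + z.2))) => //; exact: cN.
have cden : continuous (fun z : R * R * R => den z.1.1 z.1.2 z.2).
  apply: (cM _ (fun z => site (z.1.2 + z.2) P N ^+ 2)); last by apply: cX; exact: cS.
  apply: (cM (fun z => site (z.1.1 + (z.1.2 - z.2)) a2 b2)
             (fun z => site (z.1.1 - (z.1.2 - z.2)) a3 b3)).
    by apply: cS; exact: cD.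
  by apply: cS; apply: (cD _ (fun z => - (z.1.2 - z.2))) => //; exact: cN.
apply: cM => // z; apply: cvgV; first by rewrite gt_eqF.
exact: cden.
Qed.

Let lt_sqr_expR (y : R) : y < expR y ^+ 2.
Proof.
have := expR_ge1Dx (2 * y); rewrite (_ : 2 * y = y + y) ?expRD -?expr2; last by ring.
have : 0 < expR y ^+ 2 by rewrite exprn_gt0 ?expR_gt0.
by lra.
Qed.

(** Suppose that the ratio num / den exceeds 1 somewhere.  It tends to at most 1 at
    infinity, so it attains its maximum over the region 0 <= j, 0 <= k, and not at
    j = 0.  At the maximum the critical-point analysis shows that the ratio is
    constant along the whole line in direction j, which meets j = 0, where it is
    at most 1: a contradiction. *)
Lemma four_copies w j k : 0 <= j -> 0 <= k -> num w j k <= den w j k.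
Proof.
move=> j0 k0; rewrite leNgt; apply/negP => gt.
pose d := ratio (w, j, k) - 1.
have d0 : 0 < d by rewrite subr_gt0 /ratio /= ltr_pdivlMr // mul1r.
have c0 : 0 < c.
  have e0 : 0 < p * n * (a1 * b4) / P ^+ 2 by rewrite divr_gt0 ?exprn_gt0 ?mulr_gt0.
  by apply: addr_gt0; [apply: mulr_gt0 => //; exact: mulr_gt0|exact: mulr_gt0].
pose L1 := q0 * (a2 * a3); pose L2 := q0 * (b2 * b3); pose L3 := a1 * b4.
have L10 : 0 < L1 by rewrite !mulr_gt0.
have L20 : 0 < L2 by rewrite !mulr_gt0.
have L30 : 0 < L3 by rewrite !mulr_gt0.
(* Any point at which the ratio is at least as large lies in a box of size T. *)
pose T := 1 + (c / (d * L1) + c / (d * L2) + c / (d * L3)).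
have inT w' j' k' : 0 <= j' -> 0 <= k' -> ratio (w, j, k) <= ratio (w', j', k') ->
    [/\ w' < T, - w' < T & j' + k' < T].
  move=> j'0 k'0 h.
  have h1 : d * den w' j' k' <= c * site (j' - k') p n ^+ 2.
    have := bound w' _ _ j'0 k'0; suff : (1 + d) * den w' j' k' <= num w' j' k' by lra.
    by rewrite -ler_pdivlMr //; move: h; rewrite /d /ratio /=; lra.
  have [l1 l2 l3] := lower w' _ _ j'0 k'0.
  have D0 : 0 < site (j' - k') p n ^+ 2 by rewrite exprn_gt0 // site_gt0.
  have key y L : 0 < L -> expR y ^+ 2 * L * site (j' - k') p n ^+ 2 <= den w' j' k' ->
      y < c / (d * L).
    move=> L0 hy; apply: (lt_le_trans (lt_sqr_expR y)).
    rewrite ler_pdivlMr ?mulr_gt0 // -(ler_pM2r D0); apply: le_trans h1.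
    rewrite (_ : _ * _ * _ = d * (expR y ^+ 2 * L * site (j' - k') p n ^+ 2)); last by ring.
    by rewrite ler_pM2l.
  have p1 : 0 < c / (d * L1) by rewrite divr_gt0 ?mulr_gt0.
  have p2 : 0 < c / (d * L2) by rewrite divr_gt0 ?mulr_gt0.
  have p3 : 0 < c / (d * L3) by rewrite divr_gt0 ?mulr_gt0.
  have q1 := key _ _ L10 l1; have q2 := key _ _ L20 l2; have q3 := key _ _ L30 l3.
  by rewrite /T; split; lra.
pose A := (`[- T, T] `*` `[0, T]) `*` `[0, T] : set (R * R * R).
have cA : compact A by do 2?apply: compact_setX; exact: segment_compact.
have [wT NwT jkT] := inT w j k j0 k0 (lexx _).
have wA : A (w, j, k).
  by rewrite /A /= !in_itv /=; split; [split|]; apply/andP; split; lra.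
have [[[w1 j1] k1]] : exists2 z, z \in A & forall t, t \in A -> ratio t <= ratio z.
  apply: compact_EVT_max => //; first by exists (w, j, k).
  exact: continuous_subspaceT.
rewrite inE /A /= !in_itv /= => -[[/andP[_ _] /andP[j10 _]] /andP[k10 _]] max1.
have ge1 : ratio (w, j, k) <= ratio (w1, j1, k1) by apply: max1; rewrite inE.
have [w1T Nw1T jk1T] := inT w1 j1 k1 j10 k10 ge1.
have j1_gt0 : 0 < j1.
  rewrite lt_def j10 andbT; apply/eqP => j1z.
  move: ge1; rewrite j1z {2}/ratio /=.
  have : num w1 0 k1 / den w1 0 k1 <= 1 by rewrite ler_pdivrMr // mul1r; exact: H0.
  by move: d0; rewrite /d; lra.
have gt1 : 1 < ratio (w1, j1, k1) by move: d0 ge1; rewrite /d; lra.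
have max2 w' j' k' : - T <= w' <= T -> 0 <= j' <= T -> 0 <= k' <= T ->
    num w' j' k' * den w1 j1 k1 <= num w1 j1 k1 * den w' j' k'.
  move=> h1 h2 h3; have : ratio (w', j', k') <= ratio (w1, j1, k1).
    by apply: max1; rewrite inE /A /= !in_itv.
  by rewrite /ratio /= ler_pdivrMr // mulrAC ler_pdivlMr.
pose y1 := w1 + (j1 + k1); pose y2 := w1 + (j1 - k1).
pose y3 := w1 - (j1 - k1); pose y4 := w1 - (j1 + k1).
pose m1 := site_mag y1 a1 b1; pose m2 := site_mag y2 a2 b2.
pose m3 := site_mag y3 a3 b3; pose m4 := site_mag y4 a4 b4.
pose pp := site_mag (j1 + k1) P N; pose qq := site_mag (j1 - k1) p n.
have moveW (dd kk t : R) : 0 < kk -> expR dd = (1 + t) / kk -> expR (- dd) = (1 - t) / kk ->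
    num (w1 + dd) j1 k1 = kk^-1 ^+ 2 * num w1 j1 k1 * ((1 + m1 * t) * (1 + m4 * t)) /\
    den (w1 + dd) j1 k1 = kk^-1 ^+ 2 * den w1 j1 k1 * ((1 + m2 * t) * (1 + m3 * t)).
  move=> kk0 hd hNd; rewrite /num /den.
  rewrite (_ : w1 + dd + (j1 + k1) = y1 + dd) 1?(_ : w1 + dd - (j1 + k1) = y4 + dd);
    try by rewrite /y1 /y4; ring.
  rewrite (_ : w1 + dd + (j1 - k1) = y2 + dd) 1?(_ : w1 + dd - (j1 - k1) = y3 + dd);
    try by rewrite /y2 /y3; ring.
  do 4!rewrite ?(site_shift _ _ _ _ _ _ _ _ kk0 hd hNd).1 //.
  by rewrite -/m1 -/m2 -/m3 -/m4 /y1 /y2 /y3 /y4; split; ring.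
have moveJ (dd kk t : R) : 0 < kk -> expR dd = (1 + t) / kk -> expR (- dd) = (1 - t) / kk ->
    num w1 (j1 + dd) k1 = kk^-1 ^+ 4 * num w1 j1 k1 *
      ((1 + m1 * t) * (1 - m4 * t) * (1 + qq * t) ^+ 2) /\
    den w1 (j1 + dd) k1 = kk^-1 ^+ 4 * den w1 j1 k1 *
      ((1 + m2 * t) * (1 - m3 * t) * (1 + pp * t) ^+ 2).
  move=> kk0 hd hNd; rewrite /num /den.
  rewrite (_ : w1 + (j1 + dd + k1) = y1 + dd) 1?(_ : w1 - (j1 + dd + k1) = y4 - dd);
    try by rewrite /y1 /y4; ring.
  rewrite (_ : w1 + (j1 + dd - k1) = y2 + dd) 1?(_ : w1 - (j1 + dd - k1) = y3 - dd);
    try by rewrite /y2 /y3; ring.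
  rewrite (_ : j1 + dd - k1 = (j1 - k1) + dd) 1?(_ : j1 + dd + k1 = (j1 + k1) + dd); try by ring.
  rewrite !(site_shift y1 _ _ _ _ _ _ _ kk0 hd hNd).1 // !(site_shift y4 _ _ _ _ _ _ _ kk0 hd hNd).2 //.
  rewrite !(site_shift y2 _ _ _ _ _ _ _ kk0 hd hNd).1 // !(site_shift y3 _ _ _ _ _ _ _ kk0 hd hNd).2 //.
  rewrite !(site_shift (j1 - k1) _ _ _ _ _ _ _ kk0 hd hNd).1 //.
  rewrite !(site_shift (j1 + k1) _ _ _ _ _ _ _ kk0 hd hNd).1 //.
  by rewrite -/m1 -/m2 -/m3 -/m4 -/pp -/qq /y1 /y2 /y3 /y4; split; ring.
have moveK (dd kk t : R) : 0 < kk -> expR dd = (1 + t) / kk -> expR (- dd) = (1 - t) / kk ->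
    num w1 j1 (k1 + dd) = kk^-1 ^+ 4 * num w1 j1 k1 *
      ((1 + m1 * t) * (1 - m4 * t) * (1 - qq * t) ^+ 2) /\
    den w1 j1 (k1 + dd) = kk^-1 ^+ 4 * den w1 j1 k1 *
      ((1 - m2 * t) * (1 + m3 * t) * (1 + pp * t) ^+ 2).
  move=> kk0 hd hNd; rewrite /num /den.
  rewrite (_ : w1 + (j1 + (k1 + dd)) = y1 + dd) 1?(_ : w1 - (j1 + (k1 + dd)) = y4 - dd);
    try by rewrite /y1 /y4; ring.
  rewrite (_ : w1 + (j1 - (k1 + dd)) = y2 - dd) 1?(_ : w1 - (j1 - (k1 + dd)) = y3 + dd);
    try by rewrite /y2 /y3; ring.
  rewrite (_ : j1 - (k1 + dd) = (j1 - k1) - dd) 1?(_ : j1 + (k1 + dd) = (j1 + k1) + dd); try by ring.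
  rewrite !(site_shift y1 _ _ _ _ _ _ _ kk0 hd hNd).1 // !(site_shift y4 _ _ _ _ _ _ _ kk0 hd hNd).2 //.
  rewrite !(site_shift y2 _ _ _ _ _ _ _ kk0 hd hNd).2 // !(site_shift y3 _ _ _ _ _ _ _ kk0 hd hNd).1 //.
  rewrite !(site_shift (j1 - k1) _ _ _ _ _ _ _ kk0 hd hNd).2 //.
  rewrite !(site_shift (j1 + k1) _ _ _ _ _ _ _ kk0 hd hNd).1 //.
  by rewrite -/m1 -/m2 -/m3 -/m4 -/pp -/qq /y1 /y2 /y3 /y4; split; ring.
have nd := mulr_gt0 (num_gt0 w1 j1 k1) (den_gt0 w1 j1 k1).
have cancel (kk x y : R) i : 0 < kk ->
    kk^-1 ^+ i * num w1 j1 k1 * x * den w1 j1 k1 <=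
    num w1 j1 k1 * (kk^-1 ^+ i * den w1 j1 k1 * y) -> x <= y.
  move=> kk0 h; rewrite -(@ler_pM2l _ (kk^-1 ^+ i * (num w1 j1 k1 * den w1 j1 k1))).
    by move: h; congr (is_true (_ <= _)); ring.
  by rewrite mulr_gt0 ?exprn_gt0 ?invr_gt0.
pose r := Num.min (Num.min (T - w1) (T + w1)) (Num.min j1 (T - (j1 + k1))).
have r0 : 0 < r by rewrite !lt_min j1_gt0 !subr_gt0 w1T jk1T -ltrBlDr sub0r Nw1T.
have [r1 r2 r3 r4] : [/\ r <= T - w1, r <= T + w1, r <= j1 & r <= T - (j1 + k1)].
  by split; rewrite !ge_min lexx ?orbT.
have [wI jI kI] : [/\ - T <= w1 <= T, 0 <= j1 <= T & 0 <= k1 <= T].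
  by split; apply/andP; split; lra.
have [rw rj rk] : [/\ r <= w1 - - T, r <= T - j1 & r <= T - k1] by split; lra.
pose e := Num.min 2^-1 (r / 2).
have e0 : 0 < e by rewrite lt_min invr_gt0 ltr0n divr_gt0.
have small (t : R) : `|t| <= e -> `|t| <= 2^-1 /\ 2 * `|t| <= r.
  by rewrite le_min => /andP[? ?]; split=> //; lra.
have qp : qq <= pp.
  rewrite /qq /pp /site_mag ler_pdivrMr ?site_gt0 // mulrAC ler_pdivlMr ?site_gt0 //.
  rewrite -subr_ge0 (_ : _ - _ = 2 * (expR (j1 + k1) * expR (- (j1 - k1)) * (P * n)
     - expR (- (j1 + k1)) * expR (j1 - k1) * (N * p))); last by rewrite /site; ring.
  rewrite -!expRD mulr_ge0 // subr_ge0; apply: ler_pM.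
  - exact: expR_ge0.
  - by apply: mulr_ge0; apply: ltW.
  - by rewrite ler_expR; lra.
  - exact: H5.
(* The shift by - j1 corresponds to a finite value of the parameter t. *)
have final : (forall t, (1 + m1 * t) * (1 - m4 * t) * (1 + qq * t) ^+ 2
    = (1 + m2 * t) * (1 - m3 * t) * (1 + pp * t) ^+ 2) -> False.
  move=> eqt; have [t [kk [kk0 hd hNd]]] := shift_tanh (- j1).
  have [hn hD] := moveJ _ _ _ kk0 hd hNd.
  have eqND : num w1 0 k1 * den w1 j1 k1 = num w1 j1 k1 * den w1 0 k1.
    by rewrite -(subrr j1) hn hD eqt; ring.
  have := H0 w1 _ k10; rewrite -(ler_pM2r (den_gt0 w1 j1 k1)) eqND.
  rewrite mulrC ler_pM2l // leNgt => /negP; apply.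
  by move: gt1; rewrite /ratio /= ltr_pdivlMr // mul1r.
have [] := @crit m1 m2 m3 m4 pp qq e e0 qp.
- move=> t /small[t1 t2]; have [d' [kk [kk0 hd hNd hdt _]]] := tanh_shift _ t1.
  have [hn hD] := moveW _ _ _ kk0 hd hNd.
  have /andP[b1' b2'] : - r <= d' <= r by rewrite -ler_norml; exact: le_trans hdt t2.
  apply: (cancel kk _ _ 2 kk0); rewrite -hn -hD; apply: max2 => //; exact: shift_itv b1' b2' rw r1.
- move=> t /small[t1 t2]; have [d' [kk [kk0 hd hNd hdt _]]] := tanh_shift _ t1.
  have [hn hD] := moveJ _ _ _ kk0 hd hNd.
  have /andP[b1' b2'] : - r <= d' <= r by rewrite -ler_norml; exact: le_trans hdt t2.
  apply: (cancel kk _ _ 4 kk0); rewrite -hn -hD; apply: max2 => //; apply: shift_itv b1' b2' _ rj; by rewrite subr0.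
- move=> t t0 te; have [|t1 t2] := small t; first by rewrite ger0_norm.
  have [d' [kk [kk0 hd hNd hdt /(_ t0) d'0]]] := tanh_shift _ t1.
  have [hn hD] := moveK _ _ _ kk0 hd hNd.
  have /andP[b1' b2'] : - r <= d' <= r by rewrite -ler_norml; exact: le_trans hdt t2.
  apply: (cancel kk _ _ 4 kk0); rewrite -hn -hD; apply: max2 => //; rewrite addr_ge0 //=.
  by rewrite -lerBrDl (le_trans b2').
- by move=> [h1 [h2 h3]]; apply: final => t; rewrite h1 h2 h3; ring.
- by move=> [h1 [h2 [h3 h4]]]; apply: final => t; rewrite h1 h2 h3 h4; ring.
Qed.

End FourCopies.

(** * Ising partition functions on subsets of the vertices *)

(** The elementary form of the four functions inequality: after multiplication by A
    the claim becomes 0 <= (A - C) * (A - D) + A * B - C * D. *)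
Lemma four_point {R : realType} (A B C D : R) : 0 < A -> 0 < C -> 0 < D ->
  C <= A -> D <= A -> C * D <= A * B -> C + D <= A + B.
Proof. by move=> A0 C0 D0 CA DA CDAB; rewrite -(ler_pM2l A0); nra. Qed.

Section Cubes.
Context {R : realType} {n : nat}.
Implicit Types (s t : cube n) (x y u v : 'I_n -> R) (S : {set 'I_n}).

Definition sg s i : R := (-1) ^+ s i.

Definition setspin s k b : cube n := [ffun j => if j == k then b else s j].

Lemma sgE s i : sg s i = if s i then -1 else 1.
Proof. by rewrite /sg; case: (s i). Qed.

Lemma sg_sqr s i : sg s i * sg s i = 1.
Proof. by rewrite sgE; case: (s i); rewrite ?mulrNN mulr1. Qed.

Lemma sg_cases s i : sg s i = 1 \/ sg s i = -1.
Proof. by rewrite sgE; case: (s i); [right|left]. Qed.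

Lemma sg_setspin s k b i :
  sg (setspin s k b) i = if i == k then (-1) ^+ b else sg s i.
Proof. by rewrite /sg ffunE; case: ifP. Qed.

Lemma flipK i : involutive (fun s : cube n => flip s i).
Proof. by move=> s; apply/ffunP=> j; rewrite !ffunE; case: (j == i); rewrite ?negbK. Qed.

Lemma sg_flip s k i : sg (flip s k) i = if i == k then - sg s i else sg s i.
Proof. by rewrite /sg ffunE; case: ifP => // _; case: (s i); rewrite /= ?opprK. Qed.

Lemma sum_setspin k (f : cube n -> R) :
  \sum_s f s = 2^-1 * (\sum_s f (setspin s k false) + \sum_s f (setspin s k true)).
Proof.
have e : \sum_s (f s + f (flip s k)) =
         \sum_s (f (setspin s k false) + f (setspin s k true)).
  apply: eq_bigr => s _; case E: (s k); [rewrite addrC|]; congr (f _ + f _);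
    apply/ffunP => j; rewrite !ffunE; case: eqP => // ->; rewrite E //.
have e' : \sum_s f (flip s k) = \sum_s f s.
  by rewrite [RHS](reindex_inj (inv_inj (flipK k))).
rewrite -big_split /= -e big_split /= e'.
by field.
Qed.

Variable M : 'I_n -> 'I_n -> R.
Hypothesis M_sym : forall i j, M i j = M j i.

(** The energy involves the spins in S only, but configurations range over the whole
    cube: the spins outside S contribute a power of 2, which keeps the index type
    fixed when vertices are removed. *)
Definition energy S x s : R :=
  \sum_(i in S) x i * sg s i
  + 2^-1 * \sum_(i in S) \sum_(j in S | j != i) M i j * sg s i * sg s j.

Definition part S x : R := \sum_s expR (energy S x s).

Lemma part_gt0 S x : 0 < part S x.
Proof.
rewrite /part (bigD1 [ffun=> false]) //= ltr_pwDl ?expR_gt0 //.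
by apply: sumr_ge0 => s _; exact: expR_ge0.
Qed.

Lemma eq_part S x y : {in S, x =1 y} -> part S x = part S y.
Proof.
move=> xy; apply: eq_bigr => s _; congr expR; congr (_ + _).
by apply: eq_bigr => i iS; rewrite xy.
Qed.

Lemma partN S x : part S (- x) = part S x.
Proof.
have inv : involutive (fun s : cube n => [ffun i => ~~ s i] : cube n).
  by move=> s; apply/ffunP=> i; rewrite !ffunE negbK.
have sgN s i : sg ([ffun i => ~~ s i] : cube n) i = - sg s i.
  by rewrite /sg ffunE; case: (s i); rewrite /= ?opprK.
rewrite /part [LHS](reindex_inj (inv_inj inv)) /=; apply: eq_bigr => s _.
congr expR; congr (_ + _ * _).
  by apply: eq_bigr => i _; rewrite sgN mulrN fctE mulNr opprK.
by apply: eq_bigr => i _; apply: eq_bigr => j _; rewrite !sgN; ring.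
Qed.

Lemma part0 x : part finset.set0 x = \sum_(s : cube n) 1.
Proof.
by apply: eq_bigr => s _; rewrite /energy !big_set0 mulr0 addr0 expR0.
Qed.

Lemma energy_setspin S k x s b : k \in S ->
  energy S x (setspin s k b) =
  x k * (-1) ^+ b + energy (S :\ k)%SET (x + (fun i => (-1) ^+ b * M k i)) s.
Proof.
move=> kS; rewrite /energy (big_setD1 k kS) /= sg_setspin eqxx -!addrA; congr (_ + _).
have e1 : \sum_(i in (S :\ k)%SET) x i * sg (setspin s k b) i
    = \sum_(i in (S :\ k)%SET) x i * sg s i.
  by apply: eq_bigr => i; rewrite !inE sg_setspin => /andP[/negbTE ->].
have e2 i : i \in (S :\ k)%SET ->
    \sum_(j in S | j != i) M i j * sg (setspin s k b) i * sg (setspin s k b) j =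
    M k i * (-1) ^+ b * sg s i
    + \sum_(j in (S :\ k)%SET | j != i) M i j * sg s i * sg s j.
  rewrite !inE => /andP[ik iS].
  rewrite (bigD1 k) /=; last by rewrite kS eq_sym.
  rewrite !sg_setspin eqxx (negbTE ik) M_sym; congr (_ + _); first by ring.
  apply: eq_big => [j|j /andP[/andP[_ _] /negbTE jk]].
    by rewrite !inE; case: (j == k); rewrite ?andbF ?andbT //= andbC.
  by rewrite sg_setspin jk.
rewrite (big_setD1 k kS) /= (eq_bigr _ e2) e1 big_split /=.
have e3 : \sum_(j in S | j != k) M k j * sg (setspin s k b) k * sg (setspin s k b) j
   = \sum_(i in (S :\ k)%SET) M k i * (-1) ^+ b * sg s i.
  apply: eq_big => [j|j /andP[_ /negbTE jk]]; first by rewrite !inE andbC.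
  by rewrite !sg_setspin eqxx jk.
rewrite e3 !mulrDr !addrA; congr (_ + _).
rewrite [RHS](_ : _ = \sum_(i in (S :\ k)%SET) x i * sg s i
  + \sum_(i in (S :\ k)%SET) M k i * (-1) ^+ b * sg s i); last first.
  by rewrite -big_split /=; apply: eq_bigr => i _; rewrite fctE; ring.
set A := \sum_(i in _) _; set B := \sum_(i in _) _.
by field.
Qed.

(** Summing out the spin at k shifts the field felt by the other spins by the row
    of couplings of k. *)
Lemma part_rec S k x : k \in S ->
  part S x = site (x k) (2^-1 * part (S :\ k)%SET (x + M k))
                        (2^-1 * part (S :\ k)%SET (x - M k)).
Proof.
have e0 : x + (fun i => (-1) ^+ false * M k i) = x + M k.
  by apply/funext => i; rewrite !fctE mul1r.
have e1 : x + (fun i => (-1) ^+ true * M k i) = x - M k.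
  by apply/funext => i; rewrite !fctE expr1 mulN1r.
move=> kS; rewrite /part (sum_setspin k) /site mulrDr mulrCA [X in _ = _ + X]mulrCA.
congr (_ * _ + _ * _).
  rewrite mulr_sumr; apply: eq_bigr => s _; rewrite energy_setspin // expRD mulr1.
  by rewrite e0.
rewrite mulr_sumr; apply: eq_bigr => s _; rewrite energy_setspin // expRD mulrN1.
by rewrite e1.
Qed.

(** Positive association of the spins, in a form that lends itself to induction on
    the vertices: when one spin is summed out, the terms with equal signs are
    compared by the induction hypothesis and the sum of the two mixed terms by
    four_point. *)
Lemma part_spread (M_ge0 : forall i j, 0 <= M i j) S x y u v :
  x + y = u + v -> (forall i, x i <= u i) -> (forall i, y i <= u i) ->
  part S x * part S y <= part S u * part S v.
Proof.
have [m] := ubnP #|S|; elim: m S x y u v => // m IH S x y u v Sm xyuv xu yu.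
have [->|[k kS]] := set_0Vmem S; first by rewrite !part0.
have Sk : (#|(S :\ k)%SET| < m)%N by move: Sm; rewrite (cardsD1 k) kS.
rewrite !(part_rec _ _ _ kS); set S' := (S :\ k)%SET.
have xyi i : x i + y i = u i + v i by have := congr1 (fun f => f i) xyuv.
pose Z f := 2^-1 * part S' f.
have Z0 f : 0 < Z f by rewrite mulr_gt0 ?part_gt0.
have ih x' y' u' v' : x' + y' = u' + v' -> (forall i, x' i <= u' i) ->
    (forall i, y' i <= u' i) -> Z x' * Z y' <= Z u' * Z v'.
  move=> h1 h2 h3; rewrite /Z mulrACA [leRHS]mulrACA ler_pM2l ?mulr_gt0 //.
  exact: IH.
rewrite -!/(Z _).
have hpp : Z (x + M k) * Z (y + M k) <= Z (u + M k) * Z (v + M k).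
  by apply: ih => [|i|i]; [rewrite addrACA xyuv addrACA|rewrite !fctE lerD2r..].
have hmm : Z (x - M k) * Z (y - M k) <= Z (u - M k) * Z (v - M k).
  by apply: ih => [|i|i]; [rewrite addrACA xyuv addrACA|rewrite !fctE lerD2r..].
have sum0 f g : f + M k + (g - M k) = f + g by rewrite addrACA subrr addr0.
have hpm : Z (x + M k) * Z (y - M k) <= Z (u + M k) * Z (v - M k).
  apply: ih => [|i|i]; first by rewrite !sum0.
    by rewrite !fctE lerD2r.
  by rewrite !fctE; have := M_ge0 k i; have := yu i; lra.
have hmp : Z (x - M k) * Z (y + M k) <= Z (u + M k) * Z (v - M k).
  apply: ih => [|i|i]; first by rewrite addrC !sum0 addrC.
    by rewrite !fctE; have := M_ge0 k i; have := xu i; lra.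
  by rewrite !fctE lerD2r.
have hprod : Z (x + M k) * Z (y - M k) * (Z (x - M k) * Z (y + M k)) <=
             Z (u + M k) * Z (v - M k) * (Z (u - M k) * Z (v + M k)).
  rewrite [leLHS](_ : _ = Z (x + M k) * Z (y + M k) * (Z (x - M k) * Z (y - M k))); last by ring.
  rewrite [leRHS](_ : _ = Z (u + M k) * Z (v + M k) * (Z (u - M k) * Z (v - M k))); last by ring.
  by apply: ler_pM => //; rewrite mulr_ge0 ?ltW.
pose ex (f g : R) := expR (f - g).
have cross : ex (x k) (y k) * (Z (x + M k) * Z (y - M k))
             + ex (y k) (x k) * (Z (x - M k) * Z (y + M k))
  <= ex (u k) (v k) * (Z (u + M k) * Z (v - M k))
             + ex (v k) (u k) * (Z (u - M k) * Z (v + M k)).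
  have exK (f g : R) : ex f g * ex g f = 1 by rewrite /ex -expRD (_ : _ + _ = 0) ?expR0 //; ring.
  have ex0 f g : 0 < ex f g by exact: expR_gt0.
  apply: four_point; try by apply: mulr_gt0 => //; exact: mulr_gt0.
  - apply: ler_pM => //; [exact: expR_ge0|by apply: mulr_ge0; apply: ltW|rewrite ler_expR].
    by have := xyi k; have := xu k; lra.
  - apply: ler_pM => //; [exact: expR_ge0|by apply: mulr_ge0; apply: ltW|rewrite ler_expR].
    by have := xyi k; have := yu k; lra.
  - by rewrite mulrACA exK mul1r [leRHS]mulrACA exK mul1r.
have diag : expR (x k) * expR (y k) = expR (u k) * expR (v k)
    /\ expR (- x k) * expR (- y k) = expR (- u k) * expR (- v k).
  by rewrite -!expRD -!opprD xyi.
have [d1 d2] := diag.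
rewrite /site.
have expand (f g : 'I_n -> R) : (expR (f k) * Z (f + M k) + expR (- f k) * Z (f - M k)) *
     (expR (g k) * Z (g + M k) + expR (- g k) * Z (g - M k)) =
   expR (f k) * expR (g k) * (Z (f + M k) * Z (g + M k)) +
   expR (- f k) * expR (- g k) * (Z (f - M k) * Z (g - M k)) +
   (ex (f k) (g k) * (Z (f + M k) * Z (g - M k))
    + ex (g k) (f k) * (Z (f - M k) * Z (g + M k))).
  by rewrite /ex !expRD; ring.
rewrite !expand d1 d2; apply: lerD => //; apply: lerD.
  by rewrite ler_pM2l // mulr_gt0 ?expR_gt0.
by rewrite ler_pM2l // mulr_gt0 ?expR_gt0.
Qed.

End Cubes.

(** * Griffiths inequalities *)

Section Griffiths.
Context {R : realType} {n : nat}.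
Implicit Types (s t A B : cube n) (x y : 'I_n -> R) (f g : cube n -> R)
  (N : 'I_n -> 'I_n -> R).

Definition character A s : R := \prod_i (if A i then sg s i else 1).

Definition cube_xor A B : cube n := [ffun i => A i (+) B i].

Definition point (i : 'I_n) : cube n := [ffun j => j == i].

Lemma characterM A B s :
  character A s * character B s = character (cube_xor A B) s.
Proof.
rewrite -big_split /=; apply: eq_bigr => i _; rewrite ffunE.
by case: (A i); case: (B i); rewrite /= ?mulr1 ?mul1r ?sg_sqr.
Qed.

Lemma character_point i s : character (point i) s = sg s i.
Proof.
rewrite /character (bigD1 i) //= ffunE eqxx big1 ?mulr1 // => j ji.
by rewrite ffunE (negbTE ji).
Qed.

Lemma character_sum_ge0 A : 0 <= \sum_s character A s.
Proof.
have [/existsP[k kA]|] := boolP [exists k, A k]; last first.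
  rewrite negb_exists => /forallP A0; apply: sumr_ge0 => s _.
  by apply: prodr_ge0 => i _; rewrite (negbTE (A0 i)).
have : \sum_s character A s = - \sum_s character A s.
  rewrite {1}(reindex_inj (inv_inj (flipK k))) /= -sumrN; apply: eq_bigr => s _.
  rewrite /character (bigD1 k) //= [in RHS](bigD1 k) //= kA sg_flip eqxx mulNr.
  congr (- (_ * _)); apply: eq_bigr => i ik.
  by rewrite sg_flip (negbTE ik).
by move=> h; have -> : \sum_s character A s = 0 by lra.
Qed.

(** A witness is a common expansion into characters whose coefficients for f bound
    those for g in absolute value.  Characters may repeat in the list, which makes
    the relation visibly stable under products. *)
Definition dominates f g := exists l : seq (R * R * cube n),
  (forall z, z \in l -> `|z.1.2| <= z.1.1) /\
  (forall s, f s = \sum_(z <- l) z.1.1 * character z.2 s /\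
             g s = \sum_(z <- l) z.1.2 * character z.2 s).

Lemma dominates_sum f g : dominates f g -> `|\sum_s g s| <= \sum_s f s.
Proof.
move=> [l [hl h]].
rewrite (eq_bigr _ (fun s _ => (h s).1)) (eq_bigr _ (fun s _ => (h s).2)).
rewrite exchange_big [X in _ <= X]exchange_big /=.
apply: le_trans (ler_norm_sum _ _ _) _.
rewrite !big_seq; apply: ler_sum => z zl.
rewrite -!mulr_sumr normrM (ger0_norm (character_sum_ge0 _)).
by apply: ler_wpM2r; [exact: character_sum_ge0|exact: hl].
Qed.

Lemma dominatesM f g f' g' : dominates f g -> dominates f' g' ->
  dominates (fun s => f s * f' s) (fun s => g s * g' s).
Proof.
move=> [l [hl h]] [l' [hl' h']].
exists [seq (z.1.1 * z'.1.1, z.1.2 * z'.1.2, cube_xor z.2 z'.2) | z <- l, z' <- l'].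
split=> [z /allpairsP[[z1 z2] [/= z1l z2l ->]] /=|s].
  by rewrite normrM; apply: ler_pM => //; [exact: hl|exact: hl'].
split; rewrite ?(h s).1 ?(h' s).1 ?(h s).2 ?(h' s).2 big_allpairs_dep mulr_suml /=;
  apply: eq_bigr => z _; rewrite mulr_sumr; apply: eq_bigr => z' _ /=;
  by rewrite -characterM; ring.
Qed.

Lemma dominates_character A c d : `|d| <= c ->
  dominates (fun s => c * character A s) (fun s => d * character A s).
Proof.
move=> dc; exists [:: (c, d, A)]; split=> [z|s]; last by rewrite !big_seq1.
by rewrite inE => /eqP ->.
Qed.

Lemma dominates1 : dominates (fun=> 1) (fun=> 1).
Proof.
have e s : character [ffun=> false] s = 1.
  by rewrite /character big1 // => i _; rewrite ffunE.
exists [:: (1, 1, [ffun=> false])]; split=> [z|s].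
  by rewrite inE => /eqP ->; rewrite normr1.
by rewrite !big_seq1 /= e mulr1.
Qed.

Lemma dominates_prod (I : Type) (r : seq I) (F G : I -> cube n -> R) :
  (forall i, dominates (F i) (G i)) ->
  dominates (fun s => \prod_(i <- r) F i s) (fun s => \prod_(i <- r) G i s).
Proof.
move=> h; elim: r => [|i r IH].
  under eq_fun do rewrite big_nil; under [X in dominates _ X]eq_fun do rewrite big_nil.
  exact: dominates1.
under eq_fun do rewrite big_cons; under [X in dominates _ X]eq_fun do rewrite big_cons.
exact: dominatesM.
Qed.

Lemma expR_character (a : R) A s : expR (a * character A s) =
  2^-1 * (expR a + expR (- a)) + 2^-1 * (expR a - expR (- a)) * character A s.
Proof.
have [->|->] : character A s = 1 \/ character A s = -1.
- rewrite /character; elim/big_rec : _ => [|i u _ IH]; first by left.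
  case: (A i); last by rewrite mul1r.
  by case: (@sg_cases R n s i) IH => -> [->|->]; rewrite ?mulN1r ?opprK ?mul1r; by [left|right].
- by rewrite !mulr1; field.
- by rewrite !mulrN1; field.
Qed.

(** The coefficients of the exponential are a hyperbolic cosine and a hyperbolic
    sine. *)
Lemma dominates_expR A (a b : R) : `|b| <= a ->
  dominates (fun s => expR (a * character A s)) (fun s => expR (b * character A s)).
Proof.
move=> ba; have /andP[ba1 ba2] : - a <= b <= a by rewrite -ler_norml.
have h1 : expR b <= expR a by rewrite ler_expR.
have h2 : expR (- b) <= expR a by rewrite ler_expR; lra.
have h3 : expR (- a) <= expR b by rewrite ler_expR.
have h4 : expR (- a) <= expR (- b) by rewrite ler_expR; lra.
have h5 : expR b + expR (- b) <= expR a + expR (- a).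
  by apply: four_point; rewrite ?expR_gt0 // !expRN !divff ?gt_eqF ?expR_gt0.
exists [:: (2^-1 * (expR a + expR (- a)), 2^-1 * (expR b + expR (- b)), [ffun=> false]);
           (2^-1 * (expR a - expR (- a)), 2^-1 * (expR b - expR (- b)), A)].
split=> [z|s].
  rewrite !inE => /orP[|] /eqP -> /=; rewrite normrM ger0_norm ?invr_ge0 ?ler0n // ler_pM2l //.
    by rewrite ger0_norm ?addr_ge0 ?expR_ge0.
  by rewrite ler_norml; apply/andP; split; lra.
have e : character [ffun=> false] s = 1.
  by rewrite /character big1 // => i _; rewrite ffunE.
by rewrite !big_cons !big_nil /= !expR_character e !mulr1 !addr0.
Qed.

(** The energy with all couplings kept, so that no restriction to a set of vertices
    gets in the way of expansions into characters. *)
Definition quad N x s : R :=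
  \sum_i x i * sg s i + 2^-1 * \sum_i \sum_j N i j * sg s i * sg s j.

Lemma dominates_quad N x y : (forall i j, 0 <= N i j) -> (forall i, `|y i| <= x i) ->
  dominates (fun s => expR (quad N x s)) (fun s => expR (quad N y s)).
Proof.
move=> N0 yx.
have e z s : expR (quad N z s) =
    (\prod_i expR (z i * character (point i) s)) *
    \prod_i \prod_j expR (2^-1 * N i j * character (cube_xor (point i) (point j)) s).
  rewrite /quad expRD expR_sum; congr (_ * _).
    by apply: eq_bigr => i _; rewrite character_point.
  rewrite mulr_sumr expR_sum; apply: eq_bigr => i _.
  rewrite mulr_sumr expR_sum; apply: eq_bigr => j _.
  by rewrite -characterM !character_point !mulrA.
rewrite (funext (e x)) (funext (e y)).
apply: dominatesM; first by apply: dominates_prod => i; exact: dominates_expR.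
apply: dominates_prod => i; apply: dominates_prod => j; apply: dominates_expR.
by rewrite ger0_norm ?mulr_ge0 ?invr_ge0.
Qed.

Lemma sg_xor s t i : sg (cube_xor s t) i = sg s i * sg t i :> R.
Proof. by rewrite /sg ffunE; case: (s i); case: (t i); rewrite /= ?mulrNN ?mulr1 ?mul1r. Qed.

(** The duplication trick of Ginibre: two independent copies are replaced by one copy
    and its relative configuration t with respect to the other.  For fixed t the pair
    is again an Ising system, by quad_relative, and its couplings are nonnegative. *)
Lemma sum_relative (F : cube n -> cube n -> R) :
  \sum_s \sum_t F s t = \sum_t \sum_s F s (cube_xor s t).
Proof.
rewrite [RHS]exchange_big /=; apply: eq_bigr => s _.
have inv : involutive (cube_xor s).
  by move=> t; apply/ffunP => i; rewrite !ffunE addKb.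
by rewrite [LHS](reindex_inj (inv_inj inv)).
Qed.

Lemma quad_relative N N' x x' s t : quad N x s + quad N' x' (cube_xor s t) =
  quad (fun i j => N i j + N' i j * (sg t i * sg t j))
       (fun i => x i + x' i * sg t i) s.
Proof.
rewrite /quad addrACA -mulrDr -!big_split /=; congr (_ + _ * _).
  by apply: eq_bigr => i _; rewrite sg_xor; ring.
apply: eq_bigr => i _; rewrite -big_split /=; apply: eq_bigr => j _.
by rewrite !sg_xor; ring.
Qed.

Lemma relative_coupling_ge0 N N' t : (forall i j, 0 <= N' i j <= N i j) ->
  forall i j, 0 <= N i j + N' i j * (sg t i * sg t j).
Proof.
move=> h i j; have /andP[h1 h2] := h i j.
by case: (@sg_cases R n t i) => ->; case: (@sg_cases R n t j) => ->; lra.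
Qed.

Lemma quad_sum_compare N N' x x' y y' : (forall i j, 0 <= N' i j <= N i j) ->
  (forall i, `|y i + x' i| <= x i + y' i) -> (forall i, `|y i - x' i| <= x i - y' i) ->
  (\sum_s expR (quad N y s)) * (\sum_s expR (quad N' x' s)) <=
  (\sum_s expR (quad N x s)) * (\sum_s expR (quad N' y' s)).
Proof.
move=> NN hp hm.
have e z z' : (\sum_s expR (quad N z s)) * (\sum_s expR (quad N' z' s)) =
  \sum_t \sum_s expR (quad (fun i j => N i j + N' i j * (sg t i * sg t j))
       (fun i => z i + z' i * sg t i) s).
  rewrite mulr_suml; under eq_bigr do rewrite mulr_sumr.
  rewrite [LHS]sum_relative; apply: eq_bigr => t _; apply: eq_bigr => s _.
  by rewrite -expRD quad_relative.
rewrite !e; apply: ler_sum => t _; apply: le_trans (ler_norm _) _.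
apply: dominates_sum; apply: dominates_quad; first exact: relative_coupling_ge0.
by move=> i; case: (@sg_cases R n t i) => ->; rewrite ?mulr1 ?mulrN1.
Qed.

Lemma correlation_quad_ge0 N i j : (forall i j, 0 <= N i j) ->
  0 <= \sum_s sg s i * sg s j * expR (quad N (fun=> 0) s).
Proof.
move=> N0.
have h : dominates (fun s => sg s i * sg s j * expR (quad N (fun=> 0) s))
                   (fun s => sg s i * sg s j * expR (quad N (fun=> 0) s)).
  apply: dominatesM.
    have -> : (fun s => sg s i * sg s j) =
              (fun s => 1 * character (cube_xor (point i) (point j)) s).
      by apply/funext => s; rewrite mul1r -characterM !character_point.
    by apply: dominates_character; rewrite normr1.
  by apply: dominates_quad => // k; rewrite normr0.
exact: le_trans (normr_ge0 _) (dominates_sum _ _ h).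
Qed.

(** By duplication again: at fixed relative configuration t the difference of the two
    correlations is a correlation times 1 - t_i t_j, which is nonnegative. *)
Lemma correlation_quad_mono N N' i j : (forall i j, 0 <= N' i j <= N i j) ->
  (\sum_s sg s i * sg s j * expR (quad N' (fun=> 0) s)) *
    (\sum_s expR (quad N (fun=> 0) s)) <=
  (\sum_s sg s i * sg s j * expR (quad N (fun=> 0) s)) *
    (\sum_s expR (quad N' (fun=> 0) s)).
Proof.
move=> NN; rewrite mulrC -subr_ge0.
have e (a b : cube n -> R) : (\sum_s a s * expR (quad N (fun=> 0) s)) *
      (\sum_s b s * expR (quad N' (fun=> 0) s)) =
  \sum_t \sum_s a s * b (cube_xor s t) *
   expR (quad (fun i j => N i j + N' i j * (sg t i * sg t j)) (fun=> 0) s).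
  rewrite mulr_suml; under eq_bigr do rewrite mulr_sumr.
  rewrite [LHS]sum_relative; apply: eq_bigr => t _; apply: eq_bigr => s _.
  have z0 : (fun i : 'I_n => 0 + 0 * sg t i) = (fun=> 0 : R).
    by apply/funext => k; rewrite mul0r addr0.
  by rewrite mulrACA -expRD quad_relative z0.
have one M : \sum_s expR (quad M (fun=> 0) s) = \sum_s 1 * expR (quad M (fun=> 0) s).
  by apply: eq_bigr => s _; rewrite mul1r.
rewrite !one !(e _ _) -sumrB; apply: sumr_ge0 => t _.
rewrite -sumrB (eq_bigr (fun s => (1 - sg t i * sg t j) * (sg s i * sg s j *
   expR (quad (fun i j => N i j + N' i j * (sg t i * sg t j)) (fun=> 0) s)))); last first.
  by move=> s _; rewrite !sg_xor; ring.
rewrite -mulr_sumr mulr_ge0 //.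
  by case: (@sg_cases R n t i) => ->; case: (@sg_cases R n t j) => ->; lra.
by apply: correlation_quad_ge0; exact: relative_coupling_ge0.
Qed.

Variable M : 'I_n -> 'I_n -> R.
Hypothesis M_ge0 : forall i j, 0 <= M i j.

Definition restrict_coupling (S : {set 'I_n}) i j : R :=
  if (i \in S) && (j \in S) && (j != i) then M i j else 0.

Lemma energy_quad (S : {set 'I_n}) x s :
  energy M S x s = quad (restrict_coupling S) (fun i => if i \in S then x i else 0) s.
Proof.
rewrite /energy /quad; congr (_ + _ * _).
  by rewrite big_mkcond; apply: eq_bigr => i _; case: ifP => // _; rewrite mul0r.
rewrite big_mkcond; apply: eq_bigr => i _; rewrite /restrict_coupling.
case: ifP => /= _; last by rewrite big1 // => j _; rewrite !mul0r.
by rewrite big_mkcond; apply: eq_bigr => j _; case: ifP => // _; rewrite !mul0r.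
Qed.

(** By duplication, with the vertex k present in the first copy only: exchanging the
    fields x and y between the two copies is then a comparison of fields at fixed
    relative configuration. *)
Lemma part_vertex_mono (S : {set 'I_n}) k x y : k \in S -> (forall i, `|y i| <= x i) ->
  part M S y * part M (S :\ k)%SET x <= part M S x * part M (S :\ k)%SET y.
Proof.
move=> kS yx.
have e S' z : part M S' z = \sum_s expR (quad
    (restrict_coupling S') (fun i => if i \in S' then z i else 0) s).
  by apply: eq_bigr => s _; rewrite energy_quad.
rewrite (e S y) (e S x) (e _ x) (e _ y).
apply: quad_sum_compare => [i j|i|i].
- rewrite /restrict_coupling !inE; case: (i \in S); case: (j \in S);
    case: (j == i); case: (i == k); case: (j == k); by rewrite /= ?lexx ?M_ge0.
- have := yx i; rewrite ler_norml => /andP[h1 h2].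
  rewrite !inE; case: (i == k) => /=; case: (i \in S); rewrite ler_norml;
    apply/andP; split; lra.
- have := yx i; rewrite ler_norml => /andP[h1 h2].
  rewrite !inE; case: (i == k) => /=; case: (i \in S); rewrite ler_norml;
    apply/andP; split; lra.
Qed.

End Griffiths.

(** * Maximality of the zero external field *)

Section ZeroField.
Context {R : realType} {n : nat}.
Variable M : 'I_n -> 'I_n -> R.
Hypothesis M_sym : forall i j, M i j = M j i.
Hypothesis M_ge0 : forall i j, 0 <= M i j.
Implicit Types (h J K f g : 'I_n -> R) (S : {set 'I_n}).

Let set_at f (k : 'I_n) (a : R) : 'I_n -> R := fun i => if i == k then a else f i.

Let part_rec_at S k f g a : k \in S -> {in (S :\ k)%SET, g =1 f} -> g k = a ->
  part M S g = site a (2^-1 * part M (S :\ k)%SET (f + M k))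
                          (2^-1 * part M (S :\ k)%SET (f - M k)).
Proof.
move=> kS gf <-; rewrite (part_rec M M_sym _ _ _ kS).
congr (site _ (_ * _) (_ * _)); apply: eq_part => i iS; rewrite !fctE gf //.
Qed.

Let feq (f g : 'I_n -> R) : (forall i, f i = g i) -> f = g.
Proof. by move/funext. Qed.

(** For h arbitrary and J, K nonnegative, this inequality of Ding, Song and Sun says
    that the odds ratio of two spins with rows of couplings J and K is largest in the
    field h = 0.  The induction removes one vertex k at which J does not vanish.  The
    two rows of partition functions so obtained satisfy the hypotheses of
    four_copies: the inequality without k, in fields shifted by the couplings of k,
    and the inequality with J set to 0 at k, which has fewer sites carrying J. *)
Lemma part_quotient_max S h J K :
  (forall i, 0 <= J i) -> (forall i, 0 <= K i) ->
  part M S (h + J + K) * part M S (h - J - K) * part M S (J - K) ^+ 2 <=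
  part M S (h + J - K) * part M S (h - J + K) * part M S (J + K) ^+ 2.
Proof.
have [m] := ubnP #|S|; elim: m S h J K => // m IHS S h J K Sm.
have [r] := ubnP #|[set i in S | J i != 0]%SET|; elim: r h J K => // r IHJ h J K Jr J0 K0.
have [[k kS Jk]|none] := pselect (exists2 k, k \in S & J k != 0); last first.
  have Jz i : i \in S -> J i = 0.
    by move=> iS; apply/eqP/negPn/negP => Ji; apply: none; exists i.
  have -> : part M S (h + J + K) = part M S (h - J + K).
    by apply: eq_part => i iS; rewrite !fctE Jz // subr0 addr0.
  have -> : part M S (h - J - K) = part M S (h + J - K).
    by apply: eq_part => i iS; rewrite !fctE Jz // subr0 addr0.
  have -> : part M S (J - K) = part M S (J + K).
    rewrite -partN; apply: eq_part => i iS; rewrite !fctE Jz //; ring.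
  by rewrite [leLHS](mulrAC _ _ (_ ^+ 2)) mulrAC [X in _ <= X * _]mulrC mulrAC.
set S' := (S :\ k)%SET; set c := M k.
have Sk : (#|S'| < m)%N by move: Sm; rewrite (cardsD1 k) kS.
have c0 i : 0 <= c i by exact: M_ge0.
pose Z f := part M S' f.
have Z0 f : 0 < 2^-1 * Z f by rewrite mulr_gt0 ?part_gt0.
have recP f g a : {in S', g =1 f} -> g k = a ->
    part M S g = site a (2^-1 * Z (f + c)) (2^-1 * Z (f - c)).
  exact: part_rec_at.
have scale (u v u' v' A B : R) : 0 < B -> u * v * B <= u' * v' * A ->
    2^-1 * u * (2^-1 * v) <= A / B * (2^-1 * u' * (2^-1 * v')).
  by move=> B0 H; rewrite [leRHS]mulrAC ler_pdivlMr //; lra.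
have addp f g i : 0 <= f i -> 0 <= g i -> 0 <= (f + g) i by move=> *; rewrite fctE addr_ge0.
have four := @four_copies R
  (2^-1 * Z (h + J + K + c)) (2^-1 * Z (h + J + K - c))
  (2^-1 * Z (h + J - K + c)) (2^-1 * Z (h + J - K - c))
  (2^-1 * Z (h - J + K + c)) (2^-1 * Z (h - J + K - c))
  (2^-1 * Z (h - J - K + c)) (2^-1 * Z (h - J - K - c))
  (2^-1 * Z (J + K + c)) (2^-1 * Z (J + K - c))
  (2^-1 * Z (J - K + c)) (2^-1 * Z (J - K - c))
  (Z (J + K) ^+ 2 / Z (J - K) ^+ 2)
  (Z0 _) (Z0 _) (Z0 _) (Z0 _) (Z0 _) (Z0 _) (Z0 _) (Z0 _) (Z0 _) (Z0 _) (Z0 _) (Z0 _).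
have recK f a : f k = a -> part M S f = site a (2^-1 * Z (f + c)) (2^-1 * Z (f - c)).
  exact: recP.
rewrite (recK (h + J + K) (h k + (J k + K k))); last by rewrite !fctE; ring.
rewrite (recK (h - J - K) (h k - (J k + K k))); last by rewrite !fctE; ring.
rewrite (recK (h + J - K) (h k + (J k - K k))); last by rewrite !fctE; ring.
rewrite (recK (h - J + K) (h k - (J k - K k))); last by rewrite !fctE; ring.
rewrite (recK (J + K) (J k + K k)) // (recK (J - K) (J k - K k)) //.
apply: four => //.
- by rewrite divr_gt0 ?exprn_gt0 ?part_gt0.
- move=> w k0 k0_ge0; pose h' := set_at h k w; pose J' := set_at J k 0.
  pose K' := set_at K k k0.
  have offk (f : 'I_n -> R) a i : i \in S' -> set_at f k a i = f i.
    by rewrite !inE /set_at => /andP[/negbTE ->].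
  have atk (f : 'I_n -> R) a : set_at f k a k = a by rewrite /set_at eqxx.
  have := IHJ h' J' K'.
  rewrite (recP (h + J + K) (h' + J' + K') (w + (0 + k0))); [|by move=> i iS; rewrite ?/h' ?/J' ?/K' !fctE !offk|by rewrite /h' /J' /K' !fctE !atk; ring].
  rewrite (recP (h - J - K) (h' - J' - K') (w - (0 + k0))); [|by move=> i iS; rewrite ?/h' ?/J' ?/K' !fctE !offk|by rewrite /h' /J' /K' !fctE !atk; ring].
  rewrite (recP (h + J - K) (h' + J' - K') (w + (0 - k0))); [|by move=> i iS; rewrite ?/h' ?/J' ?/K' !fctE !offk|by rewrite /h' /J' /K' !fctE !atk; ring].
  rewrite (recP (h - J + K) (h' - J' + K') (w - (0 - k0))); [|by move=> i iS; rewrite ?/h' ?/J' ?/K' !fctE !offk|by rewrite /h' /J' /K' !fctE !atk; ring].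
  rewrite (recP (J + K) (J' + K') (0 + k0)); [|by move=> i iS; rewrite ?/h' ?/J' ?/K' !fctE !offk|by rewrite /h' /J' /K' !fctE !atk; ring].
  rewrite (recP (J - K) (J' - K') (0 - k0)); [|by move=> i iS; rewrite ?/h' ?/J' ?/K' !fctE !offk|by rewrite /h' /J' /K' !fctE !atk; ring].
  apply.
  + rewrite -ltnS; apply: leq_trans Jr; rewrite ltnS; apply: proper_card.
    apply/properP; split.
      by apply/fintype.subsetP => i; rewrite !inE /J' /set_at; case: (i == k); rewrite ?eqxx ?andbF.
    by exists k; rewrite !inE ?kS ?Jk // /J' atk eqxx andbF.
  + by move=> i; rewrite /J' /set_at; case: ifP.
  + by move=> i; rewrite /K' /set_at; case: ifP.
- have := IHS S' h (J + c) K Sk (fun i => addp _ _ _ (J0 i) (c0 i)) K0.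
  rewrite -!/(Z _).
  have -> : h + (J + c) + K = h + J + K + c by apply: feq => i; rewrite !fctE; ring.
  have -> : h - (J + c) - K = h - J - K - c by apply: feq => i; rewrite !fctE; ring.
  have -> : J + c - K = J - K + c by apply: feq => i; rewrite !fctE; ring.
  have -> : h + (J + c) - K = h + J - K + c by apply: feq => i; rewrite !fctE; ring.
  have -> : h - (J + c) + K = h - J + K - c by apply: feq => i; rewrite !fctE; ring.
  have -> : J + c + K = J + K + c by apply: feq => i; rewrite !fctE; ring.
  by rewrite !exprMn; lra.
- have := IHS S' h J (K + c) Sk J0 (fun i => addp _ _ _ (K0 i) (c0 i)).
  rewrite -!/(Z _).
  have -> : h + J + (K + c) = h + J + K + c by apply: feq => i; rewrite !fctE; ring.
  have -> : h - J - (K + c) = h - J - K - c by apply: feq => i; rewrite !fctE; ring.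
  have -> : J - (K + c) = J - K - c by apply: feq => i; rewrite !fctE; ring.
  have -> : h + J - (K + c) = h + J - K - c by apply: feq => i; rewrite !fctE; ring.
  have -> : h - J + (K + c) = h - J + K + c by apply: feq => i; rewrite !fctE; ring.
  have -> : J + (K + c) = J + K + c by apply: feq => i; rewrite !fctE; ring.
  by rewrite !exprMn; lra.
- have := IHS S' (h + c) J K Sk J0 K0.
  rewrite -!/(Z _).
  have -> : h + c + J + K = h + J + K + c by apply: feq => i; rewrite !fctE; ring.
  have -> : h + c - J - K = h - J - K + c by apply: feq => i; rewrite !fctE; ring.
  have -> : h + c + J - K = h + J - K + c by apply: feq => i; rewrite !fctE; ring.
  have -> : h + c - J + K = h - J + K + c by apply: feq => i; rewrite !fctE; ring.
  by move=> H; apply: scale H; rewrite exprn_gt0 // part_gt0.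
- have := IHS S' (h - c) J K Sk J0 K0.
  rewrite -!/(Z _).
  have -> : h - c + J + K = h + J + K - c by apply: feq => i; rewrite !fctE; ring.
  have -> : h - c - J - K = h - J - K - c by apply: feq => i; rewrite !fctE; ring.
  have -> : h - c + J - K = h + J - K - c by apply: feq => i; rewrite !fctE; ring.
  have -> : h - c - J + K = h - J + K - c by apply: feq => i; rewrite !fctE; ring.
  by move=> H; apply: scale H; rewrite exprn_gt0 // part_gt0.
- move=> j k0 j0 k00; pose J' := set_at J k j; pose K' := set_at K k k0.
  have offk (f : 'I_n -> R) a i : i \in S' -> set_at f k a i = f i.
    by rewrite !inE /set_at => /andP[/negbTE ->].
  have atk (f : 'I_n -> R) a : set_at f k a k = a by rewrite /set_at eqxx.
  have J'0 i : 0 <= J' i by rewrite /J' /set_at; case: ifP.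
  have K'0 i : 0 <= K' i by rewrite /K' /set_at; case: ifP.
  have := part_vertex_mono M M_ge0 S k (J' + K') (J' - K') kS.
  rewrite (recP (J + K) (J' + K') (j + k0)); [|by move=> i iS; rewrite /J' /K' !fctE !offk|by rewrite /J' /K' !fctE !atk; ring].
  rewrite (recP (J - K) (J' - K') (j - k0)); [|by move=> i iS; rewrite /J' /K' !fctE !offk|by rewrite /J' /K' !fctE !atk; ring].
  rewrite -/S' (_ : part M S' (J' + K') = Z (J + K)); last first.
    by apply: eq_part => i iS; rewrite /J' /K' !fctE !offk.
  rewrite (_ : part M S' (J' - K') = Z (J - K)); last first.
    by apply: eq_part => i iS; rewrite /J' /K' !fctE !offk.
  move=> H.
  have D0 : 0 < Z (J - K) ^+ 2 by rewrite exprn_gt0 // part_gt0.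
  rewrite mulrAC ler_pdivrMr // -!exprMn lerXn2r ?nnegrE //.
  - by rewrite mulr_ge0 // ltW ?part_gt0 // site_gt0.
  - by rewrite mulr_ge0 // ltW ?part_gt0 // site_gt0.
  - rewrite mulrC; apply: H => i; rewrite ler_norml !fctE.
    by have := J'0 i; have := K'0 i; move=> *; apply/andP; split; lra.
- have := part_spread M M_sym M_ge0 S' (J + K - c) (J - K + c) (J + K + c) (J - K - c).
  rewrite -!/(Z _) => H.
  have : Z (J + K - c) * Z (J - K + c) <= Z (J + K + c) * Z (J - K - c).
    apply: H => [|i|i]; first by apply: feq => i; rewrite !fctE; ring.
      by rewrite !fctE; have := c0 i; lra.
    by rewrite !fctE; have := c0 i; have := K0 i; lra.
  by lra.
Qed.

End ZeroField.

(** * Covariances in an arbitrary external field *)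

Section Covariance.
Context {R : realType}.

(** Here a, b, c, d are the weights of the four states of a pair of spins, and
    a0, b0, b0, a0 those of an unbiased pair with a larger odds ratio.  The odds ratio
    bounds a d and b c in terms of each other; which of u / a0 and w / b0 is smaller,
    where u = a + d and w = b + c, tells which of the two products to eliminate before
    using that 4 a d is at most u ^ 2, or 4 b c at most w ^ 2. *)
Lemma covariance_odds_ratio (a b c d a0 b0 : R) :
  0 < a -> 0 < b -> 0 < c -> 0 < d -> 0 < a0 -> 0 < b0 -> b0 <= a0 ->
  a * d * b0 ^+ 2 <= b * c * a0 ^+ 2 ->
  4 * (a * d - b * c) * (a0 + b0) <= (a0 - b0) * (a + b + c + d) ^+ 2.
Proof.
move=> a_gt0 b_gt0 c_gt0 d_gt0 a0_gt0 b0_gt0 ba h.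
pose u := a + d; pose w := b + c.
have u0 : 0 < u by rewrite addr_gt0.
have w0 : 0 < w by rewrite addr_gt0.
have hu : 4 * (a * d) <= u ^+ 2 by have := sqr_ge0 (a - d); rewrite /u; nra.
have hw : 4 * (b * c) <= w ^+ 2 by have := sqr_ge0 (b - c); rewrite /w; nra.
have -> : a + b + c + d = u + w by rewrite /u /w; ring.
have s0 : 0 < a0 + b0 by rewrite addr_gt0.
have key (e x y : R) : 0 < e -> 0 <= x -> x * (a0 + b0) <= (u + w) * e ->
   4 * (a * d - b * c) * e ^+ 2 <= x ^+ 2 * ((a0 - b0) * (a0 + b0)) ->
   4 * (a * d - b * c) * (a0 + b0) <= (a0 - b0) * (u + w) ^+ 2.
  move=> e0 x0 h1 h2; rewrite -(@ler_pM2r _ (e ^+ 2)) ?exprn_gt0 //.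
  apply: (@le_trans _ _ (x ^+ 2 * ((a0 - b0) * (a0 + b0)) * (a0 + b0))).
    by rewrite mulrAC ler_pM2r.
  rewrite (_ : x ^+ 2 * _ * _ = (a0 - b0) * (x * (a0 + b0)) ^+ 2); last by ring.
  rewrite -mulrA -exprMn; apply: ler_wpM2l; first by rewrite subr_ge0.
  by rewrite lerXn2r ?nnegrE // mulr_ge0 // ltW // addr_gt0.
have [hc|hc] := lerP (b0 * u) (a0 * w).
- apply: (key a0 u 0) => //; [exact: ltW|lra|].
  have : 4 * (a * d * b0 ^+ 2) <= 4 * (b * c * a0 ^+ 2) by rewrite ler_pM2l.
  have : 4 * (a * d) * ((a0 - b0) * (a0 + b0)) <= u ^+ 2 * ((a0 - b0) * (a0 + b0)).
    by apply: ler_wpM2r => //; rewrite mulr_ge0 ?subr_ge0 // ltW.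
  lra.
- apply: (key b0 w 0) => //; [exact: ltW|lra|].
  have : 4 * (a * d * b0 ^+ 2) <= 4 * (b * c * a0 ^+ 2) by rewrite ler_pM2l.
  have : 4 * (b * c) * ((a0 - b0) * (a0 + b0)) <= w ^+ 2 * ((a0 - b0) * (a0 + b0)).
    by apply: ler_wpM2r => //; rewrite mulr_ge0 ?subr_ge0 // ltW.
  lra.
Qed.

Context {n : nat}.
Variable A : 'M[R]_n.
Hypothesis A_sym : forall i j, A i j = A j i.
Hypothesis A_ge0 : forall i j, 0 <= A i j.
Implicit Types (v : 'cV[R]_n) (x : 'I_n -> R) (s : cube n).

Let M i j := 2 * A i j.
Let M_sym i j : M i j = M j i. Proof. by rewrite /M A_sym. Qed.
Let M_ge0 i j : 0 <= M i j. Proof. by rewrite /M mulr_ge0. Qed.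

(** The Ising weight without the diagonal of A, which only contributes a constant
    because spins square to 1. *)
Definition gibbs x s : R := expR (energy (fun i j => 2 * A i j) [set: 'I_n]%SET x s).

Lemma spinE s i : spin s i 0 = sg s i :> R.
Proof. by rewrite mxE. Qed.

Lemma ising_weight_gibbs v s :
  ising_weight A v s = expR (\sum_i A i i) * gibbs (fun i => v i 0) s.
Proof.
have eT (F : 'I_n -> R) : \sum_(i in [set: 'I_n]%SET) F i = \sum_i F i.
  by apply: eq_bigl => i; rewrite inE.
rewrite /ising_weight /gibbs /energy -expRD !eT; congr expR.
rewrite addrCA [RHS]addrC; congr (_ + _); last first.
  by apply: eq_bigr => i _; rewrite spinE mulrC.
rewrite mulr_sumr -big_split /=; apply: eq_bigr => i _.
rewrite spinE mxE mulr_sumr (bigD1 i) //= !spinE; congr (_ + _).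
  by rewrite mulrCA sg_sqr mulr1.
rewrite mulr_sumr; apply: eq_big => [j|j _]; first by rewrite inE.
by rewrite spinE; field.
Qed.

Lemma expect_ising v (f : cube n -> R) : expect (ising A v) f =
  (\sum_s gibbs (fun i => v i 0) s * f s) / \sum_s gibbs (fun i => v i 0) s.
Proof.
rewrite /expect /ising mulr_suml; apply: eq_bigr => s _.
under [X in _ / X * _]eq_bigr do rewrite ising_weight_gibbs.
rewrite -mulr_sumr ising_weight_gibbs.
set C := expR _; set Z := \sum_i _.
have C0 : C != 0 by rewrite gt_eqF ?expR_gt0.
by rewrite -mulf_div divff // mul1r mulrAC.
Qed.

(* The unnormalized law q of the pair of spins at i and j: the other spins feel the
   field of both. *)
Let rest2 (i j : 'I_n) := ([set: 'I_n] :\ i :\ j)%SET.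

Let q i j x (e e' : R) : R :=
  4^-1 * (expR (x i * e + (x j + e * M i j) * e')
          * part M (rest2 i j) (x + (fun l => e * M i l) + (fun l => e' * M j l))).

Let q_gt0 i j x e e' : 0 < q i j x e e'.
Proof. by rewrite !mulr_gt0 ?invr_gt0 ?ltr0n ?expR_gt0 ?part_gt0. Qed.

Let sum_pair i j x (G : R -> R -> R) : i != j ->
  \sum_s gibbs x s * G (sg s i) (sg s j) =
  q i j x 1 1 * G 1 1 + q i j x 1 (-1) * G 1 (-1)
  + q i j x (-1) 1 * G (-1) 1 + q i j x (-1) (-1) * G (-1) (-1).
Proof.
move=> ij; have ji : j != i by rewrite eq_sym.
have e b b' : \sum_s gibbs x (setspin (setspin s j b') i b) *
     G (sg (setspin (setspin s j b') i b) i) (sg (setspin (setspin s j b') i b) j)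
   = 4 * (q i j x ((-1) ^+ b) ((-1) ^+ b') * G ((-1) ^+ b) ((-1) ^+ b')).
  rewrite mulrA /q mulrA divff ?mul1r // -mulrA [part _ _ _ * _]mulrC mulrA.
  rewrite /part mulr_sumr; apply: eq_bigr => s _.
  rewrite !sg_setspin eqxx (negbTE ji) eqxx /gibbs -/M.
  rewrite (energy_setspin _ M_sym) ?inE // (energy_setspin _ M_sym); last by rewrite !inE ji.
  by rewrite addrA expRD fctE mulrAC.
rewrite (sum_setspin i) (sum_setspin j) [X in _ * (_ + X)](sum_setspin j) /=.
by rewrite (e false false) (e false true) (e true false) (e true true) /= !expr0 !expr1; field.
Qed.

Let part_sum i j x : i != j -> \sum_s gibbs x s =
  q i j x 1 1 + q i j x 1 (-1) + q i j x (-1) 1 + q i j x (-1) (-1).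
Proof.
move=> ij; have := sum_pair i j x (fun _ _ => 1) ij; rewrite !mulr1 => <-.
by apply: eq_bigr => s _; rewrite mulr1.
Qed.

Let cov_pair i j v : i != j -> let x := fun i => v i 0 in
  cov (ising A v) i j =
  4 * (q i j x 1 1 * q i j x (-1) (-1) - q i j x 1 (-1) * q i j x (-1) 1)
  / (q i j x 1 1 + q i j x 1 (-1) + q i j x (-1) 1 + q i j x (-1) (-1)) ^+ 2.
Proof.
move=> ij x; rewrite mxE !expect_ising -/x (part_sum i j) //.
under eq_bigr do rewrite !spinE; under [X in _ - X / _ * _]eq_bigr do rewrite !spinE.
under [X in _ - _ / _ * (X / _)]eq_bigr do rewrite !spinE.
rewrite (sum_pair i j x (fun a b => a * b)) // (sum_pair i j x (fun a _ => a)) //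
  (sum_pair i j x (fun _ b => b)) //.
have q1 := q_gt0 i j x 1 1; have q2 := q_gt0 i j x 1 (-1).
have q3 := q_gt0 i j x (-1) 1; have q4 := q_gt0 i j x (-1) (-1).
by field; rewrite gt_eqF //; do ?apply: addr_gt0.
Qed.

Let q_signs i j x : [/\
  q i j x 1 1 = 4^-1 * (expR (x i + x j + M i j) * part M (rest2 i j) (x + M i + M j)),
  q i j x 1 (-1) = 4^-1 * (expR (x i - x j - M i j) * part M (rest2 i j) (x + M i - M j)),
  q i j x (-1) 1 = 4^-1 * (expR (- x i + x j - M i j) * part M (rest2 i j) (x - M i + M j)) &
  q i j x (-1) (-1) = 4^-1 * (expR (- x i - x j + M i j) * part M (rest2 i j) (x - M i - M j))].
Proof.
have e1 k : (fun l => 1 * M k l) = M k by apply/funext => l; rewrite mul1r.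
have e2 k : (fun l => -1 * M k l) = - M k by apply/funext => l; rewrite mulN1r.
split; rewrite /q ?e1 ?e2; congr (_ * (expR _ * _)); ring.
Qed.

Let q_zero i j : [/\
  q i j 0 1 1 = 4^-1 * (expR (M i j) * part M (rest2 i j) (M i + M j)),
  q i j 0 1 (-1) = 4^-1 * (expR (- M i j) * part M (rest2 i j) (M i - M j)),
  q i j 0 (-1) 1 = 4^-1 * (expR (- M i j) * part M (rest2 i j) (M i - M j)) &
  q i j 0 (-1) (-1) = 4^-1 * (expR (M i j) * part M (rest2 i j) (M i + M j))].
Proof.
have [-> -> -> ->] := q_signs i j 0.
have e1 : (0 : R) + 0 + M i j = M i j by ring.
have e2 : (0 : R) - 0 - M i j = - M i j by ring.
have e3 : - (0 : R) + 0 - M i j = - M i j by ring.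
have e4 : - (0 : R) - 0 + M i j = M i j by ring.
have f1 : (0 : 'I_n -> R) - M i - M j = - (M i + M j) by rewrite sub0r opprD.
have f2 : (0 : 'I_n -> R) - M i + M j = - (M i - M j) by rewrite sub0r opprB addrC.
have f3 : (0 : 'I_n -> R) + M i = M i by rewrite add0r.
rewrite f1 f2 !partN f3.
by split; congr (_ * (expR _ * _)); [exact: e1|exact: e2|exact: e3|exact: e4].
Qed.

Lemma cov_ising_offdiag v i j : i != j ->
  0 <= cov (ising A v) i j <= cov (ising A 0) i j.
Proof.
move=> ij; rewrite !cov_pair //=.
set x := (fun i => v i 0).
have -> : (fun i => (0 : 'cV[R]_n) i 0) = (0 : 'I_n -> R) by apply/funext => l; rewrite mxE.
have [-> -> -> ->] := q_signs i j x; have [-> -> -> ->] := q_zero i j.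
set S := rest2 i j.
set a0 := 4^-1 * (expR (M i j) * _); set b0 := 4^-1 * (expR (- M i j) * _).
set a := 4^-1 * (expR (x i + x j + M i j) * _).
set b := 4^-1 * (expR (x i - x j - M i j) * _).
set c := 4^-1 * (expR (- x i + x j - M i j) * _).
set d := 4^-1 * (expR (- x i - x j + M i j) * _).
have pos (y z : R) : 0 < z -> 0 < 4^-1 * (expR y * z).
  by move=> z0; rewrite !mulr_gt0 ?expR_gt0.
have [p1 p2 p3 p4] : [/\ 0 < a, 0 < b, 0 < c & 0 < d] by split; apply: pos; exact: part_gt0.
have [p5 p6] : 0 < a0 /\ 0 < b0 by split; apply: pos; exact: part_gt0.
have eM : 0 < expR (M i j) by exact: expR_gt0.
have ee (z : R) : expR z * expR (- z) = 1 by rewrite -expRD subrr expR0.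
have ad : a * d = 4^-1 ^+ 2 * expR (M i j) ^+ 2 *
    (part M S (x + M i + M j) * part M S (x - M i - M j)).
  rewrite /a /d !expRD (_ : _ * _ = 4^-1 ^+ 2 * expR (M i j) ^+ 2 *
    (part M S (x + M i + M j) * part M S (x - M i - M j)) *
    ((expR (x i) * expR (- x i)) * (expR (x j) * expR (- x j)))); last by ring.
  by rewrite !ee !mulr1.
have bc : b * c = 4^-1 ^+ 2 * expR (- M i j) ^+ 2 *
    (part M S (x + M i - M j) * part M S (x - M i + M j)).
  rewrite /b /c !expRD (_ : _ * _ = 4^-1 ^+ 2 * expR (- M i j) ^+ 2 *
    (part M S (x + M i - M j) * part M S (x - M i + M j)) *
    ((expR (x i) * expR (- x i)) * (expR (x j) * expR (- x j)))); last by ring.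
  by rewrite !ee !mulr1.
have Zp f : 0 < part M S f by exact: part_gt0.
have em : expR (- M i j) ^+ 2 <= expR (M i j) ^+ 2.
  by rewrite lerXn2r ?nnegrE ?expR_ge0 // ler_expR; have := M_ge0 i j; lra.
have spread (y : 'I_n -> R) : part M S (y + M i - M j) * part M S (y - M i + M j) <=
   part M S (y + M i + M j) * part M S (y - M i - M j).
  apply: (part_spread _ M_sym M_ge0) => [|l|l].
  - by apply/funext => l; rewrite !fctE; ring.
  - by rewrite !fctE; have := M_ge0 j l; lra.
  - by rewrite !fctE; have := M_ge0 i l; lra.
have bcad : b * c <= a * d.
  rewrite ad bc; apply: ler_pM; last exact: spread.
  - by rewrite -exprMn exprn_ge0 // mulr_ge0 ?expR_ge0.
  - by apply: mulr_ge0; apply: ltW.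
  - by rewrite ler_pM2l // exprn_gt0.
have b0a0 : b0 <= a0.
  have := spread 0; rewrite !add0r.
  have -> : part M S (- M i - M j) = part M S (M i + M j) by rewrite -opprD partN.
  have -> : part M S (- M i + M j) = part M S (M i - M j).
    by rewrite -partN opprD opprK.
  rewrite -!expr2 ler_pXn2r ?nnegrE ?(ltW (Zp _)) // => h.
  rewrite ler_pM2l //; apply: ler_pM; [exact: expR_ge0|exact: ltW| |exact: h].
  by rewrite ler_expR; have := M_ge0 i j; lra.
have odds : a * d * b0 ^+ 2 <= b * c * a0 ^+ 2.
  rewrite ad bc /a0 /b0 !exprMn.
  have := part_quotient_max M M_sym M_ge0 S x (M i) (M j) (M_ge0 i) (M_ge0 j).
  set P1 := part M S (M i - M j) ^+ 2; set P2 := part M S (M i + M j) ^+ 2 => h.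
  rewrite [leLHS](_ : _ = 4^-1 ^+ 2 * 4^-1 ^+ 2 * (expR (M i j) ^+ 2 * expR (- M i j) ^+ 2) *
    (part M S (x + M i + M j) * part M S (x - M i - M j) * P1)); last by ring.
  rewrite [leRHS](_ : _ = 4^-1 ^+ 2 * 4^-1 ^+ 2 * (expR (M i j) ^+ 2 * expR (- M i j) ^+ 2) *
    (part M S (x + M i - M j) * part M S (x - M i + M j) * P2)); last by ring.
  by apply: ler_wpM2l => //; rewrite -!exprMn exprn_ge0 // !mulr_ge0 ?expR_ge0.
have s0 : 0 < a + b + c + d by rewrite !addr_gt0.
have t0 : 0 < a0 + b0 by rewrite addr_gt0.
apply/andP; split.
  by rewrite divr_ge0 ?exprn_ge0 ?mulr_ge0 ?subr_ge0 // ltW.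
rewrite (_ : 4 * (a0 * a0 - b0 * b0) / _ = (a0 - b0) / (a0 + b0)); last first.
  by field; rewrite (_ : a0 + b0 + b0 + a0 = 2 * (a0 + b0)) ?mulf_neq0 ?gt_eqF //; ring.
rewrite ler_pdivrMr ?exprn_gt0 // [leRHS]mulrAC ler_pdivlMr //.
exact: covariance_odds_ratio.
Qed.

Lemma cov_ising_diag v i : 0 <= cov (ising A v) i i <= cov (ising A 0) i i.
Proof.
pose r x (e : R) := 2^-1 * (expR (x i * e) *
  part M ([set: 'I_n] :\ i)%SET (x + (fun l => e * M i l))).
have r_gt0 x e : 0 < r x e by rewrite !mulr_gt0 ?invr_gt0 ?ltr0n ?expR_gt0 ?part_gt0.
have sum1 x (G : R -> R) : \sum_s gibbs x s * G (sg s i) = r x 1 * G 1 + r x (-1) * G (-1).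
  have e b : \sum_s gibbs x (setspin s i b) * G (sg (setspin s i b) i) =
      2 * (r x ((-1) ^+ b) * G ((-1) ^+ b)).
    rewrite mulrA /r mulrA divff ?mul1r // -mulrA [part _ _ _ * _]mulrC mulrA.
    rewrite /part mulr_sumr; apply: eq_bigr => s _.
    rewrite !sg_setspin eqxx /gibbs -/M (energy_setspin _ M_sym) ?inE //.
    by rewrite expRD mulrAC.
  by rewrite (sum_setspin i) (e false) (e true) /= expr0 expr1; field.
have covE v' : let x := fun i => v' i 0 in
    cov (ising A v') i i = 4 * (r x 1 * r x (-1)) / (r x 1 + r x (-1)) ^+ 2.
  move=> x; rewrite mxE !expect_ising -/x.
  under eq_bigr do rewrite !spinE; under [X in _ - X / _ * _]eq_bigr do rewrite !spinE.
  under [X in _ - _ / _ * (X / _)]eq_bigr do rewrite !spinE.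
  have -> : \sum_s gibbs x s = r x 1 + r x (-1).
    have := sum1 x (fun=> 1); rewrite !mulr1 => <-.
    by apply: eq_bigr => s _; rewrite mulr1.
  rewrite (sum1 x (fun a => a * a)) (sum1 x (fun a => a)).
  have q1 := r_gt0 x 1; have q2 := r_gt0 x (-1).
  by field; rewrite gt_eqF // addr_gt0.
rewrite !covE /=; set x := (fun i => v i 0).
have -> : (fun i => (0 : 'cV[R]_n) i 0) = (0 : 'I_n -> R) by apply/funext => l; rewrite mxE.
have q1 := r_gt0 x 1; have q2 := r_gt0 x (-1); have q3 := r_gt0 0 1.
have -> : r 0 (-1) = r 0 1.
  rewrite /r (_ : 0 + (fun l => -1 * M i l) = - ((0 : 'I_n -> R) + (fun l => 1 * M i l))).
    have e : (0 : R) * -1 = 0 * 1 by rewrite !mul0r.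
    by rewrite partN; congr (_ * (expR _ * _)); exact: e.
  by apply/funext => l; rewrite !fctE mulN1r mul1r !add0r.
have s0 : 0 < r x 1 + r x (-1) by rewrite addr_gt0.
apply/andP; split.
  by apply: divr_ge0; [apply: mulr_ge0 => //; apply: ltW; exact: mulr_gt0|apply/exprn_ge0/ltW].
rewrite (_ : 4 * (r 0 1 * r 0 1) / _ = 1); last first.
  rewrite (_ : r 0 1 + r 0 1 = 2 * r 0 1); last by ring.
  by field; rewrite gt_eqF.
rewrite ler_pdivrMr ?exprn_gt0 // mul1r.
by have := sqr_ge0 (r x 1 - r x (-1)); nra.
Qed.

(** Off the diagonal, positivity is part_spread for the law of the pair of spins, and
    part_quotient_max says that its odds ratio is largest in the zero field, where
    moreover both spins are unbiased: covariance_odds_ratio applies.  On the diagonal,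
    a spin has largest variance when it is unbiased. *)
Lemma cov_ising_le v i j : 0 <= cov (ising A v) i j <= cov (ising A 0) i j.
Proof.
by have [->|] := eqVneq i j; [exact: cov_ising_diag|exact: cov_ising_offdiag].
Qed.

End Covariance.

(** * Euclidean and operator norms *)

Section OperatorNorm.
Context {R : realType} {n : nat}.
Implicit Types (x y : 'cV[R]_n) (A B : 'M[R]_n).

Lemma inner_ge0 x : 0 <= inner x x.
Proof. by apply: sumr_ge0 => i _; rewrite -expr2 sqr_ge0. Qed.

Lemma innerC x y : inner x y = inner y x.
Proof. by apply: eq_bigr => i _; rewrite mulrC. Qed.

Lemma innerDl x y z : inner (x + y) z = inner x z + inner y z.
Proof. by rewrite -big_split; apply: eq_bigr => i _; rewrite mxE mulrDl. Qed.

Lemma innerZl a x y : inner (a *: x) y = a * inner x y.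
Proof. by rewrite mulr_sumr; apply: eq_bigr => i _; rewrite mxE mulrA. Qed.

Lemma innerDr x y z : inner x (y + z) = inner x y + inner x z.
Proof. by rewrite innerC innerDl !(innerC _ x). Qed.

Lemma innerZr a x y : inner x (a *: y) = a * inner x y.
Proof. by rewrite innerC innerZl innerC. Qed.

Lemma inner_eq0 x : inner x x = 0 -> x = 0.
Proof.
move=> x0; apply/matrixP => i j; rewrite ord1 mxE.
have /eqP := x0; rewrite psumr_eq0 => [/allP/(_ i)|k _]; last by rewrite -expr2 sqr_ge0.
by rewrite mem_index_enum mulf_eq0 orbb => /(_ isT)/eqP.
Qed.

Lemma inner_cauchy_schwarz x y : inner x y ^+ 2 <= inner x x * inner y y.
Proof.
have [/inner_eq0 ->|y0] := eqVneq (inner y y) 0.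
  have z x' : inner x' (0 : 'cV[R]_n) = 0 by rewrite -(scale0r x') innerZr mul0r.
  by rewrite !z expr0n mulr0.
have yp : 0 < inner y y by rewrite lt_def y0 inner_ge0.
have := inner_ge0 (inner y y *: x + - inner x y *: y).
rewrite innerDl !innerDr !innerZl !innerZr (innerC y x).
rewrite (_ : _ + _ = inner y y * (inner x x * inner y y - inner x y ^+ 2)); last by ring.
by rewrite pmulr_rge0 // subr_ge0.
Qed.

Lemma l2norm_ge0 x : 0 <= l2norm x. Proof. exact: sqrtr_ge0. Qed.

Lemma l2norm_sqr x : l2norm x ^+ 2 = inner x x.
Proof. by rewrite sqr_sqrtr // inner_ge0. Qed.

Lemma inner_le_l2norm x y : inner x y <= l2norm x * l2norm y.
Proof.
apply: le_trans (ler_norm _) _; rewrite -(@ler_pXn2r _ 2) ?nnegrE ?mulr_ge0 ?l2norm_ge0 //.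
by rewrite exprMn !l2norm_sqr real_normK ?num_real // inner_cauchy_schwarz.
Qed.

Lemma l2normZ a x : l2norm (a *: x) = `|a| * l2norm x.
Proof.
by rewrite /l2norm innerZl innerZr mulrA -expr2 sqrtrM ?sqr_ge0 // sqrtr_sqr.
Qed.

Lemma l2norm_le x y : (forall i, `|x i 0| <= y i 0) -> l2norm x <= l2norm y.
Proof.
move=> xy; rewrite ler_wsqrtr //; apply: ler_sum => i _.
rewrite -expr2 -real_normK ?num_real // -[leRHS]expr2.
by rewrite lerXn2r ?nnegrE // (le_trans (normr_ge0 _) (xy i)).
Qed.

Lemma opnorm_has_sup A :
  has_sup [set l2norm (A *m x) | x in [set x : 'cV[R]_n | l2norm x <= 1]].
Proof.
split.
  exists (l2norm (A *m 0)), 0 => //=; rewrite /l2norm -(scale0r (0 : 'cV[R]_n)) innerZl mul0r sqrtr0.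
  exact: ler01.
exists (l2norm (\col_i \sum_j `|A i j|)) => _ [x /= x1 <-].
apply: l2norm_le => i; rewrite !mxE; apply: le_trans (ler_norm_sum _ _ _) _.
apply: ler_sum => j _; rewrite normrM ler_piMr //.
have : `|x j 0| ^+ 2 <= 1 ^+ 2.
  have : l2norm x ^+ 2 <= 1 ^+ 2 by rewrite lerXn2r ?nnegrE ?l2norm_ge0.
  apply: le_trans; rewrite l2norm_sqr /inner (bigD1 j) //= real_normK ?num_real // expr2.
  by rewrite lerDl sumr_ge0 // => k _; rewrite -expr2 sqr_ge0.
by rewrite ler_pXn2r ?nnegrE.
Qed.

Lemma opnorm_ge A x : l2norm x <= 1 -> l2norm (A *m x) <= opnorm A.
Proof.
move=> x1; have [_ ub] := opnorm_has_sup A.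
by apply: ub_le_sup => //; exists x.
Qed.

Lemma opnorm_ge0 A : 0 <= opnorm A.
Proof.
apply: le_trans (l2norm_ge0 (A *m 0)) (opnorm_ge _ _ _).
by rewrite /l2norm -(scale0r (0 : 'cV[R]_n)) innerZl mul0r sqrtr0 ler01.
Qed.

Lemma l2norm_mulmx A x : l2norm (A *m x) <= opnorm A * l2norm x.
Proof.
have [x0|x0] := eqVneq (l2norm x) 0.
  have -> : x = 0 by apply: inner_eq0; rewrite -l2norm_sqr x0 expr0n.
  have z : l2norm (0 : 'cV[R]_n) = 0 by rewrite -(scale0r (0 : 'cV[R]_n)) l2normZ normr0 mul0r.
  by rewrite mulmx0 z mulr0.
have xp : 0 < l2norm x by rewrite lt_def x0 l2norm_ge0.
have xE : x = l2norm x *: ((l2norm x)^-1 *: x) by rewrite scalerA divff // scale1r.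
rewrite {1}xE -scalemxAr l2normZ ger0_norm ?l2norm_ge0 // mulrC ler_pM2r //.
by apply: opnorm_ge; rewrite l2normZ ger0_norm ?invr_ge0 ?l2norm_ge0 // mulVf.
Qed.

Lemma inner_mulmx_le A x : inner x (A *m x) <= opnorm A * inner x x.
Proof.
apply: le_trans (inner_le_l2norm _ _) _; rewrite -l2norm_sqr expr2 mulrCA.
by rewrite ler_wpM2l ?l2norm_ge0 // l2norm_mulmx.
Qed.

Let absv x : 'cV[R]_n := \col_i `|x i 0|.

Let inner_absv x : inner (absv x) (absv x) = inner x x.
Proof.
by apply: eq_bigr => i _; rewrite mxE -!expr2 real_normK ?num_real.
Qed.

Lemma opnorm_le A B : (forall i j, 0 <= A i j <= B i j) -> opnorm A <= opnorm B.
Proof.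
move=> AB; apply: ge_sup; first by have [] := opnorm_has_sup A.
move=> _ [x /= x1 <-]; apply: (@le_trans _ _ (l2norm (B *m absv x))); last first.
  by apply: opnorm_ge; rewrite /l2norm inner_absv.
apply: l2norm_le => i; rewrite !mxE; apply: le_trans (ler_norm_sum _ _ _) _.
apply: ler_sum => j _; rewrite normrM mxE ler_wpM2r //.
by have /andP[A0 ABij] := AB i j; rewrite ger0_norm.
Qed.

(** By the Perron-Frobenius principle, a quadratic form is controlled by the norm
    of any matrix dominating its coefficients. *)
Lemma inner_mulmx_le_dom A B x : (forall i j, 0 <= A i j <= B i j) ->
  inner x (A *m x) <= opnorm B * inner x x.
Proof.
move=> AB; apply: le_trans (inner_mulmx_le _ _) _.
by apply: ler_wpM2r; [exact: inner_ge0|exact: opnorm_le].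
Qed.

End OperatorNorm.

(** * The susceptibility *)

Section Susceptibility.
Context {R : realType} {n : nat}.
Variable J : 'M[R]_n.
Hypothesis J_sym : forall i j, J i j = J j i.
Hypothesis J_ge0 : forall i j, 0 <= J i j.
Implicit Types (l : R) (s : cube n).

Let N l := restrict_coupling (fun i j => 2 * (l *: J) i j) [set: 'I_n]%SET.

Let gibbs0 l s : gibbs (l *: J) (fun i => (0 : 'cV[R]_n) i 0) s =
  expR (quad (N l) (fun=> 0) s).
Proof.
have e : (fun i : 'I_n => if i \in [set: 'I_n]%SET then (0 : 'cV[R]_n) i 0 else 0) = fun=> 0.
  by apply/funext => i; rewrite mxE; case: ifP.
by rewrite /gibbs energy_quad e.
Qed.

Let N_ge0 l i j : 0 <= l -> 0 <= N l i j.
Proof.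
by move=> l0; rewrite /N /restrict_coupling mxE; case: ifP => // _; rewrite !mulr_ge0.
Qed.

Let N_le l l' i j : 0 <= l -> l <= l' -> 0 <= N l i j <= N l' i j.
Proof.
move=> l0 ll'; rewrite N_ge0 //= /N /restrict_coupling !mxE; case: ifP => // _.
by rewrite ler_pM2l // ler_wpM2r.
Qed.

Let lJ_sym l i j : (l *: J) i j = (l *: J) j i. Proof. by rewrite !mxE J_sym. Qed.
Let lJ_ge0 l i j : 0 <= l -> 0 <= (l *: J) i j.
Proof. by move=> l0; rewrite mxE mulr_ge0. Qed.

Let cov0 l i j : 0 <= l -> cov (ising (l *: J) 0) i j =
  (\sum_s sg s i * sg s j * expR (quad (N l) (fun=> 0) s)) /
  \sum_s expR (quad (N l) (fun=> 0) s).
Proof.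
move=> l0; rewrite mxE.
have mean0 k : expect (ising (l *: J) 0) (fun x => spin x k 0) = 0.
  rewrite expect_ising //.
  under eq_bigr do rewrite spinE gibbs0.
  set S := (X in X / _).
  suff -> : S = 0 by rewrite mul0r.
  have inv : involutive (fun s : cube n => [ffun i => ~~ s i] : cube n).
    by move=> s; apply/ffunP=> i'; rewrite !ffunE negbK.
  have sgN s i' : sg ([ffun i => ~~ s i] : cube n) i' = - sg s i' :> R.
    by rewrite /sg ffunE; case: (s i'); rewrite /= ?opprK.
  suff : S = - S by move=> h; lra.
  rewrite {1}/S (reindex_inj (inv_inj inv)) /= -sumrN; apply: eq_bigr => s _.
  rewrite sgN mulrN; congr (- (expR _ * _)); rewrite /quad; congr (_ + _ * _).
    by rewrite !big1 // => i' _; rewrite mul0r.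
  by apply: eq_bigr => i' _; apply: eq_bigr => j' _; rewrite !sgN; ring.
rewrite !mean0 mulr0 subr0 expect_ising //; congr (_ / _).
  by apply: eq_bigr => s _; rewrite !spinE gibbs0 mulrC.
by apply: eq_bigr => s _; rewrite gibbs0.
Qed.

Let Z_gt0 l : 0 < \sum_s expR (quad (N l) (fun=> 0) s).
Proof.
rewrite (bigD1 [ffun=> false]) //= ltr_pwDl ?expR_gt0 //.
by apply: sumr_ge0 => s _; exact: expR_ge0.
Qed.

Lemma cov_zero_field_diag l i : 0 <= l -> cov (ising (l *: J) 0) i i = 1.
Proof.
move=> l0; rewrite cov0 //.
under eq_bigr do rewrite sg_sqr mul1r.
by rewrite divff // gt_eqF.
Qed.

(** In zero field the means vanish, so covariances are correlations and the Griffiths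
    inequalities apply. *)
Lemma cov_zero_field_mono l l' i j : 0 <= l -> l <= l' ->
  0 <= cov (ising (l *: J) 0) i j <= cov (ising (l' *: J) 0) i j.
Proof.
move=> l0 ll'; have l'0 : 0 <= l' by exact: le_trans ll'.
rewrite !cov0 //; apply/andP; split.
  by apply: divr_ge0; [apply: correlation_quad_ge0 => *; exact: N_ge0|exact: ltW].
rewrite ler_pdivrMr // mulrAC ler_pdivlMr //.
by apply: correlation_quad_mono => *; exact: N_le.
Qed.

Lemma chi_mono l l' : 0 <= l -> l <= l' -> chi J l <= chi J l'.
Proof. by move=> l0 ll'; apply: opnorm_le => i j; exact: cov_zero_field_mono. Qed.

Lemma chi_ge0 l : 0 <= chi J l. Proof. exact: opnorm_ge0. Qed.

Lemma chi_ge1 l : (0 < n)%N -> 0 <= l -> 1 <= chi J l.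
Proof.
move=> n0 l0; pose i := Ordinal n0.
pose e : 'cV[R]_n := delta_mx i 0.
have ei : e i 0 = 1 by rewrite mxE !eqxx.
have ej j : j != i -> e j 0 = 0 by move=> ji; rewrite mxE (negbTE ji).
have ee : inner e e = 1.
  rewrite /inner (bigD1 i) //= big1 => [|j ji]; first by rewrite ei mulr1 addr0.
  by rewrite ej // mul0r.
have := inner_mulmx_le (cov (ising (l *: J) 0)) e.
rewrite ee mulr1; apply: le_trans.
rewrite /inner (bigD1 i) //= big1 => [|j ji]; last by rewrite ej // mul0r.
rewrite ei mul1r addr0 mxE (bigD1 i) //= big1 => [|j ji].
  by rewrite ei mulr1 addr0 cov_zero_field_diag.
by rewrite ej // mulr0.
Qed.

(** The entrywise comparison of cov_ising_le passes to quadratic forms; this is what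
    makes the susceptibility at zero field control every external field at once. *)
Lemma variance_le_chi l v (t : 'cV[R]_n) : 0 <= l ->
  inner t (cov (ising (l *: J) v) *m t) <= chi J l * inner t t.
Proof.
move=> l0; apply: inner_mulmx_le_dom => i j.
by apply: cov_ising_le => *; [exact: lJ_sym|exact: lJ_ge0].
Qed.

End Susceptibility.

(** * Entropy *)

Section Entropy.
Context {R : realType}.

Lemma xlnx_tangent (t c : R) : 0 <= t -> 0 < c -> 0 <= t * ln t - t * ln c - t + c.
Proof.
move=> t0 c0; have [->|tn0] := eqVneq t 0; first by rewrite !mul0r !subr0 add0r ltW.
have tp : 0 < t by rewrite lt_def tn0.
have ct : 0 < c / t by rewrite divr_gt0.
have : ln (c / t) <= c / t - 1.
  by rewrite -{1}(subrKC 1 (c / t)); apply: le_ln1Dx; lra.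
rewrite ln_div ?posrE // => h.
have : t * (ln c - ln t) <= t * (c / t - 1) by rewrite ler_pM2l.
by rewrite mulrBr mulrBr mulr1 mulrCA divff ?gt_eqF // mulr1; lra.
Qed.

Context {T : finType}.
Implicit Types (w f g h : T -> R).

(** Unnormalized entropy: for weights w of total mass z this is z times the
    entropy of f under the probability measure w / z. *)
Definition went w f : R :=
  \sum_x w x * (f x * ln (f x))
  - (\sum_x w x * f x) * ln ((\sum_x w x * f x) / \sum_x w x).

(** The weighted Bregman divergence of f from the constant c; the entropy is its
    minimum over c, attained at the mean of f. *)
Definition wgap w f c : R := \sum_x w x * (f x * ln (f x) - f x * ln c - f x + c).

Lemma wgapE w f c : wgap w f c = \sum_x w x * (f x * ln (f x))
  - (\sum_x w x * f x) * ln c - (\sum_x w x * f x) + (\sum_x w x) * c.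
Proof.
rewrite /wgap !mulr_suml -!sumrB -big_split /=.
by apply: eq_bigr => x _; ring.
Qed.

Lemma wgap_went w f c : 0 < \sum_x w x -> wgap w f c = went w f +
  (\sum_x w x) * ((\sum_x w x * f x) / (\sum_x w x) * ln ((\sum_x w x * f x) / (\sum_x w x))
   - (\sum_x w x * f x) / (\sum_x w x) * ln c - (\sum_x w x * f x) / (\sum_x w x) + c).
Proof. by move=> Z0; rewrite wgapE /went; field; rewrite gt_eqF. Qed.

Lemma went_le w f c : 0 < \sum_x w x -> (forall x, 0 <= w x) -> (forall x, 0 <= f x) ->
  0 < c -> went w f <= wgap w f c.
Proof.
move=> Z0 w0 f0 c0; rewrite wgap_went // lerDl mulr_ge0 ?(ltW Z0) //.
by apply: xlnx_tangent => //; rewrite divr_ge0 ?(ltW Z0) // sumr_ge0 // => x _; rewrite mulr_ge0.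
Qed.

Lemma wentE w f : 0 < \sum_x w x -> went w f = wgap w f ((\sum_x w x * f x) / \sum_x w x).
Proof. by move=> Z0; rewrite wgap_went //; ring. Qed.

Lemma sum_gt0_inhabited (F : T -> R) : 0 < \sum_x F x -> exists x : T, True.
Proof.
move=> F0; apply/not_existsP => no; have : \sum_x F x = 0.
  by apply: big1 => x _; case: (no x).
by move=> h; rewrite h ltxx in F0.
Qed.

Lemma went_zero w f : (forall x, f x = 0) -> went w f = 0.
Proof.
move=> f0; rewrite /went big1 => [|x _]; last by rewrite f0 !mul0r mulr0.
by rewrite big1 => [|x _]; rewrite ?f0 ?mulr0 // mul0r subr0.
Qed.

Lemma went_cases w f : (forall x, 0 < w x) -> (forall x, 0 <= f x) ->
  (forall x, f x = 0) \/ 0 < \sum_x w x * f x.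
Proof.
move=> w0 f0; have [[x fx]|h] := pselect (exists x, f x != 0).
  right; rewrite (bigD1 x) //= ltr_pwDl //.
    by rewrite mulr_gt0 // lt_def fx f0.
  by apply: sumr_ge0 => y _; rewrite mulr_ge0 // ltW.
by left=> x; apply/eqP/negPn/negP => fx; apply: h; exists x.
Qed.

Lemma weight_sum_gt0 w (x : T) : (forall x, 0 < w x) -> 0 < \sum_x w x.
Proof.
by move=> w0; rewrite (bigD1 x) //= ltr_pwDl // sumr_ge0 // => y _; rewrite ltW.
Qed.

Lemma went_ge0 w f : (forall x, 0 < w x) -> (forall x, 0 <= f x) -> 0 <= went w f.
Proof.
move=> w0 f0; have [fz|F0] := went_cases _ _ w0 f0; first by rewrite went_zero.
have [x _] := sum_gt0_inhabited _ F0.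
have Z0 := weight_sum_gt0 w x w0.
rewrite wentE //; apply: sumr_ge0 => y _; rewrite mulr_ge0 ?(ltW (w0 y)) //.
by apply: xlnx_tangent => //; rewrite divr_gt0.
Qed.

(** For each constant c, the divergence wgap is linear in the weights, and the entropy
    is an infimum of such functionals. *)
Lemma went_concave (I : finType) (p : I -> R) (w : I -> T -> R) (v : T -> R) f :
  (forall k, 0 <= p k) -> (forall k x, 0 < w k x) -> (forall x, 0 < v x) ->
  (forall x, v x = \sum_k p k * w k x) -> (forall x, 0 <= f x) ->
  \sum_k p k * went (w k) f <= went v f.
Proof.
move=> p0 w0 v0 vE f0; have [fz|F0] := went_cases _ _ v0 f0.
  by rewrite went_zero // big1 // => k _; rewrite went_zero // mulr0.
have [x _] := sum_gt0_inhabited _ F0.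
have Z0 := weight_sum_gt0 v x v0.
rewrite wentE //; set c := (X in wgap v f X).
have c0 : 0 < c by rewrite divr_gt0.
rewrite (_ : wgap v f c = \sum_k p k * wgap (w k) f c); last first.
  rewrite /wgap; under [RHS]eq_bigr do rewrite mulr_sumr.
  rewrite exchange_big; apply: eq_bigr => y _.
  by rewrite vE mulr_suml; apply: eq_bigr => k _; rewrite mulrA.
apply: ler_sum => k _; rewrite ler_wpM2l //; apply: went_le => //.
  exact: weight_sum_gt0.
by move=> y; rewrite ltW.
Qed.

(** The divergence of f from the mean of f under w' has nonnegative terms. *)
Lemma went_le_weight w w' f : (forall x, 0 < w x) -> (forall x, w x <= w' x) ->
  (forall x, 0 <= f x) -> went w f <= went w' f.
Proof.
move=> w0 ww f0; have w'0 x : 0 < w' x by exact: lt_le_trans (ww x).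
have [fz|F0] := went_cases _ _ w'0 f0; first by rewrite !went_zero.
have [x _] := sum_gt0_inhabited _ F0.
have Z0 := weight_sum_gt0 w' x w'0; have Z1 := weight_sum_gt0 w x w0.
rewrite (wentE w') //; set c := (X in wgap w' f X).
have c0 : 0 < c by rewrite divr_gt0.
apply: (@le_trans _ _ (wgap w f c)).
  by apply: went_le => // y; rewrite ltW.
by apply: ler_sum => y _; apply: ler_wpM2r => //; exact: xlnx_tangent.
Qed.

Lemma went_scale (a : R) w f : a != 0 -> went (fun x => a * w x) f = a * went w f.
Proof.
move=> a0; rewrite /went.
have e (F : T -> R) : \sum_x a * w x * F x = a * \sum_x w x * F x.
  by rewrite mulr_sumr; apply: eq_bigr => x _; rewrite mulrA.
by rewrite !e -mulr_sumr -mulf_div divff // mul1r mulrBr mulrA.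
Qed.

(** One half of the Gibbs variational principle: the tangent inequality xlnx_tangent is
    applied to f at the multiple c * h of h, where c is the mean of f. *)
Lemma went_dual w f h : (forall x, 0 < w x) -> (forall x, 0 <= f x) ->
  (forall x, 0 <= h x) -> (forall x, 0 < f x -> 0 < h x) ->
  \sum_x w x * h x <= \sum_x w x ->
  \sum_x w x * (f x * ln (h x)) <= went w f.
Proof.
move=> w0 f0 h0 fh hle; have [fz|F0] := went_cases _ _ w0 f0.
  by rewrite went_zero // big1 // => x _; rewrite fz mul0r mulr0.
have [x _] := sum_gt0_inhabited _ F0.
have Z0 := weight_sum_gt0 w x w0.
set c := (\sum_x w x * f x) / \sum_x w x.
have c0 : 0 < c by rewrite divr_gt0.
rewrite -subr_ge0.
apply: (@le_trans _ _ (\sum_x w x * (f x - c * h x))).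
  rewrite (_ : \sum_x _ = c * (\sum_x w x - \sum_x w x * h x)).
    by rewrite mulr_ge0 ?subr_ge0 // ltW.
  rewrite mulrBr /c mulrAC -mulrA mulfV ?gt_eqF // mulr1 mulr_sumr -sumrB.
  by apply: eq_bigr => y _; rewrite mulrBr; congr (_ - _); rewrite -/c; ring.
rewrite /went -/c mulr_suml; clearbody c; rewrite -!sumrB; apply: ler_sum => y _.
rewrite (mulrAC (w y)) -!mulrA -!mulrBr ler_pM2l //.
have [fy0|fy0] := eqVneq (f y) 0.
  have : 0 <= c * h y by rewrite mulr_ge0 // ltW.
  by rewrite fy0 !mul0r; lra.
have fy : 0 < f y by rewrite lt_def fy0 f0.
have hy := fh _ fy.
have := xlnx_tangent (f y) (c * h y) (ltW fy) (mulr_gt0 c0 hy).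
by rewrite lnM ?posrE //; lra.
Qed.

End Entropy.

(** * Transport inequality from variance bounds *)

Section Transport.
Context {R : realType}.

(** Taylor's inequality of order two, by two applications of the mean value theorem. *)
Lemma quadratic_upper (G g g2 : R -> R) (C t : R) : 0 <= t ->
  (forall x : R, 0 <= x <= t -> is_derive x 1 G (g x)) ->
  (forall x : R, 0 <= x <= t -> is_derive x 1 g (g2 x)) ->
  (forall x : R, 0 <= x <= t -> g2 x <= C) ->
  G t <= G 0 + g 0 * t + C * t ^+ 2 / 2.
Proof.
move=> t0 dG dg g2C.
have cont (F dF : R -> R) s : s <= t ->
    (forall x : R, 0 <= x <= t -> is_derive x 1 F (dF x)) ->
    {within `[0, s], continuous F}.
  move=> st dF'; apply: derivable_within_continuous => x.
  rewrite in_itv /= => /andP[x0 xs]; have := dF' x.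
  by rewrite x0 (le_trans xs st) => /(_ isT)[].
have der (F dF : R -> R) s : s <= t ->
    (forall x : R, 0 <= x <= t -> is_derive x 1 F (dF x)) ->
    forall x, x \in `]0, s[ -> is_derive x 1 F (dF x).
  move=> st dF' x; rewrite in_itv /= => /andP[x0 xs].
  by apply: dF'; rewrite (ltW x0) (ltW (lt_le_trans xs st)).
have slope s : 0 <= s -> s <= t -> g s <= g 0 + C * s.
  move=> s0 st; have [c] := MVT_segment s0 (der _ _ _ st dg) (cont _ _ _ st dg).
  rewrite in_itv /= => /andP[c0 cs]; have ct := le_trans cs st.
  rewrite subr0 => e; have := g2C c; rewrite c0 ct => /(_ isT) g2c.
  by have := ler_wpM2r s0 g2c; lra.
pose H s := G s - g 0 * s - C * s ^+ 2 / 2.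
have dH (x : R) : 0 <= x <= t -> is_derive x 1 H (g x - g 0 - C * x).
  move=> xt; have dGx := dG x xt.
  have -> : H = (G - (g 0 \*: id)) - ((C / 2) \*: ((@id R : R -> R) * @id R)).
    by apply/funext => s; rewrite /H !fctE /=; rewrite /GRing.scale /=; field.
  by apply: is_derive_eq; rewrite /GRing.scale /=; field.
have [c ct] := MVT_segment t0 (der _ _ _ (lexx t) dH) (cont _ _ _ (lexx t) dH).
move: ct; rewrite in_itv /= => /andP[c0 ct].
rewrite subr0 /H => e.
have : (g c - g 0 - C * c) * t <= 0 by rewrite mulr_le0_ge0 //; have := slope c c0 ct; lra.
by rewrite -e expr0n /=; lra.
Qed.

Lemma is_derive_bigsum (T : Type) (r : seq T) (F dF : T -> R -> R) (t : R) :
  (forall x, is_derive t 1 (F x) (dF x t)) ->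
  is_derive t 1 (fun s => \sum_(x <- r) F x s) (\sum_(x <- r) dF x t).
Proof.
move=> dFt; elim: r => [|x r IH].
  rewrite big_nil; under eq_fun do rewrite big_nil; exact: is_derive_cst.
rewrite big_cons; under eq_fun do rewrite big_cons.
exact: is_deriveD.
Qed.

Context {T : finType}.
Implicit Types (w f g : T -> R).

Let msum w g i t := \sum_x w x * g x ^+ i * expR (t * g x).

Let is_derive_msum w g i (t : R) : is_derive t 1 (msum w g i) (msum w g i.+1 t).
Proof.
apply: (@is_derive_bigsum T (index_enum T) (fun x t => w x * g x ^+ i * expR (t * g x))
  (fun x t => w x * g x ^+ i.+1 * expR (t * g x))) => x.
have d1 : is_derive t 1 (g x \*: (@id R)) (g x *: 1) by apply: is_deriveZ.
have d2 := @is_derive1_comp R expR (g x \*: (@id R)) t _ _ (is_derive_expR _) d1.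
have d3 := is_deriveZ (w x * g x ^+ i) d2.
have -> : (fun s => w x * g x ^+ i * expR (s * g x)) =
    (w x * g x ^+ i) \*: (expR \o (g x \*: (@id R))).
  by apply/funext => s; rewrite /= /GRing.scale /= (mulrC s).
by apply: is_derive_eq; rewrite /= /GRing.scale /= exprSr (mulrC t); ring.
Qed.

(** If the exponential tilts of a measure along g all give g variance at most C,
    then g is sub-Gaussian, and by duality its mean moves by at most the square
    root of 2 C times the relative entropy. *)
Lemma transport w f g (C : R) : (forall x, 0 < w x) -> (forall x, 0 <= f x) ->
  0 < C -> 0 < \sum_x w x * f x ->
  (forall t, (\sum_x w x * expR (t * g x) * g x ^+ 2) / (\sum_x w x * expR (t * g x))
     - ((\sum_x w x * expR (t * g x) * g x) / (\sum_x w x * expR (t * g x))) ^+ 2 <= C) ->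
  (\sum_x w x * f x) * ((\sum_x w x * f x * g x) / (\sum_x w x * f x)
      - (\sum_x w x * g x) / (\sum_x w x)) ^+ 2 <= 2 * C * went w f.
Proof.
move=> w0 f0 C0 F0; wlog sgn : g / 0 <= (\sum_x w x * f x * g x) / (\sum_x w x * f x)
      - (\sum_x w x * g x) / (\sum_x w x).
  move=> wl hvar; case: (lerP 0 ((\sum_x w x * f x * g x) / (\sum_x w x * f x)
      - (\sum_x w x * g x) / (\sum_x w x))) => [s0|s0]; first exact: wl.
  have e (v : T -> R) : \sum_x v x * - g x = - \sum_x v x * g x.
    by rewrite -sumrN; apply: eq_bigr => x _; rewrite mulrN.
  have := wl (fun x => - g x); rewrite !e !mulNr.
  rewrite (_ : - _ - - _ = - ((\sum_x w x * f x * g x) / (\sum_x w x * f x)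
      - (\sum_x w x * g x) / (\sum_x w x))); last by ring.
  rewrite oppr_ge0 sqrrN; apply; first exact: ltW.
  move=> t; rewrite e mulNr sqrrN; have := hvar (- t).
  under eq_bigr do rewrite mulNr -mulrN -[g _ ^+ 2]sqrrN.
  under [X in _ / X - _ <= _]eq_bigr do rewrite mulNr -mulrN.
  under [X in _ - (X / _) ^+ 2 <= _]eq_bigr do rewrite mulNr -mulrN.
  by under [X in _ - (_ / X) ^+ 2 <= _]eq_bigr do rewrite mulNr -mulrN.
move=> hvar; have [x0 _] := sum_gt0_inhabited _ F0.
set F := \sum_x w x * f x in F0 sgn *; set Z := \sum_x w x.
have Z0 : 0 < Z by exact: weight_sum_gt0.
pose S i t := msum w g i t.
have S0 t : 0 < S 0 t.
  by apply: weight_sum_gt0 => // x; rewrite expr0 mulr1 mulr_gt0 ?expR_gt0.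
have S00 : S 0 0 = Z by apply: eq_bigr => x _; rewrite mul0r expR0 !mulr1.
have S10 : S 1 0 = \sum_x w x * g x by apply: eq_bigr => x _; rewrite mul0r expR0 mulr1.
set D := (X in 0 <= X) in sgn *.
pose t := D / C.
have t0 : 0 <= t by rewrite divr_ge0 // ltW.
(* The second derivative of the logarithm of the moment generating function is the
   variance under the tilt. *)
have upper : ln (S 0 t) <= ln Z + (\sum_x w x * g x) / Z * t + C * t ^+ 2 / 2.
  have := @quadratic_upper (fun s => ln (S 0 s)) (fun s => S 1 s / S 0 s)
    (fun s => S 2 s / S 0 s - (S 1 s / S 0 s) ^+ 2) C t t0.
  rewrite S00 S10; apply => s _.
  - have := @is_derive1_comp R (@ln R) (S 0) s _ _ (is_derive1_ln (S0 s)) (is_derive_msum w g 0 s).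
    by move=> h; apply: is_derive_eq h _; rewrite mulrC.
  - have dV := is_deriveV (lt0r_neq0 (S0 s)) (is_derive_msum w g 0 s).
    have := is_deriveM (is_derive_msum w g 1 s) dV.
    move=> h; apply: is_derive_eq h _; rewrite /GRing.scale /=.
    rewrite /S; field; exact: lt0r_neq0 (S0 s).
  - have e0 : S 0 s = \sum_x w x * expR (s * g x).
      by apply: eq_bigr => x _; rewrite expr0 mulr1.
    have e1 : S 1 s = \sum_x w x * expR (s * g x) * g x.
      by apply: eq_bigr => x _; rewrite expr1 mulrAC.
    have e2 : S 2 s = \sum_x w x * expR (s * g x) * g x ^+ 2.
      by apply: eq_bigr => x _; rewrite mulrAC.
    by rewrite e0 e1 e2; exact: hvar.
(* The test function in the variational principle is the normalized tilt, and t was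
   chosen so as to make the resulting bound optimal. *)
pose h x := Z / S 0 t * expR (t * g x).
have h0 x : 0 < h x by rewrite mulr_gt0 ?expR_gt0 // divr_gt0.
have dual := went_dual w f h w0 f0 (fun x => ltW (h0 x)) (fun x _ => h0 x).
have {dual} : \sum_x w x * (f x * ln (h x)) <= went w f.
  apply: dual; rewrite (_ : \sum_x w x * h x = Z / S 0 t * S 0 t); first by rewrite divfK ?gt_eqF.
  by rewrite mulr_sumr; apply: eq_bigr => x _; rewrite /h expr0; ring.
have -> : \sum_x w x * (f x * ln (h x)) =
    F * (ln Z - ln (S 0 t)) + t * \sum_x w x * f x * g x.
  rewrite mulr_suml mulr_sumr -big_split /=; apply: eq_bigr => x _.
  rewrite /h lnM ?posrE ?expR_gt0 ?divr_gt0 // ln_div ?posrE // expRK; ring.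
move=> hent.
have fg : \sum_x w x * f x * g x = F * (D + (\sum_x w x * g x) / Z).
  by rewrite /D subrK mulrC divfK ?gt_eqF.
have : F * (t * D - C * t ^+ 2 / 2) <= went w f.
  apply: le_trans hent; rewrite fg.
  have : F * (ln (S 0 t)) <= F * (ln Z + (\sum_x w x * g x) / Z * t + C * t ^+ 2 / 2).
    by rewrite ler_pM2l.
  lra.
rewrite (_ : t * D - _ = D ^+ 2 / (2 * C)); last by rewrite /t; field; rewrite gt_eqF.
by rewrite mulrA ler_pdivrMr ?mulr_gt0 // [leRHS]mulrC.
Qed.

End Transport.

(** * Single-site entropies and Glauber dynamics *)

Section SingleSite.
Context {R : realType} {n : nat}.
Implicit Types (w f g : cube n -> R) (x y : cube n) (i j : 'I_n).

(** The states of the spin at i are indexed by whether the spin of x is flipped, so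
    that site_ent is symmetric under flipping x. *)
Definition flip_if i x (b : bool) : cube n := if b then flip x i else x.

Definition site_ent w f i x : R :=
  went (fun b => w (flip_if i x b)) (fun b => f (flip_if i x b)).

(** The Dirichlet form of the entropy, that is, the unnormalized sum over the sites of
    the expected conditional entropies given the other spins.  The two endpoints of
    an edge of the cube give the same term, hence the factor 1 / 2. *)
Definition local_ent w f : R := \sum_i 2^-1 * \sum_x site_ent w f i x.

Definition site_avg w f i x : R :=
  (w x * f x + w (flip x i) * f (flip x i)) / (w x + w (flip x i)).

Lemma sum_flip i (F : cube n -> R) : \sum_x F (flip x i) = \sum_x F x.
Proof. by rewrite [RHS](reindex_inj (inv_inj (flipK i))). Qed.

Lemma site_avg_flip w f i x : site_avg w f i (flip x i) = site_avg w f i x.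
Proof. by rewrite /site_avg flipK [w (flip x i) + _]addrC [X in X / _]addrC. Qed.

Lemma site_avg_ge0 w f i x : (forall x, 0 < w x) -> (forall x, 0 <= f x) ->
  0 <= site_avg w f i x.
Proof.
by move=> w0 f0; rewrite divr_ge0 // ?addr_ge0 ?mulr_ge0 // ltW.
Qed.

Lemma site_avg_gt0 w f i x : (forall x, 0 < w x) -> (forall x, 0 <= f x) ->
  0 < f x -> 0 < site_avg w f i x.
Proof.
move=> w0 f0 fx; apply: divr_gt0; last exact: addr_gt0.
rewrite ltr_pwDl ?mulr_gt0 //.
by rewrite mulr_ge0 // ltW.
Qed.

Lemma sum_site_avg w g i (h : R -> R) : (forall x, 0 < w x) ->
  \sum_x (w x * g x + w (flip x i) * g (flip x i)) * h (site_avg w g i x) =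
  2 * \sum_x w x * (site_avg w g i x * h (site_avg w g i x)).
Proof.
move=> w0; pose F x := w x * (site_avg w g i x * h (site_avg w g i x)).
transitivity (\sum_x (F x + F (flip x i))); last first.
  by rewrite big_split /= sum_flip; ring.
apply: eq_bigr => x _; rewrite /F site_avg_flip -mulrDl mulrA.
by congr (_ * _); rewrite /site_avg [RHS]mulrC divfK // gt_eqF // addr_gt0.
Qed.

Lemma expect_site_avg w g i : (forall x, 0 < w x) ->
  \sum_x w x * site_avg w g i x = \sum_x w x * g x.
Proof.
move=> w0; have := sum_site_avg w g i (fun=> 1) w0.
under eq_bigr do rewrite mulr1; under [X in _ = _ * X]eq_bigr do rewrite mulr1.
rewrite big_split /= (sum_flip i (fun x => w x * g x)); lra.
Qed.

Lemma site_entE w f i x : site_ent w f i x =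
  w x * (f x * ln (f x)) + w (flip x i) * (f (flip x i) * ln (f (flip x i)))
  - (w x * f x + w (flip x i) * f (flip x i)) * ln (site_avg w f i x).
Proof.
rewrite /site_ent /went !big_bool /= /site_avg.
by rewrite addrC [w (flip x i) * f _ + _]addrC [w (flip x i) + _]addrC
  [X in X - _]addrC addrC.
Qed.

Lemma local_entE w f : (forall x, 0 < w x) -> local_ent w f =
  \sum_i (\sum_x w x * (f x * ln (f x))
          - \sum_x w x * (site_avg w f i x * ln (site_avg w f i x))).
Proof.
move=> w0; apply: eq_bigr => i _; under eq_bigr do rewrite site_entE.
rewrite sumrB big_split /= (sum_flip i (fun x => w x * (f x * ln (f x)))).
by rewrite sum_site_avg //; field.
Qed.

Lemma local_ent_concave (I : finType) (p : I -> R) (w : I -> cube n -> R)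
    (v : cube n -> R) f :
  (forall k, 0 <= p k) -> (forall k x, 0 < w k x) -> (forall x, 0 < v x) ->
  (forall x, v x = \sum_k p k * w k x) -> (forall x, 0 <= f x) ->
  \sum_k p k * local_ent (w k) f <= local_ent v f.
Proof.
move=> p0 w0 v0 vE f0; under eq_bigr do rewrite mulr_sumr.
rewrite exchange_big; apply: ler_sum => i _ /=.
under eq_bigr do rewrite mulrCA mulr_sumr.
rewrite -mulr_sumr exchange_big ler_pM2l ?invr_gt0 //=; apply: ler_sum => x _.
exact: went_concave.
Qed.

Lemma local_ent_le_weight w w' f : (forall x, 0 < w x) -> (forall x, w x <= w' x) ->
  (forall x, 0 <= f x) -> local_ent w f <= local_ent w' f.
Proof.
move=> w0 ww f0; apply: ler_sum => i _; rewrite ler_pM2l ?invr_gt0 //.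
by apply: ler_sum => x _; apply: went_le_weight.
Qed.

Lemma local_ent_scale (a : R) w f : a != 0 ->
  local_ent (fun x => a * w x) f = a * local_ent w f.
Proof.
move=> a0; rewrite mulr_sumr; apply: eq_bigr => i _.
rewrite mulrCA; congr (_ * _); rewrite mulr_sumr; apply: eq_bigr => x _.
exact: went_scale.
Qed.

Lemma flip_invariant_const g : (forall i x, g (flip x i) = g x) ->
  forall x y, g x = g y.
Proof.
move=> inv x y; have [m] := ubnP #|[set i | x i != y i]%SET|.
elim: m x => // m IH x xy.
have [/existsP[i xyi]|] := boolP [exists i, x i != y i]; last first.
  rewrite negb_exists => /forallP h; congr g; apply/ffunP => i.
  by apply/eqP; have := h i; rewrite negbK.
rewrite -(inv i x); apply: IH; rewrite -ltnS; apply: leq_trans xy.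
rewrite ltnS; apply: proper_card; apply/properP; split.
  apply/fintype.subsetP => j; rewrite !inE ffunE; case: (eqVneq j i) => [->|//].
  by rewrite xyi.
exists i; rewrite inE //= ffunE eqxx; move: xyi.
by case: (x i); case: (y i).
Qed.

Section Tensorization.
Variable w : cube n -> R.
Hypothesis w0 : forall x, 0 < w x.
Hypothesis w_prod : forall i j x, i != j ->
  w (flip (flip x i) j) * w x = w (flip x i) * w (flip x j).

Let flipC i j x : flip (flip x i) j = flip (flip x j) i.
Proof.
apply/ffunP => k; rewrite !ffunE; case: (k == i); case: (k == j) => //.
Qed.

Let site_avg_invariant g i j : (forall x, g (flip x j) = g x) ->
  forall x, site_avg w g i (flip x j) = site_avg w g i x.
Proof.
move=> inv x; have [->|ij] := eqVneq i j; first exact: site_avg_flip.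
rewrite /site_avg inv -(flipC i j x) inv.
have e := w_prod i j x ij.
have pos y z : w y + w z != 0 by rewrite gt_eqF // addr_gt0.
apply/eqP; rewrite eqr_div ?pos // -subr_eq0; apply/eqP.
transitivity (- ((g x - g (flip x i)) *
   (w (flip (flip x i) j) * w x - w (flip x i) * w (flip x j)))); first by ring.
by rewrite e subrr mulr0 oppr0.
Qed.

Let avgs (s : seq 'I_n) f := foldl (fun g i => site_avg w g i) f s.

Let avgs_ge0 s f : (forall x, 0 <= f x) -> forall x, 0 <= avgs s f x.
Proof.
move=> f0; elim/last_ind: s => [//|s i IH] x; rewrite /avgs foldl_rcons.
exact: site_avg_ge0.
Qed.

Let avgs_gt0 s f x : (forall x, 0 <= f x) -> 0 < f x -> 0 < avgs s f x.
Proof.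
move=> f0 fx; elim/last_ind: s => [//|s i IH]; rewrite /avgs foldl_rcons.
by apply: site_avg_gt0 => // y; exact: avgs_ge0.
Qed.

Let avgs_invariant s f i : i \in s -> forall x, avgs s f (flip x i) = avgs s f x.
Proof.
elim/last_ind: s => [//|s j IH]; rewrite mem_rcons inE => ijs x.
rewrite /avgs foldl_rcons; have [->|ij] := eqVneq i j; first exact: site_avg_flip.
by apply: site_avg_invariant; apply: IH; move: ijs; rewrite (negbTE ij).
Qed.

Let avgs_mean s f : \sum_x w x * avgs s f x = \sum_x w x * f x.
Proof.
elim/last_ind: s => [//|s i IH]; rewrite -[RHS]IH /avgs foldl_rcons.
exact: expect_site_avg.
Qed.

Let one_site f g i : (forall x, 0 <= f x) -> (forall x, 0 <= g x) ->
  (forall x, 0 < f x -> 0 < g x) ->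
  \sum_x w x * (f x * (ln (g x) - ln (site_avg w g i x))) <=
  2^-1 * \sum_x site_ent w f i x.
Proof.
move=> f0 g0 fg.
set F := fun x => w x * (f x * (ln (g x) - ln (site_avg w g i x))).
rewrite (_ : \sum_x _ = 2^-1 * \sum_x (F x + F (flip x i))); last first.
  by rewrite big_split /= sum_flip /F; field.
rewrite ler_pM2l ?invr_gt0 //; apply: ler_sum => x _.
pose h b := g (flip_if i x b) / site_avg w g i x.
have a0 := site_avg_ge0 w g i x w0 g0.
have fa b : 0 < f (flip_if i x b) -> 0 < site_avg w g i x.
  case: b => /= /fg gx; last exact: site_avg_gt0.
  by rewrite -site_avg_flip; exact: site_avg_gt0.
have := @went_dual R bool (fun b => w (flip_if i x b)) (fun b => f (flip_if i x b)) h.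
rewrite -/(site_ent w f i x) => dual.
have {dual} : \sum_b w (flip_if i x b) * (f (flip_if i x b) * ln (h b)) <= site_ent w f i x.
  apply: dual => //.
  - by move=> b; rewrite divr_ge0.
  - by move=> b fb; rewrite divr_gt0 ?fg // (fa b).
  - rewrite !big_bool /= /h /=; have [->|an0] := eqVneq (site_avg w g i x) 0.
      by rewrite invr0 !mulr0 addr0 addr_ge0 // ltW.
    have e : site_avg w g i x * (w x + w (flip x i)) =
        w x * g x + w (flip x i) * g (flip x i).
      by rewrite divfK // gt_eqF // addr_gt0.
    by rewrite !mulrA -mulrDl ler_pdivrMr ?lt_def ?an0 //; lra.
apply: le_trans; rewrite big_bool /= addrC /F site_avg_flip.
have term b : w (flip_if i x b) * (f (flip_if i x b) *
    (ln (g (flip_if i x b)) - ln (site_avg w g i x))) =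
    w (flip_if i x b) * (f (flip_if i x b) * ln (h b)).
  have [->|fn0] := eqVneq (f (flip_if i x b)) 0; first by rewrite !mul0r.
  have fb : 0 < f (flip_if i x b) by rewrite lt_def fn0 f0.
  by rewrite /h ln_div ?posrE ?fg // (fa b).
by rewrite (term true) (term false).
Qed.

(** Subadditivity of the entropy for product measures: the entropy is telescoped
    along successive averages over the coordinates, and each increment is tested
    against the variational formula for one conditional entropy. *)
Lemma went_le_local_ent f : (forall x, 0 <= f x) -> went w f <= local_ent w f.
Proof.
move=> f0.
have tele s : \sum_x w x * (f x * (ln (f x) - ln (avgs s f x))) <=
    \sum_(i <- s) 2^-1 * \sum_x site_ent w f i x.
  elim/last_ind: s => [|s i IH].
    by rewrite big_nil /avgs /= big1 // => x _; rewrite subrr !mulr0.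
  rewrite -cats1 big_cat big_seq1 /=.
  have := one_site f (avgs s f) i f0 (avgs_ge0 s f f0) (fun x => avgs_gt0 s f x f0).
  move=> h; apply: le_trans (lerD IH h); rewrite -big_split /=.
  apply: ler_sum => x _; rewrite cats1 /avgs foldl_rcons -mulrDr -mulrDr.
  by rewrite -/(avgs s f) addrA subrK.
have const x : avgs (index_enum 'I_n) f x = (\sum_x w x * f x) / \sum_x w x.
  have c y : avgs (index_enum 'I_n) f y = avgs (index_enum 'I_n) f x.
    apply: flip_invariant_const => i z; apply: avgs_invariant.
    exact: mem_index_enum.
  rewrite -(avgs_mean (index_enum 'I_n)); under eq_bigr do rewrite c.
  by rewrite -mulr_suml [X in X / _]mulrC mulfK // gt_eqF // (weight_sum_gt0 w x).
apply: le_trans (tele (index_enum _)).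
rewrite /went le_eqVlt; apply/orP; left; apply/eqP.
rewrite mulr_suml -sumrB; apply: eq_bigr => x _.
by rewrite const; ring.
Qed.

End Tensorization.

(** The kernel picks a site uniformly and averages over the spin at that site. *)
Lemma kernel_glauber nu f x : (0 < n)%N -> (forall x, 0 < nu x) ->
  kernel_app (glauber nu) f x = n%:R^-1 * \sum_i site_avg nu f i x.
Proof.
move=> n0 nu0; rewrite /kernel_app (bigD1 x) //=.
have diffx y : #|[set i | x i != y i]%SET| = 1%N -> exists i, y = flip x i.
  move/eqP/cards1P => [i hi]; exists i; apply/ffunP => j; rewrite ffunE.
  have : (j \in [set i | x i != y i]%SET) = (j == i) by rewrite hi inE.
  by rewrite inE; case: (j == i); case: (x j); case: (y j).
have flipx i : #|[set j | x j != flip x i j]%SET| = 1%N.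
  apply/eqP/cards1P; exists i; apply/setP => j; rewrite !inE ffunE.
  by case: (j == i); case: (x j).
have gxx : glauber nu x x = n%:R^-1 * \sum_i (nu x / (nu x + nu (flip x i))).
  rewrite /glauber eqxx (_ : [set i | x i != x i]%SET = finset.set0) ?cards0 //.
  by apply/setP => i; rewrite !inE eqxx.
have inj : injective (flip x).
  move=> i j /ffunP/(_ i); rewrite !ffunE eqxx.
  by case: (i =P j) => // _; case: (x i).
have flip_neq i : flip x i != x.
  by apply/eqP => /ffunP/(_ i); rewrite ffunE eqxx; case: (x i).
rewrite gxx.
have -> : \sum_(y | y != x) glauber nu x y * f y =
    \sum_i n%:R^-1 * (nu (flip x i) / (nu x + nu (flip x i))) * f (flip x i).
  rewrite (bigID [pred y | y \in codom (flip x)]) /= [X in _ + X]big1 ?addr0; last first.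
    move=> y /andP[yx ny]; rewrite /glauber; case: ifP => [/eqP/diffx[i yi]|_].
      by rewrite yi codom_f in ny.
    by rewrite eq_sym (negbTE yx) mul0r.
  rewrite (reindex_onto (flip x) (fun y => odflt (Ordinal n0) [pick i | flip x i == y])) /=.
    apply: eq_big => [i|i _]; last by rewrite /glauber flipx eqxx.
    rewrite flip_neq codom_f /=; case: pickP => [j /eqP/inj ->|/(_ i)]; rewrite ?eqxx //.
  move=> y /andP[_ /codomP[i ->]]; case: pickP => [j /eqP //|/(_ i)]; rewrite ?eqxx //.
rewrite mulr_sumr mulr_suml -big_split [RHS]mulr_sumr /=; apply: eq_bigr => i _.
by rewrite /site_avg; field; rewrite !gt_eqF ?addr_gt0 // ltr0n.
Qed.

(** By convexity of x ln x, replacing f by the average over the sites of its site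
    averages loses at least the average of the entropies lost at the single sites. *)
Lemma Ent_glauber nu f : (0 < n)%N -> (forall x, 0 < nu x) -> \sum_x nu x = 1 ->
  (forall x, 0 <= f x) ->
  n%:R^-1 * local_ent nu f <= Ent nu f - Ent nu (kernel_app (glauber nu) f).
Proof.
move=> n0 nu0 nu1 f0; have nR : 0 < n%:R :> R by rewrite ltr0n.
rewrite (_ : kernel_app _ _ = fun x => n%:R^-1 * \sum_i site_avg nu f i x); last first.
  by apply/funext => x; exact: kernel_glauber.
set Pf := fun x => _.
have mean : expect nu Pf = expect nu f.
  rewrite /expect /Pf; under eq_bigr do rewrite mulrCA mulr_sumr.
  rewrite -mulr_sumr exchange_big /=; under eq_bigr do rewrite expect_site_avg //.
  by rewrite sumr_const card_ord -[X in _ * X]mulr_natl mulKf // gt_eqF.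
rewrite /Ent mean opprB addrA subrK local_entE //.
rewrite /expect; set E := \sum_x nu x * (f x * ln (f x)).
rewrite sumrB sumr_const card_ord mulrBr -[E *+ n]mulr_natl mulKf ?gt_eqF // lerD2l lerN2.
rewrite exchange_big mulr_sumr; apply: ler_sum => x _ /=.
rewrite -mulr_sumr [leRHS]mulrCA ler_pM2l //.
have a0 i : 0 <= site_avg nu f i x by exact: site_avg_ge0.
have P0 : 0 <= Pf x by rewrite mulr_ge0 ?invr_ge0 // ?sumr_ge0 // ltW.
have [Pz|Pn] := eqVneq (Pf x) 0.
  rewrite Pz mul0r big1 ?mulr0 // => i _.
  have : \sum_i site_avg nu f i x = 0.
    by move/eqP: Pz; rewrite mulf_eq0 invr_eq0 gt_eqF //= => /eqP.
  by move/eqP; rewrite psumr_eq0 // => /allP/(_ i (mem_index_enum _))/eqP ->; rewrite mul0r.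
have Pp : 0 < Pf x by rewrite lt_def Pn.
have : 0 <= \sum_i (site_avg nu f i x * ln (site_avg nu f i x)
   - site_avg nu f i x * ln (Pf x) - site_avg nu f i x + Pf x).
  by apply: sumr_ge0 => i _; exact: xlnx_tangent.
rewrite big_split /= !sumrB -mulr_suml sumr_const card_ord -[Pf x *+ n]mulr_natl.
have sE : \sum_i site_avg nu f i x = n%:R * Pf x by rewrite /Pf mulVKf // gt_eqF.
rewrite sE subrK subr_ge0 => h.
by rewrite -(ler_pM2l nR) mulVKf ?gt_eqF // mulrA.
Qed.

End SingleSite.

(** * Entropy lost by a mixture *)

Section JensenGap.
Context {R : realType}.

(** The second derivative 1 / x of x ln x is at most C between 1 and r. *)
Lemma xlnx_upper (r C : R) : 0 < r -> 1 <= C -> 1 <= C * r ->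
  r * ln r - r + 1 <= C * (r - 1) ^+ 2 / 2.
Proof.
move=> r0 C1 Cr.
have key (sg t : R) : sg * sg = 1 -> 0 <= t -> (forall x, 0 <= x <= t -> 0 < 1 + sg * x) ->
    (forall x, 0 <= x <= t -> 1 <= C * (1 + sg * x)) ->
    (1 + sg * t) * ln (1 + sg * t) - sg * t <= C * t ^+ 2 / 2.
  move=> ss t0 pos hC.
  have := @quadratic_upper R (fun x => (1 + sg * x) * ln (1 + sg * x) - sg * x)
    (fun x => sg * ln (1 + sg * x)) (fun x => (1 + sg * x)^-1) C t t0.
  rewrite !mulr0 !addr0 ln1 !mulr0 subr0 mul0r !add0r; apply.
  - move=> x xt; have p := pos x xt.
    pose l := (cst 1 + (sg \*: (@id R))) : R -> R.
    have dl : is_derive x 1 l sg.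
      by apply: is_derive_eq; rewrite add0r /GRing.scale /= mulr1.
    have lx : l x = 1 + sg * x by [].
    have dln : is_derive x 1 (@ln R \o l) ((1 + sg * x)^-1 * sg).
      by apply: is_derive1_comp; rewrite lx; exact: is_derive1_ln.
    have -> : (fun x => (1 + sg * x) * ln (1 + sg * x) - sg * x) =
        l * (@ln R \o l) - (sg \*: (@id R)).
      by apply/funext => y; rewrite !fctE /= /l !fctE.
    apply: is_derive_eq; rewrite /= lx /GRing.scale /=; field; exact: lt0r_neq0.
  - move=> x xt; have p := pos x xt.
    pose l := (cst 1 + (sg \*: (@id R))) : R -> R.
    have dl : is_derive x 1 l sg.
      by apply: is_derive_eq; rewrite add0r /GRing.scale /= mulr1.
    have lx : l x = 1 + sg * x by [].
    have dln : is_derive x 1 (@ln R \o l) ((1 + sg * x)^-1 * sg).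
      by apply: is_derive1_comp; rewrite lx; exact: is_derive1_ln.
    have -> : (fun x => sg * ln (1 + sg * x)) = sg \*: (@ln R \o l).
      by apply/funext => y; rewrite !fctE /= /l !fctE.
    by apply: is_derive_eq; rewrite /GRing.scale /= mulrCA ss mulr1.
  - by move=> x xt; rewrite -(mul1r (_^-1)) ler_pdivrMr ?pos // hC.
case: (lerP 1 r) => r1.
  have h : (1 + 1 * (r - 1)) * ln (1 + 1 * (r - 1)) - 1 * (r - 1) <= C * (r - 1) ^+ 2 / 2.
    apply: key; [by rewrite mulr1|lra| |]; move=> x /andP[x0 xt]; first lra.
    by rewrite mul1r; apply: (le_trans C1); rewrite ler_peMr; lra.
  by move: h; rewrite !mul1r (subrKC 1 r); lra.
have h : (1 + -1 * (1 - r)) * ln (1 + -1 * (1 - r)) - -1 * (1 - r) <= C * (1 - r) ^+ 2 / 2.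
  apply: key; [by rewrite mulrNN mulr1|lra| |]; move=> x /andP[x0 xt]; first lra.
  by apply: (le_trans Cr); rewrite ler_pM2l; lra.
have e : 1 + -1 * (1 - r) = r by ring.
by move: h; rewrite e; lra.
Qed.

Context {T K : finType}.

(** The concavity defect of the entropy.  For each component, testing the entropy of
    the mixture against the mean of f under w costs a divergence between two numbers:
    the averages of the tilt under f w and under w.  They are within a factor
    exp(2 rho) of each other, so the divergence is comparable to the square of their
    difference. *)
Lemma mixture_gap (w f v : T -> R) (p : K -> R) (y : K -> T -> R) (rho : R) :
  (forall x, 0 < w x) -> (forall x, 0 <= f x) -> (forall k, 0 <= p k) -> 0 <= rho ->
  (forall k x, `|y k x| <= rho) -> (forall x, 0 < v x) ->
  (forall x, v x = \sum_k p k * (w x * expR (y k x))) ->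
  0 < \sum_x w x * f x ->
  went v f - \sum_k p k * went (fun x => w x * expR (y k x)) f <=
  2^-1 * expR (3 * rho) * \sum_k p k * ((\sum_x w x * f x) *
    ((\sum_x w x * f x * expR (y k x)) / (\sum_x w x * f x)
     - (\sum_x w x * expR (y k x)) / \sum_x w x) ^+ 2).
Proof.
move=> w0 f0 p0 rho0 yrho v0 vE F0.
have [x0 _] := sum_gt0_inhabited _ F0.
set F := \sum_x w x * f x in F0 *; set Z := \sum_x w x.
have Z0 : 0 < Z by exact: weight_sum_gt0.
have c0 : 0 < F / Z by rewrite divr_gt0.
pose wk k x := w x * expR (y k x).
have wk0 k x : 0 < wk k x by rewrite mulr_gt0 ?expR_gt0.
have Zk0 k : 0 < \sum_x wk k x by exact: weight_sum_gt0.
have le1 : went v f <= \sum_k p k * wgap (wk k) f (F / Z).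
  apply: (@le_trans _ _ (wgap v f (F / Z))).
    by apply: went_le => //; [exact: weight_sum_gt0|move=> x; exact: ltW].
  rewrite /wgap; under [leRHS]eq_bigr do rewrite mulr_sumr.
  rewrite [leRHS]exchange_big /=; apply: ler_sum => x _.
  rewrite vE mulr_suml; apply: ler_sum => k _; by rewrite -mulrA lexx.
apply: (@le_trans _ _ (\sum_k p k * (wgap (wk k) f (F / Z) - went (wk k) f))).
  by under [leRHS]eq_bigr do rewrite mulrBr; rewrite sumrB lerD2r.
rewrite [leRHS]mulr_sumr; apply: ler_sum => k _; rewrite [leRHS]mulrCA ler_wpM2l //.
rewrite wgap_went // addrC addKr.
have Fk : \sum_x wk k x * f x = \sum_x w x * f x * expR (y k x).
  by apply: eq_bigr => x _; rewrite mulrAC.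
rewrite Fk; set Zk := \sum_x wk k x; set Fk' := \sum_x w x * f x * _.
have bound (u : T -> R) (V := \sum_x u x) : (forall x, 0 <= u x) -> 0 < V ->
    expR (- rho) <= (\sum_x u x * expR (y k x)) / V <= expR rho.
  move=> u0 V0; rewrite ler_pdivlMr // ler_pdivrMr // !mulr_sumr.
  apply/andP; split; apply: ler_sum => x _;
    have := yrho k x; rewrite ler_norml => /andP[y1 y2].
    by rewrite [leLHS]mulrC ler_wpM2l // ler_expR.
  by rewrite [leRHS]mulrC ler_wpM2l // ler_expR.
have /andP[nu1 nu2] : expR (- rho) <= Zk / Z <= expR rho.
  by apply: bound => // x; rewrite ltW.
have /andP[mu1 mu2] : expR (- rho) <= Fk' / F <= expR rho.
  by apply: bound => // x; rewrite mulr_ge0 // ltW.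
set en := Zk / Z in nu1 nu2 *; set em := Fk' / F in mu1 mu2 *.
have en0 : 0 < en by apply: lt_le_trans nu1; exact: expR_gt0.
have em0 : 0 < em by apply: lt_le_trans mu1; exact: expR_gt0.
have Fk0 : 0 < Fk' by move: em0; rewrite /em pmulr_lgt0 ?invr_gt0.
have FkE : Fk' / Zk = F / Z * (em / en).
  rewrite /em /en; field.
  by rewrite (gt_eqF F0) (gt_eqF (Zk0 k)) (gt_eqF Z0).
have r0 : 0 < em / en by rewrite divr_gt0.
rewrite FkE lnM ?posrE //.
rewrite (_ : Zk * _ = F * en * (em / en * ln (em / en) - em / en + 1)); last first.
  have -> : Zk = en * Z by rewrite /en divfK // gt_eqF.
  by field; rewrite (gt_eqF en0) (gt_eqF Z0).
have up : em / en * ln (em / en) - em / en + 1 <= expR (2 * rho) * (em / en - 1) ^+ 2 / 2.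
  apply: xlnx_upper => //.
    by rewrite -[leLHS]expR0 ler_expR mulr_ge0.
  rewrite mulrA ler_pdivlMr // mul1r (le_trans nu2) //.
  have -> : expR rho = expR (2 * rho) * expR (- rho).
    by rewrite -expRD; congr expR; ring.
  by rewrite ler_pM2l ?expR_gt0.
apply: (@le_trans _ _ (F * en * (expR (2 * rho) * (em / en - 1) ^+ 2 / 2))).
  by rewrite ler_pM2l // mulr_gt0.
rewrite (_ : F * en * _ = F * (em - en) ^+ 2 / 2 * (expR (2 * rho) / en)); last first.
  by field; rewrite gt_eqF.
rewrite (_ : 2^-1 * _ * _ = F * (em - en) ^+ 2 / 2 * expR (3 * rho)); last by field.
apply: ler_wpM2l; first by rewrite divr_ge0 // mulr_ge0 ?sqr_ge0 // ltW.
rewrite ler_pdivrMr //.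
have -> : expR (2 * rho) = expR (3 * rho) * expR (- rho).
  by rewrite -expRD; congr expR; ring.
by rewrite ler_pM2l ?expR_gt0.
Qed.

End JensenGap.

Section RankOne.
Context {R : realType} {n : nat}.
Implicit Types (A : 'M[R]_n) (x y u : 'cV[R]_n).

Let form A x y := inner x (A *m y).

(** Gaussian elimination: subtracting the square attached to a nonzero diagonal entry
    keeps the form positive semidefinite, clears that entry and makes no zero diagonal
    entry nonzero.  A positive semidefinite form with zero diagonal vanishes. *)
Lemma psd_sum_squares A : (forall i j, A i j = A j i) ->
  (forall x, 0 <= inner x (A *m x)) ->
  exists us : seq 'cV[R]_n, forall x,
    inner x (A *m x) = \sum_(u <- us) inner u x ^+ 2.
Proof.
have [m] := ubnP #|[set i | A i i != 0]%SET|; elim: m A => // m IH A Am A_sym A_psd.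
have sym x y : form A x y = form A y x.
  rewrite /form /inner; under eq_bigr do rewrite mxE mulr_sumr.
  rewrite exchange_big /=; apply: eq_bigr => i _; rewrite mxE mulr_sumr.
  by apply: eq_bigr => j _; rewrite (A_sym j i); ring.
have addl x y z : form A (x + y) z = form A x z + form A y z by exact: innerDl.
have addr x y z : form A x (y + z) = form A x y + form A x z.
  by rewrite sym addl !(sym x).
have scl a x y : form A (a *: x) y = a * form A x y by exact: innerZl.
have scr a x y : form A x (a *: y) = a * form A x y by rewrite sym scl sym.
pose e i : 'cV[R]_n := delta_mx i 0.
have ee i : form A (e i) (e i) = A i i.
  rewrite /form /inner (bigD1 i) //= big1 => [|j ji]; last by rewrite mxE (negbTE ji) mul0r.
  rewrite [e i i 0]mxE !eqxx mul1r addr0 mxE (bigD1 i) //= big1 => [|j ji].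
    by rewrite [e i i 0]mxE !eqxx mulr1 addr0.
  by rewrite [e i j 0]mxE (negbTE ji) mulr0.
have formE x y i : form A (e i) x = (A *m x) i 0.
  rewrite /form /inner (bigD1 i) //= big1 => [|j ji]; last by rewrite mxE (negbTE ji) mul0r.
  by rewrite [e i i 0]mxE !eqxx mul1r addr0.
have [[i Aii]|none] := pselect (exists i, A i i != 0); last first.
  exists [::] => x; rewrite big_nil.
  have Az i : (A *m x) i 0 = 0.
    rewrite -(formE x x).
    have diag0 : form A (e i) (e i) = 0.
      by rewrite ee; apply/eqP/negPn/negP => h; apply: none; exists i.
    set b := form A (e i) x; pose c := form A x x.
    have q t : 0 <= 2 * t * b + c.
      have := A_psd (t *: e i + x); rewrite -/(form A _ _) addl !addr !scl !scr diag0.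
      by rewrite (sym x) -/b -/c; lra.
    apply/eqP/negPn/negP => b0.
    have := q (- (c + 1) / (2 * b)); rewrite (_ : 2 * _ * b = - (c + 1)); last by field.
    by lra.
  by apply: big1 => i _; rewrite Az mulr0.
have Ap : 0 < A i i by rewrite lt_def Aii -ee A_psd.
pose u := (Num.sqrt (A i i))^-1 *: (A *m e i).
have ux x : inner u x ^+ 2 = form A (e i) x ^+ 2 / A i i.
  rewrite /u innerZl exprMn exprVn sqr_sqrtr ?ltW // mulrC; congr (_ ^+ 2 / _).
  by rewrite innerC -/(form A x (e i)) sym.
pose A' : 'M[R]_n := A - u *m u^T.
have A'form x : inner x (A' *m x) = form A x x - inner u x ^+ 2.
  rewrite /A' mulmxBl innerDr -/(form A x x); congr (_ + _).
  rewrite -mulmxA.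
  have -> : u^T *m x = (inner u x)%:M.
    apply/matrixP => a b; rewrite !ord1 !mxE eqxx mulr1n.
    by apply: eq_bigr => j _; rewrite mxE.
  by rewrite mul_mx_scalar -scaleN1r (innerZr (-1)) (innerZr (inner u x)) (innerC x u); ring.
have A'_sym a b : A' a b = A' b a.
  rewrite !mxE A_sym; congr (_ - _); rewrite !big_ord1 !mxE; exact: mulrC.
have A'_psd x : 0 <= inner x (A' *m x).
  rewrite A'form ux.
  pose t := form A (e i) x / A i i.
  have := A_psd (x + - t *: e i); rewrite -/(form A _ _) addl !addr !scl !scr ee (sym x).
  rewrite (_ : _ + _ = form A x x - form A (e i) x ^+ 2 / A i i) //.
  by rewrite /t; field; exact: lt0r_neq0.
have A'diag j : A' j j = A j j - u j 0 ^+ 2.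
  by rewrite [LHS]mxE [X in _ + X]mxE [X in _ - X]mxE big_ord1 [X in _ - _ * X]mxE expr2.
have A'diag_ge0 j : 0 <= A' j j.
  have := A'_psd (e j); rewrite A'form ee A'diag.
  rewrite (_ : inner u (e j) = u j 0) //.
  rewrite /inner (bigD1 j) //= big1 => [|k kj]; last by rewrite [e j k 0]mxE (negbTE kj) mulr0.
  by rewrite [e j j 0]mxE !eqxx mulr1 addr0.
have uii : u i 0 ^+ 2 = A i i.
  have := ux (e i); rewrite ee (_ : inner u (e i) = u i 0) => [->|].
    by rewrite expr2 mulfK.
  rewrite /inner (bigD1 i) //= big1 => [|k ki]; last by rewrite [e i k 0]mxE (negbTE ki) mulr0.
  by rewrite [e i i 0]mxE !eqxx mulr1 addr0.
have A'm : (#|[set j | (A' j j != 0)%R]%SET| < m)%N.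
  rewrite -ltnS; apply: leq_trans Am; rewrite ltnS; apply: proper_card.
  apply/properP; split; last by exists i; rewrite inE // A'diag uii subrr eqxx.
  apply/fintype.subsetP => j; rewrite !inE; apply: contra_neq => Aj.
  have := A'diag_ge0 j; rewrite A'diag Aj sub0r oppr_ge0 => h.
  by apply/eqP; rewrite oppr_eq0 eq_le h sqr_ge0.
have [us usE] := IH A' A'm A'_sym A'_psd.
exists (u :: us) => x; rewrite big_cons -usE A'form; rewrite /form; ring.
Qed.

End RankOne.

(** * One step of the stochastic localization *)

Section Exponential.
Context {R : realType}.
Implicit Types (y t : R).

Definition cosh y : R := (expR y + expR (- y)) / 2.

Lemma is_derive_cosh (s : R) : is_derive s 1 cosh ((expR s - expR (- s)) / 2) /\
  is_derive s 1 (fun t => (expR t - expR (- t)) / 2) (cosh s).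
Proof.
have d1 := is_derive_expR s.
have dN : is_derive s 1 (- (@id R)) (- 1) by apply: is_deriveN.
have d2 := @is_derive1_comp R expR (- (@id R)) s _ _ (is_derive_expR _) dN.
have dp := is_deriveZ 2^-1 (is_deriveD d1 d2).
have dm := is_deriveZ 2^-1 (is_deriveB d1 d2).
split.
  have -> : cosh = 2^-1 \*: (expR + (expR \o (- (@id R)))).
    by apply/funext => t; rewrite /cosh /= mulrC.
  by apply: is_derive_eq; rewrite /= /GRing.scale /=; field.
have -> : (fun t => (expR t - expR (- t)) / 2) = 2^-1 \*: (expR - (expR \o (- (@id R)))).
  by apply/funext => t; rewrite /= mulrC.
by apply: is_derive_eq; rewrite /cosh /= /GRing.scale /=; field.
Qed.

Lemma coshN y : cosh (- y) = cosh y.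
Proof. by rewrite /cosh opprK addrC. Qed.

Lemma cosh_abs y : cosh `|y| = cosh y.
Proof. by case: (ger0P y) => // _; rewrite coshN. Qed.

Lemma cosh_ge1 y : 1 <= cosh y.
Proof.
have e0 : 0 < expR y := expR_gt0 y.
have e1 : expR y * expR (- y) = 1 by rewrite -expRD subrr expR0.
rewrite /cosh ler_pdivlMr // -(ler_pM2l e0) [leRHS]mulrDr e1.
by have := sqr_ge0 (expR y - 1); lra.
Qed.

Lemma cosh_ge y : 1 + y ^+ 2 / 2 <= cosh y.
Proof.
rewrite -cosh_abs -real_normK ?num_real //; set t := `|y|.
have := @quadratic_upper R (fun s => - cosh s) (fun s => - ((expR s - expR (- s)) / 2))
  (fun s => - cosh s) (-1) t (normr_ge0 y).
have d1 (s : R) := (is_derive_cosh s).1; have d2 (s : R) := (is_derive_cosh s).2.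
move=> h; have {h} : - cosh t <= - cosh 0 + - ((expR 0 - expR (- 0)) / 2) * t + -1 * t ^+ 2 / 2.
  by apply: (h (fun s _ => is_deriveN (d1 s)) (fun s _ => is_deriveN (d2 s))) => s _;
    rewrite lerN2 cosh_ge1.
by rewrite /cosh oppr0 expR0; lra.
Qed.

Lemma cosh_le y : `|y| <= 1 -> cosh y <= 1 + y ^+ 2 / 2 + y ^+ 4.
Proof.
rewrite -cosh_abs -[y ^+ 2]real_normK ?num_real //.
rewrite (_ : y ^+ 4 = `|y| ^+ 4); last first.
  by rewrite (exprM `|y| 2 2) real_normK ?num_real // -exprM.
have t0 := normr_ge0 y; move: t0; set t := `|y| => t0 t1; clearbody t.
have mono s : 0 <= s <= t -> cosh s <= cosh t.
  move=> /andP[s0 st].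
  have dsinh (u : R) : 0 <= u -> 0 <= (expR u - expR (- u)) / 2.
    by move=> u0; rewrite divr_ge0 // subr_ge0 ler_expR; lra.
  have := @MVT_segment R cosh (fun u => (expR u - expR (- u)) / 2) s t st.
  case.
  - by move=> u _; exact: (is_derive_cosh u).1.
  - apply: derivable_within_continuous => u _; exact: (@ex_derive _ _ _ _ _ _ _ (is_derive_cosh u).1).
  - move=> c; rewrite in_itv /= => /andP[sc ct] e.
    by rewrite -subr_ge0 e mulr_ge0 ?subr_ge0 // dsinh // (le_trans s0).
have up : cosh t <= 1 + cosh t * t ^+ 2 / 2.
  have := @quadratic_upper R cosh (fun s => (expR s - expR (- s)) / 2) cosh (cosh t) t t0.
  move=> h; have {h} := h (fun s _ => (is_derive_cosh s).1) (fun s _ => (is_derive_cosh s).2) mono.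
  by rewrite {2}/cosh oppr0 expR0; lra.
have t2 : t ^+ 2 <= 1 by rewrite expr_le1.
have ct : cosh t <= 1 + t ^+ 2.
  have h : 0 < 1 - t ^+ 2 / 2 by lra.
  rewrite -(ler_pM2r h); have : 0 <= t ^+ 2 * (1 - t ^+ 2) by rewrite mulr_ge0 ?sqr_ge0 // subr_ge0.
  by lra.
have := ler_wpM2r (sqr_ge0 t) ct; have := sqr_ge0 (t ^+ 2).
rewrite -exprM; lra.
Qed.

Lemma expR_second_order y : `|y| <= 1 / 2 -> `|expR y - 1 - y| <= 2 * y ^+ 2.
Proof.
rewrite ler_norml => /andP[y1 y2].
have l1 := expR_ge1Dx y; have l2 := expR_ge1Dx (- y).
rewrite ger0_norm; last by lra.
have e0 := expR_gt0 y.
have : expR y * (1 - y) <= 1.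
  by rewrite -[leRHS](mulfV (lt0r_neq0 e0)) -expRN ler_pM2l.
have p : 0 < 1 - y by lra.
move=> h; rewrite -(ler_pM2r p); have := mulr_ge0 (sqr_ge0 y) (_ : 0 <= 1 - 2 * y).
by move=> h2; have := h2 ltac:(lra); lra.
Qed.

End Exponential.

Section MeanShift.
Context {R : realType} {n : nat}.
Implicit Types (A : 'M[R]_n) (v t d : 'cV[R]_n) (x : cube n) (f : cube n -> R).

Lemma ising_weight_gt0 A v x : 0 < ising_weight A v x.
Proof. exact: expR_gt0. Qed.

Lemma ising_weight_sum_gt0 A v : 0 < \sum_x ising_weight A v x.
Proof. exact: (weight_sum_gt0 _ [ffun=> false] (ising_weight_gt0 A v)). Qed.

Lemma ising_weight_tilt A v t x :
  ising_weight A v x * expR (inner t (spin x)) = ising_weight A (v + t) x.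
Proof. by rewrite /ising_weight -expRD innerDr (innerC t) addrA. Qed.

Lemma expect_ising_weight A v f : expect (ising A v) f =
  (\sum_x ising_weight A v x * f x) / \sum_x ising_weight A v x.
Proof. by rewrite /expect mulr_suml; apply: eq_bigr => x _; rewrite mulrAC. Qed.

Lemma inner_cov (nu : cube n -> R) d : inner d (cov nu *m d) =
  expect nu (fun x => inner d (spin x) ^+ 2) - expect nu (fun x => inner d (spin x)) ^+ 2.
Proof.
have e1 : expect nu (fun x => inner d (spin x)) =
    \sum_i d i 0 * expect nu (fun x => spin x i 0).
  rewrite /expect; under eq_bigr do rewrite mulr_sumr.
  rewrite exchange_big; apply: eq_bigr => i _ /=; rewrite mulr_sumr.
  by apply: eq_bigr => x _; rewrite mulrCA.
have e2 : expect nu (fun x => inner d (spin x) ^+ 2) =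
    \sum_i \sum_j d i 0 * (d j 0 * expect nu (fun x => spin x i 0 * spin x j 0)).
  rewrite /expect.
  under eq_bigr do rewrite expr2 /inner mulr_suml mulr_sumr.
  rewrite exchange_big; apply: eq_bigr => i _ /=.
  under eq_bigr do rewrite mulr_sumr mulr_sumr.
  rewrite exchange_big; apply: eq_bigr => j _ /=.
  by rewrite !mulr_sumr; apply: eq_bigr => x _; ring.
rewrite e1 e2 expr2 mulr_suml -sumrB; apply: eq_bigr => i _.
rewrite mxE [LHS]mulr_sumr [X in _ - X]mulr_sumr -sumrB; apply: eq_bigr => j _.
by rewrite mxE; ring.
Qed.

Lemma inner_sum_spin (w : cube n -> R) d :
  \sum_x w x * inner d (spin x) = inner d (\col_i \sum_x w x * spin x i 0).
Proof.
rewrite /inner; under eq_bigr do rewrite mulr_sumr.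
rewrite exchange_big; apply: eq_bigr => i _ /=.
by rewrite mxE mulr_sumr; apply: eq_bigr => x _; rewrite mulrCA.
Qed.

Variable J : 'M[R]_n.
Hypothesis J_sym : forall i j, J i j = J j i.
Hypothesis J_ge0 : forall i j, 0 <= J i j.

(** The displacement of the mean magnetization when the measure is reweighted by f. *)
Definition mean_shift (w f : cube n -> R) : 'cV[R]_n :=
  (\sum_x w x * f x)^-1 *: (\col_i \sum_x w x * f x * spin x i 0)
  - (\sum_x w x)^-1 *: (\col_i \sum_x w x * spin x i 0).

Lemma inner_mean_shift (w f : cube n -> R) d : inner d (mean_shift w f) =
  (\sum_x w x * f x * inner d (spin x)) / (\sum_x w x * f x)
  - (\sum_x w x * inner d (spin x)) / \sum_x w x.
Proof.
rewrite /mean_shift -scaleN1r !(innerDr, innerZr) -!inner_sum_spin; ring.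
Qed.

(** Exponential tilts of an Ising measure only change its field, so the transport
    inequality applies with a constant that does not depend on the field. *)
Lemma mean_shift_le l v f : 0 <= l -> (forall x, 0 <= f x) ->
  0 < \sum_x ising_weight (l *: J) v x * f x ->
  (\sum_x ising_weight (l *: J) v x * f x) *
    inner (mean_shift (ising_weight (l *: J) v) f) (mean_shift (ising_weight (l *: J) v) f)
  <= 2 * chi J l * went (ising_weight (l *: J) v) f.
Proof.
move=> l0 f0 F0; set w := ising_weight (l *: J) v in F0 *.
have w0 x : 0 < w x by exact: ising_weight_gt0.
set d := mean_shift w f; have dge := inner_ge0 d.
have [d0|dn] := eqVneq (inner d d) 0.
  rewrite d0 mulr0 mulr_ge0 ?went_ge0 // mulr_ge0 //; exact: chi_ge0.
have dp : 0 < inner d d by rewrite lt_def dn.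
have n0 : (0 < n)%N.
  rewrite lt0n; apply/eqP => n0; move/eqP: dn; apply; apply: big1 => i.
  by have := ltn_ord i; rewrite {2}n0.
have X0 : 0 < chi J l by exact: lt_le_trans ltr01 (chi_ge1 J J_sym l n0 l0).
have := transport w f (fun x => inner d (spin x)) (chi J l * inner d d) w0 f0.
rewrite -inner_mean_shift -/d => h.
have {h} : (\sum_x w x * f x) * inner d d ^+ 2 <= 2 * (chi J l * inner d d) * went w f.
  apply: h => // [|s]; first exact: mulr_gt0.
  have := variance_le_chi J J_sym J_ge0 l (v + s *: d) d l0.
  rewrite inner_cov !expect_ising_weight.
  have e (G : cube n -> R) : \sum_x w x * expR (s * inner d (spin x)) * G x =
      \sum_x ising_weight (l *: J) (v + s *: d) x * G x.
    by apply: eq_bigr => x _; rewrite -innerZl ising_weight_tilt.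
  have e1 : \sum_x w x * expR (s * inner d (spin x)) =
      \sum_x ising_weight (l *: J) (v + s *: d) x.
    by apply: eq_bigr => x _; rewrite -innerZl ising_weight_tilt.
  by rewrite !e e1.
by move=> k; rewrite -(ler_pM2r dp); lra.
Qed.

End MeanShift.

Section SecondOrder.
Context {R : realType} {T : finType}.
Implicit Types (w f q : T -> R).

Lemma variance_le_sup w q (C : R) : (forall x, 0 < w x) -> (forall x, q x ^+ 2 <= C) ->
  0 < \sum_x w x ->
  (\sum_x w x * q x ^+ 2) / (\sum_x w x) - ((\sum_x w x * q x) / (\sum_x w x)) ^+ 2 <= C.
Proof.
move=> w0 qC Z0; rewrite lerBlDr; apply: (@le_trans _ _ C); last by rewrite lerDl sqr_ge0.
rewrite ler_pdivrMr // mulr_sumr; apply: ler_sum => x _.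
by rewrite mulrC ler_pM2r.
Qed.

(** The variance is at most b ^ 2 under every tilt. *)
Lemma transport_bounded w f q (b : R) : (forall x, 0 < w x) -> (forall x, 0 <= f x) ->
  0 < b -> (forall x, `|q x| <= b) -> 0 < \sum_x w x * f x ->
  (\sum_x w x * f x) * ((\sum_x w x * f x * q x) / (\sum_x w x * f x)
      - (\sum_x w x * q x) / (\sum_x w x)) ^+ 2 <= 2 * b ^+ 2 * went w f.
Proof.
move=> w0 f0 b0 qb F0; apply: transport => // [|t]; first by rewrite exprn_gt0.
have [x0 _] := sum_gt0_inhabited _ F0.
have w'0 x : 0 < w x * expR (t * q x) by rewrite mulr_gt0 ?expR_gt0.
apply: variance_le_sup => //; last exact: (weight_sum_gt0 _ x0 w'0).
by move=> x; rewrite -real_normK ?num_real // lerXn2r ?nnegrE // ltW.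
Qed.

Lemma sqrrD_le (a b r : R) : 0 < r ->
  (a + b) ^+ 2 <= (1 + r) * a ^+ 2 + (1 + r^-1) * b ^+ 2.
Proof.
move=> r0; rewrite -subr_ge0.
rewrite (_ : _ - _ = (r * a - b) ^+ 2 / r); last by field; rewrite gt_eqF.
by rewrite divr_ge0 ?sqr_ge0 // ltW.
Qed.

(** The second-order remainder of the exponential is bounded by 2 rho ^ 2, so that
    transport_bounded makes its contribution of order rho ^ 4; the weight 1 + rho in
    sqrrD_le balances it against the linear part at the price of one order. *)
Lemma expR_shift w f (y : T -> R) (rho : R) : (forall x, 0 < w x) -> (forall x, 0 <= f x) ->
  0 < rho -> rho <= 1 / 2 -> (forall x, `|y x| <= rho) -> 0 < \sum_x w x * f x ->
  (\sum_x w x * f x) * ((\sum_x w x * f x * expR (y x)) / (\sum_x w x * f x)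
      - (\sum_x w x * expR (y x)) / (\sum_x w x)) ^+ 2 <=
  (1 + rho) * ((\sum_x w x * f x) * ((\sum_x w x * f x * y x) / (\sum_x w x * f x)
      - (\sum_x w x * y x) / (\sum_x w x)) ^+ 2) + (1 + rho) * (8 * rho ^+ 3) * went w f.
Proof.
move=> w0 f0 rho0 rho1 yrho F0.
have [x0 _] := sum_gt0_inhabited _ F0.
have Z0 := weight_sum_gt0 w x0 w0.
pose q x := expR (y x) - 1 - y x.
have qb x : `|q x| <= 2 * rho ^+ 2.
  have yx := yrho x; apply: le_trans (expR_second_order (y x) (le_trans yx rho1)) _.
  by rewrite ler_pM2l // -[y x ^+ 2]real_normK ?num_real // lerXn2r ?nnegrE // ltW.
have b0 : 0 < 2 * rho ^+ 2 by rewrite mulr_gt0 // exprn_gt0.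
have tq := transport_bounded w f q _ w0 f0 b0 qb F0.
have split (v : T -> R) : \sum_x v x * expR (y x) =
    \sum_x v x + \sum_x v x * y x + \sum_x v x * q x.
  by rewrite -!big_split /=; apply: eq_bigr => x _; rewrite /q; ring.
rewrite (split (fun x => w x * f x)) (split w).
set F := \sum_x w x * f x in F0 tq *; set Z := \sum_x w x in Z0 tq *.
set a := _ - _ in tq; set b := (X in _ <= _ * (_ * X ^+ 2) + _).
rewrite (_ : _ / F - _ = b + a); last first.
  by rewrite /a /b; field; rewrite !gt_eqF.
clearbody a b.
apply: (@le_trans _ _ (F * ((1 + rho) * b ^+ 2 + (1 + rho^-1) * a ^+ 2))).
  by rewrite ler_pM2l // sqrrD_le.
rewrite mulrDr (mulrCA F) lerD2l.
have r1 : 0 < 1 + rho^-1 by rewrite addr_gt0 ?invr_gt0.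
rewrite mulrCA; apply: le_trans (ler_wpM2l (ltW r1) tq) _.
rewrite le_eqVlt; apply/orP; left; apply/eqP; field; exact: lt0r_neq0.
Qed.

End SecondOrder.

Section Step.
Context {R : realType} {n : nat}.
Variable J : 'M[R]_n.
Hypothesis J_sym : forall i j, J i j = J j i.
Hypothesis J_ge0 : forall i j, 0 <= J i j.
Implicit Types (l h c : R) (v : 'cV[R]_n) (f : cube n -> R).

(** Approximate tensorization of entropy.  Uniformity over the field is essential for
    the iteration, since the tilts of a mixture change the field. *)
Definition tensorizes l c : Prop := forall v f, (forall x, 0 <= f x) ->
  c * went (ising_weight (l *: J) v) f <= local_ent (ising_weight (l *: J) v) f.

Section Mixture.
Variables (m : nat) (u : 'I_m.+1 -> 'cV[R]_n) (B : R).
Hypothesis uE : forall x, inner x (J *m x) = \sum_i inner (u i) x ^+ 2.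
Hypothesis uB : forall i (x : cube n), `|inner (u i) (spin x)| <= B.

Let M : R := m.+1%:R.
Let M0 : 0 < M. Proof. by rewrite ltr0n. Qed.
Let r h := h * Num.sqrt (2 * M).
Let r_sqr h : r h ^+ 2 = h ^+ 2 * (2 * M).
Proof. by rewrite exprMn sqr_sqrtr // mulr_ge0 // ltW. Qed.
Let tilt h (k : 'I_m.+1 * bool) := ((-1) ^+ k.2 * r h) *: u k.1.
Let p : R := (2 * M)^-1.
Let p0 : 0 <= p. Proof. by rewrite invr_ge0 mulr_ge0 // ltW. Qed.
Let rho h := Num.sqrt (2 * M) * B * h.

(** The average of the Ising weights over 2 (m + 1) fields, namely v shifted by plus or
    minus a multiple of one of the vectors of a decomposition of J into squares; the
    multiple is such that the random shift has covariance 2 h ^ 2 J. *)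
Definition field_mixture l v h (x : cube n) : R :=
  \sum_(k : 'I_m.+1 * bool) (2 * m.+1%:R)^-1 * ising_weight (l *: J)
    (v + ((-1) ^+ k.2 * (h * Num.sqrt (2 * m.+1%:R))) *: u k.1) x.

Let sum_signs (F : 'I_m.+1 * bool -> R) :
  \sum_k F k = \sum_i (F (i, true) + F (i, false)).
Proof.
transitivity (\sum_i \sum_b F (i, b)); last by apply: eq_bigr => i _; rewrite big_bool.
rewrite (pair_big xpredT xpredT (fun i b => F (i, b))) /=.
by apply: eq_bigr => -[].
Qed.

Let y h k (x : cube n) := inner (tilt h k) (spin x).

Let mixE l v h x : field_mixture l v h x =
  \sum_k p * (ising_weight (l *: J) v x * expR (y h k x)).
Proof. by apply: eq_bigr => k _; rewrite ising_weight_tilt. Qed.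

Let y_le h k x : 0 <= h -> `|y h k x| <= rho h.
Proof.
move=> h0; rewrite /y /tilt innerZl !normrM normrX normrN1 expr1n mul1r.
rewrite (ger0_norm h0) (ger0_norm (sqrtr_ge0 _)) /rho.
by rewrite [leRHS]mulrC [leRHS]mulrA ler_wpM2l // mulr_ge0.
Qed.

Let mix_cosh l v h x : field_mixture l v h x =
  ising_weight (l *: J) v x * (M^-1 * \sum_i cosh (r h * inner (u i) (spin x))).
Proof.
rewrite mixE sum_signs !mulr_sumr; apply: eq_bigr => i _.
rewrite /y /tilt /= !innerZl expr1 expr0 mul1r mulN1r mulNr /cosh /p.
by field; exact: lt0r_neq0.
Qed.

Let quadE h x : M^-1 * \sum_i (r h * inner (u i) (spin x)) ^+ 2 / 2 =
  h ^+ 2 * inner (spin x) (J *m spin x).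
Proof.
rewrite uE !mulr_sumr; apply: eq_bigr => i _; rewrite exprMn r_sqr.
by field; exact: lt0r_neq0.
Qed.

Let tilt_le h i x : 0 <= h -> `|r h * inner (u i) (spin x)| <= rho h.
Proof.
by move=> h0; have := y_le h (i, false) x h0; rewrite /y /tilt innerZl expr0 mul1r.
Qed.

Lemma field_mixture_gt0 l v h x : 0 < field_mixture l v h x.
Proof.
rewrite mix_cosh mulr_gt0 ?ising_weight_gt0 // mulr_gt0 ?invr_gt0 //.
rewrite (bigD1 ord0) //= ltr_pwDl //; first exact: lt_le_trans (cosh_ge1 _).
by apply: sumr_ge0 => i _; exact: le_trans (cosh_ge1 _).
Qed.

(** The average over the two signs is a hyperbolic cosine, hence 1 plus half a square
    up to fourth order, and the squares add up to the quadratic form of J: the mixture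
    has interaction (l + h ^ 2) J up to a fourth-order relative error. *)
Lemma field_mixture_bounds l v h x : 0 <= h -> rho h <= 1 / 2 ->
  [/\ ising_weight (l *: J) v x <= field_mixture l v h x,
      field_mixture l v h x <= (1 + rho h ^+ 4) * ising_weight ((l + h ^+ 2) *: J) v x &
      (1 - rho h ^+ 4) * ising_weight ((l + h ^+ 2) *: J) v x <= field_mixture l v h x].
Proof.
move=> h0 rho1; have rho0 : 0 <= rho h by exact: le_trans (tilt_le h ord0 x h0).
set w := ising_weight (l *: J) v x; set A := h ^+ 2 * inner (spin x) (J *m spin x).
have w0 : 0 < w by exact: ising_weight_gt0.
have -> : ising_weight ((l + h ^+ 2) *: J) v x = w * expR A.
  rewrite /w /ising_weight -expRD; congr expR.
  by rewrite scalerDl mulmxDl innerDr -!scalemxAl !innerZr /A; ring.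
have A0 : 0 <= A.
  by rewrite mulr_ge0 ?sqr_ge0 // uE sumr_ge0 // => i _; exact: sqr_ge0.
have avg a : M^-1 * \sum_(i < m.+1) a = a.
  by rewrite sumr_const card_ord -[a *+ _]mulr_natl mulKf // gt_eqF.
have Ale : A <= rho h ^+ 2 / 2.
  rewrite /A -quadE -[leRHS]avg ler_pM2l ?invr_gt0 //; apply: ler_sum => i _.
  rewrite ler_pM2r ?invr_gt0 // -real_normK ?num_real //.
  by rewrite lerXn2r ?nnegrE // tilt_le.
have lo : 1 + A <= M^-1 * \sum_i cosh (r h * inner (u i) (spin x)).
  rewrite /A -quadE -[X in X + _]avg -mulrDr ler_pM2l ?invr_gt0 // -big_split /=.
  by apply: ler_sum => i _; exact: cosh_ge.
have hi : M^-1 * \sum_i cosh (r h * inner (u i) (spin x)) <= 1 + A + rho h ^+ 4.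
  rewrite /A -quadE -[X in X + _ + _]avg -[X in _ + X]avg -!mulrDr ler_pM2l ?invr_gt0 //.
  rewrite -!big_split /=; apply: ler_sum => i _.
  have t1 := tilt_le h i x h0.
  apply: le_trans (cosh_le _ _) _; first by apply: (le_trans t1); lra.
  rewrite lerD2l (_ : _ ^+ 4 = `|r h * inner (u i) (spin x)| ^+ 4).
    by rewrite lerXn2r ?nnegrE.
  by rewrite (exprM `|_| 2 2) real_normK ?num_real // -exprM.
have eA := expR_ge1Dx A.
have e1 : expR A * (1 - A ^+ 2) <= 1 + A.
  have : expR A * (1 - A) <= 1.
    by rewrite -[leRHS]expR0 -(subrr A) expRD ler_pM2l ?expR_gt0 // expR_ge1Dx.
  have A1 : 0 <= 1 + A by lra.
  by move/(ler_wpM2r A1); lra.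
have A4 : A ^+ 2 <= rho h ^+ 4.
  apply: (@le_trans _ _ ((rho h ^+ 2 / 2) ^+ 2)).
    by rewrite lerXn2r ?nnegrE // divr_ge0 ?sqr_ge0.
  rewrite (_ : (_ / 2) ^+ 2 = rho h ^+ 4 / 4); last by field.
  by have := exprn_ge0 4 rho0; lra.
rewrite mix_cosh -/w; set S := M^-1 * _ in lo hi *; clearbody S A; split.
- by rewrite -[leLHS]mulr1 ler_pM2l //; lra.
- rewrite mulrCA ler_pM2l //.
  have : rho h ^+ 4 * 1 <= rho h ^+ 4 * expR A.
    by apply: ler_wpM2l; [exact: exprn_ge0|lra].
  by lra.
- rewrite mulrCA ler_pM2l //.
  have := ler_wpM2r (expR_ge0 A) A4; lra.
Qed.

(** The entropy gained by the mixture is governed by the susceptibility: the linear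
    part of the tilts contributes the quadratic form of J at the displacement of the
    magnetization, everything else is of third order. *)
Lemma field_mixture_gap l v h f : 0 <= l -> 0 < h -> 0 < B -> rho h <= 1 / 2 ->
  (forall x, 0 <= f x) ->
  went (field_mixture l v h) f
   - \sum_k p * went (ising_weight (l *: J) (v + tilt h k)) f <=
  expR (3 * rho h) * (1 + rho h) * (2 * h ^+ 2 * opnorm J * chi J l + 4 * rho h ^+ 3) *
    went (ising_weight (l *: J) v) f.
Proof.
move=> l0 h0 B0 rho1 f0; set w := ising_weight (l *: J) v.
have w0 x : 0 < w x by exact: ising_weight_gt0.
have rho0 : 0 < rho h by rewrite !mulr_gt0 // sqrtr_gt0 mulr_gt0.
have [fz|F0] := went_cases w f w0 f0.
  rewrite !went_zero // mulr0 subr_le0 sumr_ge0 // => k _.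
  by rewrite went_zero // mulr0.
have -> : \sum_k p * went (ising_weight (l *: J) (v + tilt h k)) f =
    \sum_k p * went (fun x => w x * expR (y h k x)) f.
  apply: eq_bigr => k _; congr (_ * _).
  suff -> : ising_weight (l *: J) (v + tilt h k) = fun x => w x * expR (y h k x) by [].
  by apply/funext => x; rewrite ising_weight_tilt.
apply: le_trans (mixture_gap w f (field_mixture l v h) (fun=> p) (y h) (rho h)
  w0 f0 (fun=> p0) (ltW rho0) (fun k x => y_le h k x (ltW h0))
  (field_mixture_gt0 l v h) (mixE l v h) F0) _.
set F := \sum_x w x * f x in F0 *; set Z := \sum_x w x.
rewrite -[leLHS]mulrA [leLHS]mulrCA -!(mulrA (expR _)) ler_pM2l ?expR_gt0 //.
rewrite ler_pdivrMl //.
pose d := mean_shift w f.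
have shift := mean_shift_le J J_sym J_ge0 l v f l0 f0 F0.
rewrite -/w -/d -/F in shift.
pose b k := (\sum_x w x * f x * y h k x) / F - (\sum_x w x * y h k x) / Z.
have bE k : b k = (-1) ^+ k.2 * r h * inner (u k.1) d.
  by rewrite -innerZl inner_mean_shift.
have bsum : \sum_k p * b k ^+ 2 = 2 * h ^+ 2 * inner d (J *m d).
  rewrite sum_signs uE mulr_sumr; apply: eq_bigr => i _.
  rewrite !bE /= !expr1 expr0 mul1r mulN1r mulNr sqrrN exprMn r_sqr /p.
  by field; exact: lt0r_neq0.
have psum : \sum_(k : 'I_m.+1 * bool) p = 1.
  rewrite sumr_const card_prod card_ord card_bool -[p *+ _]mulr_natl natrM /p.
  by rewrite [m.+1%:R * _]mulrC mulfV // gt_eqF // mulr_gt0.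
apply: (@le_trans _ _ (\sum_k p * ((1 + rho h) * (F * b k ^+ 2) +
    (1 + rho h) * (8 * rho h ^+ 3) * went w f))).
  apply: ler_sum => k _; rewrite ler_wpM2l //.
  by apply: expR_shift => // x; apply: y_le; exact: ltW.
under eq_bigr do rewrite mulrDr.
rewrite big_split /= -mulr_suml psum mul1r.
rewrite (_ : \sum_k _ = (1 + rho h) * F * \sum_k p * b k ^+ 2); last first.
  by rewrite mulr_sumr; apply: eq_bigr => k _; ring.
rewrite bsum.
have dJ := inner_mulmx_le J d.
have E0 : 0 <= 2 * h ^+ 2 by rewrite mulr_ge0 ?sqr_ge0.
have s1 : F * (2 * h ^+ 2 * inner d (J *m d)) <=
    2 * h ^+ 2 * (opnorm J * (2 * chi J l * went w f)).
  rewrite mulrCA ler_wpM2l //.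
  apply: (@le_trans _ _ (opnorm J * (F * inner d d))).
    by rewrite mulrCA ler_pM2l.
  by rewrite ler_wpM2l // opnorm_ge0.
have r1 : 0 <= 1 + rho h by lra.
have := ler_wpM2l r1 s1; lra.
Qed.

(** The local entropies are concave in the measure, so tensorization of the components
    bounds the local entropy of the mixture by their average entropy, which falls
    short of the entropy of the mixture by at most the gap above. *)
Lemma tensorizes_mixture l h c : 0 <= l -> 0 < h -> 0 < B -> rho h <= 1 / 2 ->
  0 <= c -> tensorizes l c ->
  let eps := expR (3 * rho h) * (1 + rho h) *
      (2 * h ^+ 2 * opnorm J * chi J l + 4 * rho h ^+ 3) in
  eps + 2 * rho h ^+ 4 <= 1 ->
  tensorizes (l + h ^+ 2) (c * (1 - (eps + 2 * rho h ^+ 4))).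
Proof.
move=> l0 h0 B0 rho1 c0 Cl eps heps v f f0.
have rho0 : 0 < rho h by rewrite !mulr_gt0 // sqrtr_gt0 mulr_gt0.
have q0 : 0 < rho h ^+ 4 by exact: exprn_gt0.
have eps0 : 0 <= eps.
  have rho3 : 0 <= rho h ^+ 3 by rewrite ltW // exprn_gt0.
  apply: mulr_ge0; first by apply: mulr_ge0; [exact: expR_ge0|rewrite addr_ge0 // ltW].
  apply: addr_ge0; last exact: mulr_ge0.
  apply: mulr_ge0; last exact: chi_ge0.
  by rewrite !mulr_ge0 ?opnorm_ge0 // ltW.
set w := ising_weight (l *: J) v; set w' := ising_weight ((l + h ^+ 2) *: J) v.
pose wm := field_mixture l v h.
have w0 x : 0 < w x by exact: ising_weight_gt0.
have w'0 x : 0 < w' x by exact: ising_weight_gt0.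
have wm0 x : 0 < wm x by exact: field_mixture_gt0.
have bounds x := field_mixture_bounds l v h x (ltW h0) rho1.
have q1 : 0 < 1 - rho h ^+ 4.
  by move: q0 eps0 heps; clearbody eps; move: (rho h ^+ 4) => q; lra.
have q2 : 0 < 1 + rho h ^+ 4 by rewrite addr_gt0.
have V1 : local_ent wm f <= (1 + rho h ^+ 4) * local_ent w' f.
  rewrite -local_ent_scale ?gt_eqF //; apply: local_ent_le_weight => // x.
  by have [] := bounds x.
have U1 : (1 - rho h ^+ 4) * went w' f <= went wm f.
  rewrite -went_scale ?gt_eqF //; apply: went_le_weight => // [x|x].
    exact: mulr_gt0.
  by have [] := bounds x.
have U2 : went w f <= went wm f.
  by apply: went_le_weight => // x; have [] := bounds x.
have Um := went_ge0 w' f w'0 f0.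
have gap := field_mixture_gap l v h f l0 h0 B0 rho1 f0.
rewrite -/w -/wm -/eps in gap; clearbody eps.
have V2 : c * \sum_k p * went (ising_weight (l *: J) (v + tilt h k)) f <= local_ent wm f.
  apply: (@le_trans _ _ (\sum_k p * local_ent (ising_weight (l *: J) (v + tilt h k)) f)).
    rewrite mulr_sumr; apply: ler_sum => k _; rewrite mulrCA ler_wpM2l //.
    exact: Cl.
  by apply: local_ent_concave => // k x; exact: ising_weight_gt0.
set Uk := \sum_k p * went _ f in gap V2; set Uw := went w f in gap U2.
set Uwm := went wm f in gap U1 U2; clearbody Uk Uw Uwm.
have U3 : (1 - eps) * Uwm <= Uk.
  have := ler_wpM2l eps0 U2; lra.
have e1 : 0 <= 1 - eps by lra.
have V3 : c * ((1 - eps) * ((1 - rho h ^+ 4) * went w' f)) <=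
    (1 + rho h ^+ 4) * local_ent w' f.
  apply: le_trans V1; apply: le_trans V2; rewrite ler_wpM2l //.
  by apply: le_trans U3; rewrite ler_wpM2l.
rewrite -(ler_pM2l q2); apply: le_trans V3.
set q := rho h ^+ 4 in q0 q1 q2 heps *; clearbody q.
rewrite -(mulrA c) [leLHS]mulrCA ler_wpM2l //.
rewrite !mulrA ler_wpM2r //.
have : 0 <= eps * q by rewrite mulr_ge0 // ltW.
have : 0 <= q * q by rewrite mulr_ge0 // ltW.
lra.
Qed.

End Mixture.
End Step.

(** * From independent spins to the full interaction *)

Section StepLoss.
Context {R : realType}.

Lemma expRN_le (t : R) : 0 <= t <= 1 / 2 -> expR (- (t + 2 * t ^+ 2)) <= 1 - t.
Proof.
move=> /andP[t0 t1]; have p : 0 < 1 - t by lra.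
rewrite expRN -[leRHS]invrK lef_pV2 ?posrE ?expR_gt0 ?invr_gt0 //.
apply: (le_trans _ (expR_ge1Dx _)).
rewrite -[leLHS]mul1r ler_pdivrMr //.
have : 0 <= t ^+ 2 * (1 - 2 * t) by rewrite mulr_ge0 ?sqr_ge0 //; lra.
by lra.
Qed.

(** The loss factor of one step, with all error terms collected into K h ^ 3.  It is
    uniform in a, which stands for the norm of J times the susceptibility. *)
Lemma step_loss (k X : R) : 0 <= k -> 0 <= X -> exists K h0 : R, [/\ 0 <= K, 0 < h0 &
  forall a h, 0 <= a <= X -> 0 < h <= h0 -> k * h <= 1 / 2 /\
  let eps := expR (3 * (k * h)) * (1 + k * h) * (2 * h ^+ 2 * a + 4 * (k * h) ^+ 3) in
  expR (- (2 * a * h ^+ 2 + K * h ^+ 3)) <= 1 - (eps + 2 * (k * h) ^+ 4)].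
Proof.
move=> k0 X0; pose K1 := 16 * k * X + 13 * k ^+ 3; pose M := 2 * X + K1.
have K10 : 0 <= K1 by rewrite addr_ge0 // !mulr_ge0 // exprn_ge0.
have M0 : 0 <= M by rewrite addr_ge0 // mulr_ge0.
pose D := 1 + 6 * k + 2 * M.
have D0 : 0 < D by rewrite /D; lra.
exists (K1 + 2 * M ^+ 2), D^-1; split; first by rewrite addr_ge0 // mulr_ge0 ?sqr_ge0.
  by rewrite invr_gt0.
move=> a h /andP[a0 aX] /andP[h0 hD].
have hD1 : D * h <= 1 by rewrite -(mulfV (lt0r_neq0 D0)) ler_pM2l.
have kh0 : 0 <= k * h by rewrite mulr_ge0 // ltW.
have Mh0 : 0 <= M * h by rewrite mulr_ge0 // ltW.
have [h1 kh Mh] : [/\ h <= 1, k * h <= 1 / 6 & M * h <= 1 / 2].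
  by move: hD1; rewrite /D; split; lra.
split; first by lra.
move=> eps; set rho := k * h in kh0 kh eps *.
have h2 : 0 < h ^+ 2 by rewrite exprn_gt0.
have h3 : 0 < h ^+ 3 by rewrite exprn_gt0.
have r3 : 0 <= rho ^+ 3 by rewrite exprn_ge0.
have e3 : expR (3 * rho) <= 1 + 6 * rho.
  have : expR (3 * rho) * (1 - 3 * rho) <= 1.
    by rewrite -[leRHS]expR0 -(subrr (3 * rho)) expRD ler_pM2l ?expR_gt0 // expR_ge1Dx.
  have p : 0 < 1 - 3 * rho by lra.
  move=> q; rewrite -(ler_pM2r p); apply: (le_trans q).
  have : 0 <= rho * (1 - 6 * rho) by rewrite mulr_ge0 //; lra.
  by lra.
have e4 : expR (3 * rho) * (1 + rho) <= 1 + 8 * rho.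
  apply: (@le_trans _ _ ((1 + 6 * rho) * (1 + rho))).
    by rewrite ler_wpM2r //; lra.
  have : 0 <= rho * (1 - 6 * rho) by rewrite mulr_ge0 //; lra.
  by lra.
have main0 : 0 <= 2 * h ^+ 2 * a + 4 * rho ^+ 3.
  by rewrite addr_ge0 // !mulr_ge0 // ltW.
pose theta := 2 * a * h ^+ 2 + K1 * h ^+ 3.
have etheta : eps + 2 * rho ^+ 4 <= theta.
  have := ler_wpM2r main0 e4; rewrite -/eps => h4.
  have h5 : rho * (h ^+ 2 * a) <= k * X * h ^+ 3.
    rewrite (_ : k * X * _ = rho * (h ^+ 2 * X)); last by rewrite /rho; ring.
    by rewrite ler_wpM2l // ler_pM2l.
  have h6 : rho * rho ^+ 3 <= 1 / 6 * rho ^+ 3 by rewrite ler_wpM2r.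
  have h7 : rho ^+ 3 = k ^+ 3 * h ^+ 3 by rewrite /rho exprMn.
  have -> : theta = 2 * a * h ^+ 2 + 16 * (k * X * h ^+ 3) + 13 * rho ^+ 3.
    by rewrite /theta /K1 h7; ring.
  rewrite (_ : rho ^+ 4 = rho * rho ^+ 3); last by rewrite exprS.
  by clearbody eps; lra.
have theta0 : 0 <= theta by rewrite addr_ge0 // !mulr_ge0 // ltW.
have thetaM : theta <= M * h ^+ 2.
  have : a * h ^+ 2 <= X * h ^+ 2 by rewrite ler_pM2r.
  have : K1 * h ^+ 3 <= K1 * h ^+ 2.
    by rewrite ler_wpM2l // exprS ler_piMl // ltW.
  by rewrite /theta /M; lra.
have h21 : h ^+ 2 <= h by rewrite expr2 ler_piMl // ltW.
have theta1 : theta <= 1 / 2.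
  by apply: (le_trans thetaM); apply: le_trans Mh; rewrite ler_wpM2l.
apply: (@le_trans _ _ (1 - theta)); last by clearbody eps theta; lra.
apply: le_trans (expRN_le theta _); last by rewrite theta0.
rewrite ler_expR lerN2 (_ : _ + _ * h ^+ 3 = theta + 2 * (M ^+ 2 * h ^+ 3)); last first.
  by rewrite /theta; ring.
rewrite lerD2l ler_pM2l //.
apply: (@le_trans _ _ ((M * h ^+ 2) ^+ 2)).
  by rewrite lerXn2r ?nnegrE // mulr_ge0 // ltW.
rewrite exprMn ler_wpM2l ?sqr_ge0 // -exprM (exprS h 3) ler_piMl //; exact: ltW.
Qed.

End StepLoss.

Section Iteration.
Context {R : realType} {n : nat}.
Variable J : 'M[R]_n.
Hypothesis J_sym : forall i j, J i j = J j i.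
Hypothesis J_ge0 : forall i j, 0 <= J i j.
Hypothesis J_psd : forall x, 0 <= inner x (J *m x).
Implicit Types (l h c : R) (v : 'cV[R]_n) (f : cube n -> R).

Lemma tensorizes_le l c c' : c' <= c -> tensorizes J l c -> tensorizes J l c'.
Proof.
move=> cc Tc v f f0; apply: le_trans (Tc v f f0); apply: ler_wpM2r => //.
by apply: went_ge0 => // x; exact: ising_weight_gt0.
Qed.

(** Without interaction the spins are independent. *)
Lemma tensorizes0 : tensorizes J 0 1.
Proof.
move=> v f f0; rewrite mul1r; apply: went_le_local_ent => // [x|i j x ij].
  exact: ising_weight_gt0.
rewrite /ising_weight !scale0r !mul0mx -!expRD; congr expR.
have z t : inner t (0 : 'cV[R]_n) = 0 by rewrite -(scale0r (0 : 'cV[R]_n)) innerZr mul0r.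
rewrite !z !add0r /inner -!big_split /=; apply: eq_bigr => k _.
rewrite !mxE !ffunE -!mulrDl; congr (_ * _).
have [->|ki] := eqVneq k i; have [|kj] := eqVneq _ j => [e|].
- by move: ij; rewrite e eqxx.
- by [].
- by rewrite addrC.
- by [].
Qed.

Lemma tensorizes_step : exists K h0 : R, [/\ 0 <= K, 0 < h0 &
  forall l h c, 0 <= l <= 1 -> 0 < h <= h0 -> 0 <= c -> tensorizes J l c ->
  tensorizes J (l + h ^+ 2)
    (c * expR (- (2 * (opnorm J * chi J l) * h ^+ 2 + K * h ^+ 3)))].
Proof.
have [us usE] := psd_sum_squares J J_sym J_psd.
(* The default value 0 at index m adds a zero vector, so that there is at least one. *)
pose m := size us; pose u (i : 'I_m.+1) := nth 0 us i.
have uE x : inner x (J *m x) = \sum_i inner (u i) x ^+ 2.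
  rewrite usE (big_nth 0) big_mkord big_ord_recr /= {2}/u nth_default //.
  rewrite (_ : inner 0 x ^+ 2 = 0) ?addr0 // -(scale0r (0 : 'cV[R]_n)) innerZl mul0r expr0n //.
pose B : R := 1 + \sum_i \sum_j `|u i j 0|.
have B0 : 0 < B by rewrite ltr_pwDl // sumr_ge0 // => i _; exact: sumr_ge0.
have uB i (x : cube n) : `|inner (u i) (spin x)| <= B.
  apply: le_trans (ler_norm_sum _ _ _) _.
  apply: (@le_trans _ _ (\sum_j `|u i j 0|)).
    apply: ler_sum => j _; rewrite normrM mxE normrX normrN1 expr1n mulr1 //.
  rewrite /B [X in _ <= _ + X](bigD1 i) //= addrCA lerDl addr_ge0 // sumr_ge0 // => k _.
  exact: sumr_ge0.
pose k := Num.sqrt (2 * m.+1%:R) * B.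
have k0 : 0 <= k by rewrite mulr_ge0 ?sqrtr_ge0 // ltW.
have X0 : 0 <= opnorm J * chi J 1 by rewrite mulr_ge0 ?opnorm_ge0 // opnorm_ge0.
have [K [h0 [K0 h00 loss]]] := step_loss k (opnorm J * chi J 1) k0 X0.
exists K, h0; split; [exact: K0|exact: h00|move=> l h c /andP[l0 l1] hh c0 Tl].
have aX : 0 <= opnorm J * chi J l <= opnorm J * chi J 1.
  apply/andP; split; first by apply: mulr_ge0; [exact: opnorm_ge0|exact: chi_ge0].
  by apply: ler_wpM2l; [exact: opnorm_ge0|exact: chi_mono].
have [kh eps_le] := loss _ _ aX hh.
have /andP[hp _] := hh.
have eps1 := le_trans (expR_ge0 _) eps_le.
have := tensorizes_mixture J J_sym J_ge0 m u B uE uB l h c l0 hp B0 kh c0 Tl.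
rewrite -/k -!(mulrA _ (opnorm J)) => T.
apply: tensorizes_le (T _); first by rewrite ler_wpM2l.
by rewrite -subr_ge0.
Qed.

End Iteration.

Section RiemannSum.
Context {R : realType}.
Variable g : R -> R.
Hypothesis g_mono : forall x y : R, 0 <= x -> x <= y -> g x <= g y.

Local Notation mu := (@lebesgue_measure R).

Lemma monotone_integrable (b : R) : mu.-integrable `]0, b[ (EFin \o g).
Proof.
(* Only the values on the positive half-line are known to be monotone. *)
have e : {in `]0, b[%classic, (fun x => g (Num.max 0 x)) =1 g}.
  by move=> x; rewrite inE /= in_itv /= => /andP[x0 _]; rewrite max_r // ltW.
apply: measurable_bounded_integrable => //.
- by rewrite /= lebesgue_measure_itv /=; case: ifP => _; rewrite ?ltry // -EFinD ltry.
- apply: (eq_measurable_fun _ e).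
  apply: nondecreasing_measurable => // x y xy; apply: g_mono.
    by rewrite le_max lexx.
  by rewrite ge_max !le_max lexx xy orbT.
- exists (`|g 0| + `|g b|); split; first exact: num_real.
  move=> M hM x /=; rewrite in_itv /= => /andP[x0 xb].
  apply: le_trans (ltW hM).
  have := g_mono 0 x (lexx _) (ltW x0); have := g_mono x b (ltW x0) (ltW xb).
  rewrite ler_norml; move: (ler_norm (g b)) (ler_norm (- g 0)) (normr_ge0 (g b)) (normr_ge0 (g 0)).
  by rewrite normrN => *; apply/andP; split; lra.
Qed.

(** Left endpoints undershoot a nondecreasing function. *)
Lemma riemann_sum_le (N : nat) : (0 < N)%N ->
  \sum_(i < N) g (i%:R / N%:R) / N%:R <= \int[mu]_(x in `]0, 1[) g x.
Proof.
move=> N0; have NR : 0 < N%:R :> R by rewrite ltr0n.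
suff h k : (k <= N)%N ->
    \sum_(i < k) g (i%:R / N%:R) / N%:R <= \int[mu]_(x in `]0, (k%:R / N%:R)%R[) g x.
  by have := h N (leqnn N); rewrite divff // gt_eqF.
elim: k => [|k IH] kN.
  by rewrite big_ord0 mul0r set_itvoo0 Rintegral_set0.
set a : R := k%:R / N%:R; set b : R := k.+1%:R / N%:R.
have a0 : 0 <= a by rewrite divr_ge0.
have ab : a < b by rewrite ltr_pM2r ?invr_gt0 // ltr_nat.
have ba : b - a = N%:R^-1 by rewrite -mulrBl -natrB // subSnn mul1r.
rewrite big_ord_recr /= -/a.
have [a00|an0] := eqVneq a 0.
  have k0 : k = 0%N.
    by move/eqP: a00; rewrite mulf_eq0 invr_eq0 pnatr_eq0 (gt_eqF NR) orbF => /eqP.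
  rewrite k0 big_ord0 add0r a00.
  rewrite [leLHS](_ : _ = \int[mu]_(x in `]0, b[) g 0); last first.
    rewrite Rintegral_cst //= lebesgue_measure_itv /= lte_fin.
    by rewrite (le_lt_trans a0 ab) -EFinD /= -a00 ba.
  apply: le_Rintegral => //.
  - apply: measurable_bounded_integrable => //.
      by rewrite /= lebesgue_measure_itv /=; case: ifP => _; rewrite ?ltry // -EFinD ltry.
    by exists `|g 0|; split=> [|M hM x _]; [exact: num_real|exact: ltW].
  - exact: monotone_integrable.
  - by move=> x /=; rewrite in_itv /= => /andP[x0 _]; apply: g_mono => //; exact: ltW.
have ap : 0 < a by rewrite lt_def an0.
have -> : `]0, b[%classic = `]0, a[ `|` `[a, b[ :> set R.
  apply/seteqP; split => x /=; rewrite !in_itv /=.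
    by move=> /andP[x0 xb]; case: (ltP x a) => xa; [left; rewrite x0|right].
  by move=> [/andP[x0 xa]|/andP[xa xb]]; rewrite ?x0 ?xb /= ?andbT; lra.
have int : mu.-integrable (`]0, a[ `|` `[a, b[) (EFin \o g).
  apply: (@integrableS _ _ _ mu `]0, b[) => //; last exact: monotone_integrable.
    exact: measurableU.
  by move=> x [] /=; rewrite !in_itv /= => /andP[]; lra.
rewrite Rintegral_setU //; last first.
  apply/disj_setPS => x [] /=; rewrite !in_itv /= => /andP[_ xa] /andP[ax _].
  by move: (lt_le_trans xa ax); rewrite ltxx.
apply: lerD; first by apply: IH; exact: ltnW.
rewrite [leLHS](_ : _ = \int[mu]_(x in `[a, b[) g a); last first.
  by rewrite Rintegral_cst //= lebesgue_measure_itv /= lte_fin ab -EFinD /= ba.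
apply: le_Rintegral => //.
- apply: measurable_bounded_integrable => //.
    by rewrite /= lebesgue_measure_itv /=; case: ifP => _; rewrite ?ltry // -EFinD ltry.
  by exists `|g a|; split=> [|M hM x _]; [exact: num_real|exact: ltW].
- by apply: (@integrableS _ _ _ mu (`]0, a[ `|` `[a, b[)) => //; exact: measurableU.
- by move=> x /=; rewrite in_itv /= => /andP[xa _]; exact: g_mono.
Qed.

End RiemannSum.

Section Telescope.
Context {R : realType} {n : nat}.
Variable J : 'M[R]_n.
Hypothesis J_sym : forall i j, J i j = J j i.
Hypothesis J_ge0 : forall i j, 0 <= J i j.
Hypothesis J_psd : forall x, 0 <= inner x (J *m x).

(** N steps of size h ^ 2 = 1 / N lead from 0 to 1.  Their losses add up to a Riemann
    sum of the susceptibility and a total error of order h, which vanishes in the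
    limit. *)
Lemma tensorizes_chi :
  tensorizes J 1 (expR (- 2 * opnorm J * \int[lebesgue_measure]_(l in `]0, 1[) chi J l)).
Proof.
have [K [h0 [K0 h00 step]]] := tensorizes_step J J_sym J_ge0 J_psd.
set I := \int[_]_(_ in _) _; set c := expR _.
have discrete N : (0 < N)%N -> (Num.sqrt N%:R)^-1 <= h0 ->
    tensorizes J 1 (c * expR (- (K * (Num.sqrt N%:R)^-1))).
  move=> N0; set h := (Num.sqrt _)^-1 => hh0.
  have NR : 0 < N%:R :> R by rewrite ltr0n.
  have hp : 0 < h by rewrite invr_gt0 sqrtr_gt0.
  have h2 : h ^+ 2 = N%:R^-1 by rewrite exprVn sqr_sqrtr // ltW.
  pose loss k : R := \sum_(i < k) (2 * (opnorm J * chi J (i%:R / N%:R)) * h ^+ 2 + K * h ^+ 3).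
  have iter k : (k <= N)%N -> tensorizes J (k%:R / N%:R) (expR (- loss k)).
    elim: k => [_|k IH kN].
      by rewrite /loss big_ord0 oppr0 expR0 mul0r; exact: tensorizes0.
    have kN1 : 0 <= (k%:R / N%:R : R) <= 1.
      by rewrite divr_ge0 //= ler_pdivrMr // mul1r ler_nat ltnW.
    have hb : 0 < h <= h0 by rewrite hp.
    have -> : k.+1%:R / N%:R = k%:R / N%:R + h ^+ 2 :> R by rewrite h2 -natr1 mulrDl mul1r.
    have -> : - loss k.+1 = - loss k -
        (2 * (opnorm J * chi J (k%:R / N%:R)) * h ^+ 2 + K * h ^+ 3).
      by rewrite /loss big_ord_recr /= opprD.
    by rewrite expRD; exact: step (IH (ltnW kN)).
  have := iter N (leqnn N); rewrite divff ?gt_eqF //.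
  apply: tensorizes_le; rewrite /c -expRD ler_expR.
  have L0 : 0 <= 2 * opnorm J by rewrite mulr_ge0 // opnorm_ge0.
  have := ler_wpM2l L0 (riemann_sum_le (chi J) (chi_mono J J_sym J_ge0) N N0).
  rewrite -/I; suff -> : loss N = 2 * opnorm J * (\sum_(i < N) chi J (i%:R / N%:R) / N%:R) + K * h.
    by lra.
  rewrite /loss big_split /= sumr_const card_ord; congr (_ + _).
    by rewrite mulr_sumr; apply: eq_bigr => i _; rewrite h2; ring.
  rewrite -mulr_natl (exprSr h 2) h2; field; exact: lt0r_neq0.
move=> v f f0; rewrite -subr_le0.
have U0 : 0 <= went (ising_weight (1 *: J) v) f.
  by apply: went_ge0 => // x; exact: ising_weight_gt0.
set U := went _ f in U0 *; set V := local_ent _ f.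
apply: (@le0_of_le_small _ h0 _ (K * c * U)) => // t t0 th0.
pose N := Num.bound (t ^- 2).
have tN : t ^- 2 < N%:R by apply: archi_boundP; rewrite invr_ge0 sqr_ge0.
have t2 : 0 < t ^- 2 by rewrite invr_gt0 exprn_gt0.
have NR : 0 < N%:R :> R by exact: lt_trans t2 tN.
have N0 : (0 < N)%N by move: NR; rewrite ltr0n.
set h := (Num.sqrt (N%:R : R))^-1.
have ht : h <= t.
  rewrite -[leRHS]invrK lef_pV2 ?posrE ?invr_gt0 ?sqrtr_gt0 //.
  by rewrite -[leLHS]ger0_norm ?invr_ge0 ?(ltW t0) // -sqrtr_sqr ler_wsqrtr // exprVn ltW.
have := discrete N N0 (le_trans ht th0) v f f0; rewrite -/h -/U -/V => le1.
have cU : 0 <= c * U by rewrite mulr_ge0 // expR_ge0.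
have := ler_wpM2l cU (expR_ge1Dx (- (K * h))).
have := ler_wpM2l (mulr_ge0 K0 cU) ht.
by lra.
Qed.

End Telescope.

(** * The modified log-Sobolev inequality *)

Section EntropyDecay.
Context {R : realType} {n : nat}.

Lemma ising_gt0 (A : 'M[R]_n) v x : 0 < ising A v x.
Proof. by rewrite divr_gt0 ?ising_weight_gt0 ?ising_weight_sum_gt0. Qed.

Lemma ising_sum1 (A : 'M[R]_n) v : \sum_x ising A v x = 1.
Proof. by rewrite -mulr_suml divff // gt_eqF // ising_weight_sum_gt0. Qed.

Lemma Ent_went (nu f : cube n -> R) : \sum_x nu x = 1 -> Ent nu f = went nu f.
Proof. by move=> nu1; rewrite /Ent /went nu1 divr1. Qed.

(** Both sides are homogeneous in the measure, so the normalization drops out. *)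
Lemma ising_ent_le (J : 'M[R]_n) v f c : tensorizes J 1 c -> (forall x, 0 <= f x) ->
  c * Ent (ising J v) f <= local_ent (ising J v) f.
Proof.
move=> Tc f0; rewrite Ent_went ?ising_sum1 //.
have Z0 := ising_weight_sum_gt0 J v.
have -> : ising J v = fun x => (\sum_y ising_weight J v y)^-1 * ising_weight J v x.
  by apply/funext => x; rewrite /ising mulrC.
rewrite went_scale ?local_ent_scale ?invr_eq0 ?gt_eqF // mulrCA ler_pM2l ?invr_gt0 //.
by have := Tc v f f0; rewrite scale1r.
Qed.

Lemma rho_LS_ge (nu : cube n -> R) c : (0 < n)%N -> (forall x, 0 < nu x) ->
  \sum_x nu x = 1 ->
  (forall f, (forall x, 0 <= f x) -> c * Ent nu f <= local_ent nu f) ->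
  ((n%:R^-1 * c)%:E <= rho_LS nu (glauber nu))%E.
Proof.
move=> n0 nu0 nu1 hc.
have ub : (ereal_sup [set (Ent nu (kernel_app (glauber nu) f) / Ent nu f)%R%:E
     | f in [set f : cube n -> R | (forall x, 0 <= f x) /\ 0 < Ent nu f]%R]
   <= (1 - n%:R^-1 * c)%:E)%E.
  apply: ge_ereal_sup => _ [f [f0 Ef] <-]; rewrite lee_fin ler_pdivrMr //.
  have := Ent_glauber nu f n0 nu0 nu1 f0.
  have := hc f f0; rewrite -(@ler_pM2l _ n%:R^-1) ?invr_gt0 ?ltr0n //; lra.
rewrite /rho_LS; move: ub; case: (ereal_sup _) => [r||] //=.
  by rewrite -EFinB !lee_fin lerBrDr addrC -lerBrDr.
by rewrite leey.
Qed.

Lemma posdefmx_sym (J : 'M[R]_n) : posdefmx J -> forall i j, J i j = J j i.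
Proof.
move=> [/is_hermitianmxP sym _] i j; rewrite {1}sym expr0 scale1r !mxE //.
Qed.

Lemma posdefmx_psd (J : 'M[R]_n) : posdefmx J -> forall x, 0 <= inner x (J *m x).
Proof.
move=> [_ pos] x; have [->|x0] := eqVneq x 0; last by rewrite ltW // pos.
by rewrite mulmx0 inner_ge0.
Qed.

Lemma ferromagnetic_posdefmx_ge0 (J : 'M[R]_n) : posdefmx J -> ferromagnetic J ->
  forall i j, 0 <= J i j.
Proof.
move=> Jpos Jferro i j; have [->|ij] := eqVneq i j; last exact: Jferro.
have := posdefmx_psd J Jpos (delta_mx j 0).
rewrite /inner (bigD1 j) //= big1 => [|k kj]; last by rewrite mxE (negbTE kj) mul0r.
by rewrite -colE !mxE !eqxx mul1r addr0.
Qed.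

End EntropyDecay.

Theorem corollary54 (R : realType) (n : nat) (hn : (0 < n)%N)
    (J : 'M[R]_n) (v : 'cV[R]_n)
    (hJ : posdefmx J) (hferro : ferromagnetic J) :
  ((n%:R^-1 * expR (- 2 * opnorm J
      * \int[lebesgue_measure]_(lambda in `]0, 1[) chi J lambda)%R)%:E
    <= rho_LS (ising J v) (glauber (ising J v)))%E.
Proof.
apply: rho_LS_ge => // [x||f f0]; [exact: ising_gt0|exact: ising_sum1|].
apply: ising_ent_le => //; apply: tensorizes_chi.
- exact: posdefmx_sym.
- exact: ferromagnetic_posdefmx_ge0.
- exact: posdefmx_psd.
Qed.
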